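(* Let $N=2$, $2<p<\infty$, $m^-=0$, and let $u\ge0$ be a weak solution of the Dirichlet problem $$\Delta_p u=\partial_z\beta(u)\ \text{in }\mathcal C_L,\qquad u(x,0)=0,\quad u(x,L)=m^+\ (x\in\Omega),\qquad u=g\ \text{on }\Sigma,$$ such that $u$ is nondecreasing in the $z$-direction, where $g\in W^{2,2+\eta_0}(\Sigma)$ for some $\eta_0>0$. Then there is a constant $\mu>0$ such that $$u(X)\le\mu|X-X_0|\qquad (X\in\mathcal C_L)$$ for any $X_0\in\partial\{u>0\}\cap\Sigma$.
   Context: Here $N=2$: $\Omega\subset\mathbb R$ is a bounded open interval, $L>0$, $\mathcal C_L=\Omega\times(0,L)\subset\mathbb R^2$, with points $X=(x,z)$, and $\Sigma=\partial\Omega\times(0,L)$ is the lateral boundary (two segments). $\Delta_p u=\operatorname{div}(|\nabla u|^{p-2}\nabla u)$. $m^+>0$ is a constant. The boundary datum $g$ is $C^{1,\alpha}$ for some $\alpha\in(0,1)$ and satisfies $g(x,0)=-m^-=0$, $g(x,L)=m^+$ for $x\in\partial\Omega$. Given constants $a>0$, $\ell>0$, $\beta$ is the maximal monotone graph $\beta(s)=as$ for $s<0$, $\beta(0)=[0,\ell]$, $\beta(s)=as+\ell$ for $s>0$. A weak solution of the Dirichlet problem is $u\in W^{1,p}(\mathcal C_L)$ (together with a measurable $\eta\in\beta(u)$ a.e.) attaining the stated boundary values in the trace sense and satisfying $$-\int_{\mathcal C_L}\eta\,\partial_z\phi+\int_{\mathcal C_L}|\nabla u|^{p-2}\nabla u\cdot\nabla\phi=0\qquad\forall\phi\in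 W^{1,p}_0(\mathcal C_L).$$ It is bounded, and $u$ is identified with its continuous representative; points of $\partial\{u>0\}\cap\Sigma$ are the contact points of the free boundary with the lateral boundary. *)

(* Defs.v *)
(* Points of the plane are pairs [X = (x, z) : R * R]. *)
From HB Require Import structures.
From mathcomp Require Import all_boot all_order all_algebra.
From mathcomp Require Import all_classical all_reals all_analysis.

Set Implicit Arguments.
Unset Strict Implicit.
Unset Printing Implicit Defensive.

Import Order.TTheory GRing.Theory Num.Theory.
Import numFieldNormedType.Exports.

Local Open Scope classical_set_scope.
Local Open Scope ring_scope.

Section Lp.
Context d (T : measurableType d) (R : realType).
Variables (mu : {measure set T -> \bar R}) (D : set T) (p : R).

(* [f \_ D] is [f] extended by [0] outside [D]; values off [D] are irrelevant. *)
Definition in_Lp (f : T -> R) : Prop := f \_ D \in Lfun mu p%:E.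

Definition cvg_Lp (v : nat -> T -> R) (f : T -> R) : Prop :=
  [/\ forall n, in_Lp (v n), in_Lp f &
      ('N[mu]_p%:E[EFin \o ((v n \- f)%R \_ D)])%E @[n --> \oo] --> 0%E].

End Lp.

Section OneVariable.
Context (R : realType).
Implicit Types (I : set R) (h : R -> R).

Definition smooth1 h : Prop := forall n t, derivable (derive1n n h) t 1.

Definition test_fun1 I h : Prop :=
  smooth1 h /\
  exists K, [/\ compact K, K `<=` I & forall t, ~ K t -> h t = 0].

Definition weak_deriv1 I h h' : Prop :=
  forall phi, test_fun1 I phi ->
    \int[lebesgue_measure]_(t in I) (h t * derive1 phi t) =
    - (\int[lebesgue_measure]_(t in I) (h' t * phi t)).

Definition W2q q I h : Prop :=
  exists h' h'', [/\ in_Lp lebesgue_measure I q h,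
                     in_Lp lebesgue_measure I q h',
                     in_Lp lebesgue_measure I q h'',
                     weak_deriv1 I h h' & weak_deriv1 I h' h''].

(* [C^{1,alpha}([s, t])]; the last clause is on the closed interval, so [h']
   is the continuous extension of the derivative to the end points. *)
Definition C1alpha (alpha s t : R) h : Prop :=
  {within `[s, t], continuous h} /\
  exists h', (forall r, r \in `]s, t[ -> is_derive r 1 h (h' r)) /\
    exists C, forall r1 r2, r1 \in `[s, t] -> r2 \in `[s, t] ->
      `|h' r1 - h' r2| <= C * `|r1 - r2| `^ alpha.

End OneVariable.

Section Plane.
Context (R : realType).
Implicit Types (D : set (R * R)) (f u ux uz : R * R -> R) (X Y : R * R).

(* [measurableTypeR R] is [R] with its Borel sigma-algebra, on which
   [lebesgue_measure] is declared *)
Definition leb2 :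
    {measure set (measurableTypeR R * measurableTypeR R) -> \bar R} :=
  (@lebesgue_measure R \x @lebesgue_measure R)%E.

Definition euclid_dist X Y : R :=
  Num.sqrt ((X.1 - Y.1) ^+ 2 + (X.2 - Y.2) ^+ 2).

Definition dx f X : R := 'D_((1, 0) : R * R) f X.
Definition dz f X : R := 'D_((0, 1) : R * R) f X.

Fixpoint Ck (k : nat) f : Prop :=
  if k is k'.+1 then
    [/\ continuous f,
        forall X, derivable f X ((1, 0) : R * R),
        forall X, derivable f X ((0, 1) : R * R),
        Ck k' (dx f) & Ck k' (dz f)]
  else continuous f.

Definition smooth2 f : Prop := forall k, Ck k f.

Definition test_fun2 D f : Prop :=
  smooth2 f /\
  exists K, [/\ compact K, K `<=` D & forall X, ~ K X -> f X = 0].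

(* [u] is in [W^{1,p}(D)] with weak gradient [(ux, uz)] *)
Definition W1p (p : R) D u ux uz : Prop :=
  [/\ in_Lp leb2 D p u, in_Lp leb2 D p ux, in_Lp leb2 D p uz &
      forall phi, test_fun2 D phi ->
        (\int[leb2]_(X in D) (u X * dx phi X) =
          - (\int[leb2]_(X in D) (ux X * phi X))) /\
        (\int[leb2]_(X in D) (u X * dz phi X) =
          - (\int[leb2]_(X in D) (uz X * phi X)))].

Definition cvg_W1p (p : R) D (v : nat -> R * R -> R) u ux uz : Prop :=
  [/\ cvg_Lp leb2 D p v u,
      cvg_Lp leb2 D p (fun n => dx (v n)) ux &
      cvg_Lp leb2 D p (fun n => dz (v n)) uz].

(* [u] is in [W^{1,p}_0(D)], the closure of the test functions in [W^{1,p}(D)],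
   and [(ux, uz)] is its weak gradient *)
Definition W1p0 (p : R) D u ux uz : Prop :=
  W1p p D u ux uz /\
  exists v, (forall n, test_fun2 D (v n)) /\ cvg_W1p p D v u ux uz.

(* topological boundary of [S] relative to the ambient set [A] *)
Definition rel_boundary (A S : set (R * R)) : set (R * R) :=
  A `&` closure (A `&` S) `&` closure (A `\` S).

End Plane.

Section Cylinder.
Context (R : realType).
Implicit Types (c d L p : R) (g h u ux uz : R * R -> R) (X : R * R).

(* Omega = ]c, d[ *)
Definition cyl c d L : set (R * R) := `]c, d[ `*` `]0, L[.
Definition ccyl c d L : set (R * R) := `[c, d] `*` `[0, L].
Definition lateral c d L : set (R * R) := [set c; d] `*` `]0, L[.

(* The trace of [u] on the boundary of the rectangle is [h]: the trace operator
   is the continuous extension to [W^{1,p}] of the restriction of functions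
   smooth up to the boundary; the boundary measure is the arc length, i.e. the
   Lebesgue measure on each of the four sides. *)
Definition has_trace p c d L u ux uz h : Prop :=
  exists v : nat -> R * R -> R,
    [/\ forall n, smooth2 (v n),
        cvg_W1p p (cyl c d L) v u ux uz,
        forall x, [set c; d] x ->
          cvg_Lp lebesgue_measure `]0, L[ p
            (fun n z => v n (x, z)) (fun z => h (x, z)) &
        forall z, [set 0; L] z ->
          cvg_Lp lebesgue_measure `]c, d[ p
            (fun n x => v n (x, z)) (fun x => h (x, z))].

(* [bot] on the bottom, [top] on the top, [g] on the lateral boundary *)
Definition boundary_datum L (bot top : R) g X : R :=
  if X.2 == 0 then bot else if X.2 == L then top else g X.

(* the maximal monotone graph, [beta_graph a l s] being the set of values at [s] *)
Definition beta_graph (a l s : R) : set R :=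
  if s < 0 then [set a * s]
  else if s == 0 then `[0, l]%classic
  else [set a * s + l].

(* weak solution of [Delta_p u = d_z beta(u)] in the cylinder with boundary
   values [h] *)
Definition weak_solution p a l c d L h u : Prop :=
  exists ux uz eta : R * R -> R,
    [/\ W1p p (cyl c d L) u ux uz,
        has_trace p c d L u ux uz h,
        measurable_fun (cyl c d L) eta,
        {ae leb2 R, forall X, cyl c d L X -> beta_graph a l (u X) (eta X)} &
        forall phi phix phiz, W1p0 p (cyl c d L) phi phix phiz ->
          - (\int[leb2 R]_(X in cyl c d L) (eta X * phiz X)) +
          (\int[leb2 R]_(X in cyl c d L)
            (Num.sqrt (ux X ^+ 2 + uz X ^+ 2) `^ (p - 2) *
               (ux X * phix X + uz X * phiz X))) = 0].

End Cylinder.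

(* Main.v *)
(* At a contact point [(e, z0)] the datum [g] vanishes and, being nonnegative on
   the whole side, also has zero derivative, so [g <= C |z - z0|^(1+alpha)] there.
   With [t] the distance to the side, [s = z - z0], [2 q = 1 + alpha] and
   [dl > 0], the function
     [W = A t - K ((t^2 + dl)^q - dl^q) + C (t^2 + s^2 + dl)^q]
   is smooth, has gradient at least 1, lies above [u] on the boundary and satisfies
   [Delta_p W <= a W_z] for [A], [K] chosen independently of [dl] and of the
   contact point. Testing the equation with [chi Phi(u - W - eps)], where [Phi] is
   a smooth function vanishing on the negative reals and [chi] a cutoff equal to a
   constant where [u > W + eps], gives [u <= W]: on the support of the test function
   [eta = a u + l], and the zeroth order contribution is an exact [z]-derivative.
   Taking [dl] to be the squared distance from [X] to the contact point yields the
   linear bound at [X].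
   Sobolev functions are handled through the smooth approximations provided by
   the trace, which also show that the continuous representative takes the
   boundary values pointwise. *)
Require Import Defs.
From HB Require Import structures.
From mathcomp Require Import all_boot all_order all_algebra.
From mathcomp Require Import all_classical all_reals all_analysis.
From mathcomp Require Import measurable_realfun ring lra.

Set Implicit Arguments.
Unset Strict Implicit.
Unset Printing Implicit Defensive.

Import Order.TTheory GRing.Theory Num.Theory.
Import numFieldNormedType.Exports.

Local Open Scope classical_set_scope.
Local Open Scope ring_scope.

(** * Convergence in L^p on a set of finite measure *)

(** The parameter [dl] keeps the barrier smooth: for [dl = 0] and [q < 1] its second derivatives
    blow up at the side. For [dl > 0] they are of size tau^(q-1), tau = t^2 + dl. The concave term
    contributes -(2q-1) K times this size to the normal second derivative, and the term in rho = t^2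
    + s^2 + dl at most a multiple of C times it, because rho >= tau. The drift a W_z is bounded in
    the same scale with a factor a L, whence the form of [K]. The lower bound for the gradient
    serves twice: the operator is nondegenerate along W, so its flux can be differentiated
    classically, and the field |V|^(p-2) V is quadratically monotone against grad W. The outer
    function Phi is flat at 0, so its compositions with the smooth approximations of u are test
    functions once multiplied by the cutoff, and positive parts of Sobolev functions never occur. It
    is chosen so that t Phi'(t) is again the derivative of a function of the same class; this makes
    (u - W - eps) times the z-derivative of the test function an exact derivative. *)

Lemma squeeze_cvge0 (R : realType) (s t : nat -> \bar R) :
  (forall n, (0 <= s n <= t n)%E) -> t n @[n --> \oo] --> 0%E ->
  s n @[n --> \oo] --> 0%E.
Proof.
move=> st ct; apply: (@squeeze_cvge _ _ _ R (fun=> 0%E) s t) ct => //.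
- by near do exact: st.
- exact: cvg_cst.
Unshelve. all: by end_near. Qed.

Lemma ge0_cvge0P (R : realType) (s : nat -> \bar R) : (forall n, (0 <= s n)%E) ->
  s n @[n --> \oo] --> 0%E <->
  (forall e : R, 0 < e -> \forall n \near \oo, (s n <= e%:E)%E).
Proof.
move=> s0; split => [/fine_cvgP[fs /cvgrPdist_le cs] e e0|H].
  have {}cs := cs e e0; near=> n.
  have fn : s n \is a fin_num by near: n.
  rewrite -(fineK fn) lee_fin; have : `|0 - fine (s n)| <= e by near: n.
  by rewrite sub0r normrN ger0_norm// fine_ge0.
have fs e : 0 < e -> \forall n \near \oo, s n \is a fin_num /\ fine (s n) <= e.
  move=> e0; have He := H e e0; near=> n.
  have sne : (s n <= e%:E)%E by near: n.
  have fn : s n \is a fin_num by rewrite ge0_fin_numE// (le_lt_trans sne)// ltry.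
  by split => //; rewrite -lee_fin fineK.
apply/fine_cvgP; split; first by apply: filterS (fs 1 ltr01) => n [].
apply/cvgrPdist_le => e /fs; apply: filterS => n [_ /= sne].
by rewrite sub0r normrN ger0_norm// fine_ge0.
Unshelve. all: by end_near. Qed.

Section LpTools.
Context d (T : measurableType d) (R : realType).
Variables (mu : {measure set T -> \bar R}) (D : set T) (p : R).
Hypotheses (mD : measurable D) (muD : (mu D < +oo)%E) (p1 : 1 <= p).
Implicit Types (f g : T -> R) (h k : nat -> T -> R).

Let p0 : 0 < p. Proof. exact: lt_le_trans ltr01 p1. Qed.

(** The p-th power of the norm. Estimates are carried out without the root, and [poweR_cvg0]
    translates convergence to 0 between the two forms. *)
Definition Lp_int f := (\int[mu]_(x in D) (`|f x| `^ p)%:E)%E.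

Lemma Lnorm_restrict f : ('N[mu]_p%:E[EFin \o (f \_ D)])%E = (Lp_int f `^ p^-1)%E.
Proof.
rewrite unlock /Lp_int [in RHS]integral_mkcond; congr (_ `^ _)%E.
apply: eq_integral => x _; rewrite /= patchE [RHS]patchE; case: ifPn => // _.
by rewrite /= normr0 powR0// gt_eqF.
Qed.

Lemma measurable_normpow f : measurable_fun D f ->
  measurable_fun D (fun x => `|f x| `^ p).
Proof.
move=> mf; apply: (measurableT_comp (measurable_powR _)) => //.
exact: measurableT_comp.
Qed.

Lemma in_LpP f : in_Lp mu D p f <->
  measurable_fun D f /\ mu.-integrable D (fun x => (`|f x| `^ p)%:E).
Proof.
rewrite /in_Lp; split => [|[mf fi]].
  rewrite inE => /andP[/[!inE]/= mf]; rewrite /finite_norm Lnorm_restrict => fy.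
  have {}mf : measurable_fun D f by exact: (measurable_restrictT f mD).2 mf.
  split => //; apply/integrableP; split.
    by apply/measurable_EFinP; exact: measurable_normpow.
  rewrite (eq_integral (fun x => (`|f x| `^ p)%:E)); last first.
    by move=> x _; rewrite /= ger0_norm// powR_ge0.
  by apply: (lty_poweRy _ fy); rewrite invr_eq0 gt_eqF.
apply/andP; rewrite !inE /=; split; first exact: (measurable_restrictT f mD).1.
rewrite /finite_norm Lnorm_restrict poweR_lty//.
move/integrableP : fi => [_]; rewrite (eq_integral (fun x => (`|f x| `^ p)%:E))//.
by move=> x _; rewrite /= ger0_norm// powR_ge0.
Qed.

Definition Lp_null h : Prop :=
  (forall n, measurable_fun D (h n)) /\
  Lp_int (h n) @[n --> \oo] --> 0%E.

Lemma Lp_int_ge0 f : (0 <= Lp_int f)%E.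
Proof. by apply: integral_ge0 => x _; rewrite lee_fin powR_ge0. Qed.

Lemma poweR_cvg0 (s : nat -> \bar R) (r : R) : 0 < r -> (forall n, (0 <= s n)%E) ->
  s n @[n --> \oo] --> 0%E -> (s n `^ r)%E @[n --> \oo] --> 0%E.
Proof.
move=> r0 s0 /fine_cvgP[fs cs]; apply/fine_cvgP; split.
  by near=> n; apply: fin_num_poweR; near: n.
apply/cvgrPdist_lt => e e0.
move/cvgrPdist_lt : cs => /(_ (e `^ r^-1) (powR_gt0 _ e0)).
move=> cs; near=> n.
have : `|0 - fine (s n)| < e `^ r^-1 by near: n.
rewrite !sub0r !normrN /= fine_poweR ger0_norm ?fine_ge0// => sne.
rewrite ger0_norm ?powR_ge0//.
have := @gt0_ltr_powR _ r r0 (fine (s n)) (e `^ r^-1).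
rewrite -powRrM mulVf ?gt_eqF// powRr1 ?ltW//; apply => //.
- by rewrite nnegrE fine_ge0.
- by rewrite nnegrE powR_ge0.
Unshelve. all: by end_near. Qed.

Lemma cvg_LpP h f : cvg_Lp mu D p h f <->
  [/\ forall n, in_Lp mu D p (h n), in_Lp mu D p f & Lp_null (fun n => h n \- f)].
Proof.
split=> -[h1 f1 H]; split => //.
  split=> [n|].
    by apply: measurable_funB; [have /in_LpP[] := h1 n|have /in_LpP[] := f1].
  have : (('N[mu]_p%:E[EFin \o ((h n \- f)%R \_ D)])%E `^ p)%E @[n --> \oo] --> 0%E.
    by apply: poweR_cvg0 => // n; exact: Lnorm_ge0.
  apply: cvg_trans; apply: near_eq_cvg; near=> n.
  rewrite Lnorm_restrict -poweRrM mulVf ?gt_eqF// poweRe1//.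
  exact: Lp_int_ge0.
move: H => [mh ch].
under eq_fun do rewrite Lnorm_restrict.
apply: poweR_cvg0 => //; first by rewrite invr_gt0.
by move=> n; exact: Lp_int_ge0.
Unshelve. all: by end_near. Qed.

Lemma Lp_null_le h k : Lp_null h -> (forall n, measurable_fun D (k n)) ->
  (forall n x, D x -> `|k n x| <= `|h n x|) -> Lp_null k.
Proof.
move=> [mh ch] mk kh; split; first exact: mk.
apply: (squeeze_cvge0 _ ch) => n; apply/andP; split.
  exact: Lp_int_ge0.
apply: ge0_le_integral => //.
- by apply/measurable_EFinP; exact: measurable_normpow.
- by apply/measurable_EFinP; exact: measurable_normpow.
- move=> x Dx; rewrite lee_fin; apply: ge0_ler_powR; rewrite ?nnegrE//.
  + exact: ltW.
  + exact: kh.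
Qed.

Lemma Lp_nullZ (a : R) h : Lp_null h -> Lp_null (fun n x => a * h n x).
Proof.
move=> [mh ch]; split.
  by move=> n; apply: measurable_funM.
have -> : (fun n => Lp_int (fun x => a * h n x)) =
    (fun n => ((`|a| `^ p)%:E * Lp_int (h n))%E).
  apply/funext => n; rewrite /Lp_int -ge0_integralZl//.
  - by apply: eq_integral => x _; rewrite normrM powRM.
  - by apply/measurable_EFinP; exact: measurable_normpow.
by rewrite -[X in _ --> X](mule0 (`|a| `^ p)%:E); exact: cvgeZl.
Qed.

Lemma normpowD_le (a b : R) : `|a + b| `^ p <= 2 `^ p * (`|a| `^ p + `|b| `^ p).
Proof.
have le2 (x y : R) : `|x| <= `|y| -> `|x + y| `^ p <= 2 `^ p * (`|x| `^ p + `|y| `^ p).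
  move=> xy; apply: (@le_trans _ _ ((2 * `|y|) `^ p)).
    apply: ge0_ler_powR; rewrite ?nnegrE ?mulr_ge0//; first exact: ltW.
    by rewrite (le_trans (ler_normD _ _))// mulr_natl mulr2n lerD2r.
  by rewrite powRM// ler_wpM2l ?powR_ge0// lerDr powR_ge0.
have [ab|/ltW ba] := leP `|a| `|b|; first exact: le2.
by rewrite addrC [X in _ * X]addrC; exact: le2.
Qed.

Lemma Lp_nullD h k : Lp_null h -> Lp_null k -> Lp_null (fun n x => h n x + k n x).
Proof.
move=> [mh ch] [mk ck]; split.
  by move=> n; apply: measurable_funD.
have c : ((2 `^ p)%:E * (Lp_int (h n) + Lp_int (k n)))%E @[n --> \oo] --> 0%E.
  rewrite -[X in _ --> X](mule0 (2 `^ p)%:E); apply: cvgeZl => //.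
  by rewrite -[X in _ --> X](adde0 0%E); apply: cvgeD; [by []|exact: ch|exact: ck].
apply: (squeeze_cvge0 _ c) => n; apply/andP; split.
  exact: Lp_int_ge0.
have mp f : measurable_fun D f -> measurable_fun D (fun x => (`|f x| `^ p)%:E).
  by move=> mf; apply/measurable_EFinP; exact: measurable_normpow.
have ge0p f x : D x -> (0 <= (`|f x| `^ p)%:E)%E by rewrite lee_fin powR_ge0.
have -> : (Lp_int (h n) + Lp_int (k n))%E =
    (\int[mu]_(x in D) ((`|h n x| `^ p)%:E + (`|k n x| `^ p)%:E))%E.
  by rewrite (ge0_integralD mu mD (ge0p (h n)) (mp _ (mh n)) (ge0p (k n)) (mp _ (mk n))).
have -> : ((2 `^ p)%:E * \int[mu]_(x in D) ((`|h n x| `^ p)%:E + (`|k n x| `^ p)%:E))%E =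
   (\int[mu]_(x in D) (2 `^ p * (`|h n x| `^ p + `|k n x| `^ p))%:E)%E.
  rewrite -ge0_integralZl ?lee_fin ?powR_ge0//.
  - exact: (emeasurable_funD (mp _ (mh n)) (mp _ (mk n))).
  - by move=> x _; rewrite lee_fin addr_ge0 ?powR_ge0.
apply: ge0_le_integral.
- exact: mD.
- by move=> x _; rewrite lee_fin powR_ge0.
- by apply: mp; exact: measurable_funD.
- apply/measurable_EFinP; apply: measurable_funM; first exact: measurable_cst.
  by apply: measurable_funD; exact: measurable_normpow.
- by move=> x Dx; rewrite lee_fin normpowD_le.
Qed.

Lemma bounded_integrable f (M : R) : measurable_fun D f ->
  (forall x, D x -> `|f x| <= M) -> mu.-integrable D (EFin \o f).
Proof.
move=> mf fM; apply: measurable_bounded_integrable => //.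
exists M; split; first exact: num_real.
by move=> y My x /= Dx; rewrite (le_trans (fM x Dx))// ltW.
Qed.

Lemma in_Lp_integrable f : in_Lp mu D p f -> mu.-integrable D (EFin \o f).
Proof.
move=> /in_LpP[mf fi].
have i1 : mu.-integrable D (fun x => (1 + `|f x| `^ p)%:E).
  apply: (eq_integrable mD (fun x => (1%:E + (`|f x| `^ p)%:E)%E)) => //.
  apply: integrableD => //; apply: (@bounded_integrable (fun=> 1) 1) => //.
  by move=> x _; rewrite normr1.
apply: (le_integrable mD _ _ i1) => //; first exact/measurable_EFinP.
move=> x Dx /=; rewrite lee_fin [leRHS]ger0_norm ?addr_ge0 ?powR_ge0//.
have [f1|/ltW f1] := leP `|f x| 1; first by rewrite (le_trans f1)// lerDl powR_ge0.
by rewrite (le_trans (le1r_powR f1 p1))// lerDr.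
Qed.

Lemma in_Lp_le f g : in_Lp mu D p f -> measurable_fun D g ->
  (forall x, D x -> `|g x| <= `|f x|) -> in_Lp mu D p g.
Proof.
move=> /in_LpP[mf fi] mg gf; apply/in_LpP; split => //.
apply: (le_integrable mD _ _ fi).
  by apply/measurable_EFinP; exact: measurable_normpow.
move=> x Dx /=; rewrite lee_fin 2!(ger0_norm (powR_ge0 _ _)).
by apply: ge0_ler_powR; rewrite ?nnegrE ?gf//; exact: ltW.
Qed.

Lemma in_Lp_bounded f (M : R) : measurable_fun D f ->
  (forall x, D x -> `|f x| <= M) -> in_Lp mu D p f.
Proof.
move=> mf fM; apply/in_LpP; split => //.
apply: (@bounded_integrable _ (M `^ p)); first exact: measurable_normpow.
move=> x Dx; rewrite (ger0_norm (powR_ge0 _ _)).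
apply: ge0_ler_powR; rewrite ?nnegrE ?fM//; first exact: ltW.
by rewrite (le_trans _ (fM x Dx)).
Qed.

Lemma in_LpZ (a : R) f : in_Lp mu D p f -> in_Lp mu D p (fun x => a * f x).
Proof.
move=> /in_LpP[mf fi]; apply/in_LpP; split; first exact: measurable_funM.
have -> : (fun x => (`|a * f x| `^ p)%:E) =
    (fun x => ((`|a| `^ p)%:E * (`|f x| `^ p)%:E)%E).
  by apply/funext => x; rewrite normrM powRM.
exact: integrableZl.
Qed.

Lemma in_LpD f g : in_Lp mu D p f -> in_Lp mu D p g -> in_Lp mu D p (f \+ g).
Proof.
move=> /in_LpP[mf fi] /in_LpP[mg gi]; apply/in_LpP.
split; first exact: measurable_funD.
apply: (le_integrable mD _ _ (integrableZl mD (2 `^ p) (integrableD mD fi gi))).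
  by apply/measurable_EFinP; apply: measurable_normpow; exact: measurable_funD.
move=> x Dx /=; rewrite lee_fin (ger0_norm (powR_ge0 _ _)).
rewrite [leRHS]ger0_norm ?mulr_ge0 ?addr_ge0 ?powR_ge0//.
exact: normpowD_le.
Qed.

Lemma in_LpM (B f : T -> R) (M : R) : in_Lp mu D p f -> measurable_fun D B ->
  (forall x, D x -> `|B x| <= M) -> in_Lp mu D p (fun x => B x * f x).
Proof.
move=> fp mB BM; apply: (in_Lp_le (in_LpZ M fp)).
  by apply: measurable_funM => //; have /in_LpP[] := fp.
move=> x Dx; rewrite !normrM ler_wpM2r// (le_trans (BM x Dx))// ler_norm//.
Qed.

Lemma in_LpB f g : in_Lp mu D p f -> in_Lp mu D p g -> in_Lp mu D p (f \- g).
Proof.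
move=> fp gp; have -> : f \- g = f \+ (fun x => -1 * g x).
  by apply/funext => x /=; rewrite mulN1r.
exact/in_LpD/in_LpZ.
Qed.

(** A Young inequality with a small parameter takes the place of Hölder's: s <= k + k^(1-p) s^p for
    s >= 0, since s^(1-p) <= k^(1-p) once s > k. The choice of [k] makes k mu(D) at most e/2; the
    other half comes from n large. *)
Lemma Lp_null_L1 h : (forall n, in_Lp mu D p (h n)) -> Lp_null h ->
  forall e : R, 0 < e -> \forall n \near \oo, \int[mu]_(x in D) `|h n x| <= e.
Proof.
move=> hp [mh ch] e e0.
pose m := fine (mu D); have m0 : 0 <= m by exact: fine_ge0.
pose k := e / 2 / (m + 1); have k0 : 0 < k by rewrite !divr_gt0// ltr_wpDl.
pose C := k `^ (1 - p); have C0 : 0 < C by exact: powR_gt0.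
have /ge0_cvge0P := ch => /(_ (fun n => Lp_int_ge0 (h n))) H.
have e2C : 0 < e / 2 / C by rewrite !divr_gt0.
apply: filterS (H _ e2C) => n hn.
have [_ hpi] := (in_LpP _).1 (hp n).
have young s : 0 <= s -> s <= k + C * s `^ p.
  move=> s0; have [sk|ks] := leP s k.
    by rewrite (le_trans sk)// lerDl mulr_ge0 ?powR_ge0// ltW.
  rewrite -[leLHS]add0r; apply: lerD; first exact: ltW.
  have s_gt0 : 0 < s by exact: lt_trans ks.
  rewrite -(mulr_powRB1 s0 p0) mulrCA -[leLHS]mulr1; apply: ler_wpM2l => //.
  rewrite /C -[1 - p]opprB powRN mulrC ler_pdivlMr ?powR_gt0// mul1r.
  by apply: ge0_ler_powR; rewrite ?nnegrE ?subr_ge0// ltW.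
apply: (@le_trans _ _ (\int[mu]_(x in D) (k + C * `|h n x| `^ p))).
  apply: le_Rintegral => //.
  - exact: (integrable_norm (in_Lp_integrable (hp n))).
  - apply: (integrableD mD (f := fun=> k%:E) (g := fun x => (C * _)%:E)).
      by apply: (@bounded_integrable (fun=> k) `|k|).
    exact: (integrableZl mD C hpi).
  - by move=> x _; exact: young.
rewrite RintegralD//; last 2 first.
- by apply: (@bounded_integrable (fun=> k) `|k|).
- exact: (integrableZl mD C hpi).
rewrite Rintegral_cst// RintegralZl// -/m (splitr e) lerD//.
  rewrite /k -mulrA ler_piMr ?divr_ge0 ?(ltW e0)//.
  by rewrite mulrC ler_pdivrMr ?ltr_wpDl// mul1r lerDl.
rewrite mulrC -ler_pdivlMr//.
have fn : Lp_int (h n) \is a fin_num.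
  by rewrite ge0_fin_numE ?Lp_int_ge0// (le_lt_trans hn)// ltry.
by rewrite /Rintegral -/(Lp_int (h n)) -lee_fin fineK.
Qed.

(** The device by which integral identities pass from smooth functions to their limits: the
    coefficient [B] is fixed and bounded, so convergence in mean is enough. *)
Lemma cvg_Lp_pairing h f (B : T -> R) (M : R) : cvg_Lp mu D p h f ->
  measurable_fun D B -> (forall x, D x -> `|B x| <= M) ->
  \int[mu]_(x in D) (B x * h n x) @[n --> \oo] --> \int[mu]_(x in D) (B x * f x).
Proof.
move=> /cvg_LpP[hp fp hf] mB BM.
have hfp n : in_Lp mu D p (h n \- f) by exact: in_LpB.
have int g : in_Lp mu D p g -> mu.-integrable D (EFin \o (fun x => B x * g x)).
  by move=> gp; apply: in_Lp_integrable; exact: in_LpM gp mB BM.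
have N0 : 0 < `|M| + 1 by rewrite ltr_wpDl.
apply/cvgrPdist_le => e e0.
have eN : 0 < e / (`|M| + 1) by rewrite divr_gt0.
apply: filterS (Lp_null_L1 hfp hf eN) => n hn.
rewrite distrC -RintegralB//; [|exact: int|exact: int].
rewrite (@eq_Rintegral _ _ _ _ _ (fun x => B x * (h n \- f) x)); last first.
  by move=> x _; rewrite /= mulrBr.
rewrite (le_trans (le_normr_Rintegral _ (int _ (hfp n))))//.
apply: (@le_trans _ _ (\int[mu]_(x in D) ((`|M| + 1) * `|(h n \- f) x|))).
  have i1 := integrable_norm (in_Lp_integrable (hfp n)).
  apply: le_Rintegral => //.
  - exact: (integrable_norm (int _ (hfp n))).
  - exact: (integrableZl mD (`|M| + 1) i1).
  - move=> x Dx; rewrite normrM ler_wpM2r// (le_trans (BM x Dx))//.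
    by rewrite (le_trans (ler_norm _))// lerDl.
rewrite RintegralZl//; last exact: integrable_norm (in_Lp_integrable (hfp n)).
by rewrite mulrC -ler_pdivlMr.
Qed.

(* Splitting at the level [`|F| = m] replaces almost everywhere convergence of a
   subsequence of [w]. *)
Lemma Lp_null_dominated w k (F : T -> R) : Lp_null w -> in_Lp mu D p F ->
  (forall n, measurable_fun D (k n)) ->
  (forall n x, D x -> `|k n x| <= `|F x|) ->
  (forall n x, D x -> `|k n x| <= `|w n x| * `|F x|) -> Lp_null k.
Proof.
move=> [mw cw] /in_LpP[mF iF] mk kF kwF; split; first exact: mk.
apply/ge0_cvge0P; first by move=> n; exact: Lp_int_ge0.
move=> e e0.
pose G (m : nat) x : R := (`|F x| `^ p) * (m%:R < `|F x|)%R%:R.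
have mG m : measurable_fun D (G m).
  apply: measurable_funM; first exact: measurable_normpow.
  apply: (@measurableT_comp _ _ _ _ _ _ (fun b : bool => b%:R : R)) => //.
  by apply: measurable_fun_ltr => //; exact: measurableT_comp.
have G0 m x : (0 <= (G m x)%:E)%E by rewrite lee_fin mulr_ge0// powR_ge0.
have : (\int[mu]_(x in D) (G m x)%:E)%E @[m --> \oo] --> 0%E.
  have := @dominated_convergence _ _ _ mu D mD (fun m x => (G m x)%:E) (fun=> 0%E)
    (fun x => (`|F x| `^ p)%:E).
  rewrite integral0 => -[] //.
  - by move=> m; apply/measurable_EFinP.
  - apply: aeW => x Dx.
    apply: cvg_near_cst; near=> m; rewrite /G.
    have -> : (m%:R < `|F x|) = false.
      by apply/negbTE; rewrite -leNgt; near: m; exact: nbhs_infty_ger.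
    by rewrite mulr0.
  - apply: aeW => x m Dx /=; rewrite lee_fin ger0_norm ?mulr_ge0 ?powR_ge0//.
    by rewrite ler_piMr ?powR_ge0// lern1 leq_b1.
move=> /ge0_cvge0P; move=> /(_ (fun m => integral_ge0 _ (fun x _ => G0 m x))).
have e2 : 0 < e / 2 by rewrite divr_gt0.
move=> /(_ _ e2)[m _ /(_ m (leqnn m)) /= Gm].
pose C := m%:R `^ p + 1 : R; have C0 : 0 < C by rewrite ltr_wpDl ?powR_ge0.
have e2C : 0 < e / 2 / C by rewrite !divr_gt0.
move/ge0_cvge0P : cw => /(_ (fun n => Lp_int_ge0 (w n))) /(_ _ e2C).
apply: filterS => n wn.
apply: (@le_trans _ _ (\int[mu]_(x in D) ((C * `|w n x| `^ p)%:E + (G m x)%:E))%E).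
  apply: ge0_le_integral.
  - exact: mD.
  - by move=> x _; rewrite lee_fin powR_ge0.
  - by apply/measurable_EFinP; exact: measurable_normpow.
  - apply: emeasurable_funD; apply/measurable_EFinP; last exact: mG.
    by apply: measurable_funM; [exact: measurable_cst|exact: measurable_normpow].
  - move=> x Dx; rewrite -EFinD lee_fin /G; case: ltP => Fm.
      rewrite mulr1 -[leLHS]add0r lerD ?mulr_ge0 ?powR_ge0 ?(ltW C0)//.
      by apply: ge0_ler_powR; rewrite ?nnegrE ?kF// ltW.
    rewrite mulr0 addr0 (@le_trans _ _ ((`|w n x| * m%:R) `^ p))//.
      apply: ge0_ler_powR; rewrite ?nnegrE ?mulr_ge0 ?(ltW p0)//.
      by rewrite (le_trans (kwF n x Dx))// ler_wpM2l.
    by rewrite powRM// mulrC ler_wpM2r ?powR_ge0// lerDl.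
have mw' : measurable_fun D (fun x => (`|w n x| `^ p)%:E).
  by apply/measurable_EFinP; exact: measurable_normpow.
have mCw : measurable_fun D (fun x => (C * `|w n x| `^ p)%:E).
  apply/measurable_EFinP; apply: measurable_funM; first exact: measurable_cst.
  exact: measurable_normpow.
have mGE : measurable_fun D (fun x => (G m x)%:E) by exact/measurable_EFinP.
have Cw0 x : D x -> (0 <= (C * `|w n x| `^ p)%:E)%E.
  by rewrite lee_fin mulr_ge0 ?powR_ge0// ltW.
rewrite (ge0_integralD mu mD Cw0 mCw (fun x _ => G0 m x) mGE).
rewrite (splitr e) EFinD; apply: leeD; last exact: Gm.
under eq_integral do rewrite EFinM.
rewrite (ge0_integralZl mu mD mw') ?lee_fin ?(ltW C0)//.
rewrite -/(Lp_int (w n)) (le_trans (lee_wpmul2l _ wn)) ?lee_fin ?(ltW C0)//.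
by rewrite mulrC divfK ?gt_eqF.
Unshelve. all: by end_near. Qed.

End LpTools.

(** * Calculus of smooth functions of two variables *)

Section Smooth.
Context (R : realType).
Implicit Types (f g : R * R -> R) (X : R * R) (x z : R).

(** A directional derivative sees only the restriction to a line, so equal restrictions have equal
    difference quotients. This moves partial derivatives between the plane and the line. *)
Lemma is_derive_lineW (V1 V2 : normedModType R) (f : V1 -> R) (g : V2 -> R)
    a v b w (df : R) : (forall h : R, f (h *: v + a) = g (h *: w + b)) ->
  is_derive a v f df -> is_derive b w g df.
Proof.
move=> fg; have fgab : f a = g b by have := fg 0; rewrite !scale0r !add0r.
have E : (fun h : R => h^-1 *: ((f \o shift a) (h *: v) - f a)) =
         (fun h => h^-1 *: ((g \o shift b) (h *: w) - g b)).
  by apply/funext => h; rewrite /= fg fgab.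
by move=> [fd <-]; split; [move: fd; rewrite /derivable E|rewrite /derive E].
Qed.

Lemma is_derive_line (f : R * R -> R) X v (df : R) :
  is_derive X v f df <-> is_derive (0 : R) 1 (fun h => f (h *: v + X)) df.
Proof.
split; apply: is_derive_lineW => h;
  by rewrite addr0 /GRing.scale/= mulr1.
Qed.

Lemma is_derive_dx f X (df : R) :
  is_derive X ((1, 0) : R * R) f df <-> is_derive X.1 1 (fun t => f (t, X.2)) df.
Proof.
have E (h : R) : h *: ((1, 0) : R * R) + X = (h *: 1 + X.1, X.2).
  by case: X => a b; congr pair; rewrite /= scaler0 add0r.
by split; apply: is_derive_lineW => h; rewrite E.
Qed.

Lemma is_derive_dz f X (df : R) :
  is_derive X ((0, 1) : R * R) f df <-> is_derive X.2 1 (fun t => f (X.1, t)) df.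
Proof.
have E (h : R) : h *: ((0, 1) : R * R) + X = (X.1, h *: 1 + X.2).
  by case: X => a b; congr pair; rewrite /= scaler0 add0r.
by split; apply: is_derive_lineW => h; rewrite E.
Qed.

Lemma Ck_continuous k f : Ck k f -> continuous f.
Proof. by case: k => [//|k [+ _ _ _ _]]. Qed.

Lemma CkW k f : Ck k.+1 f -> Ck k f.
Proof.
elim: k f => [|k IHk] f; first by case.
by move=> [cf dxf dzf fx fz]; split; [exact: cf|exact: dxf|exact: dzf|exact: (IHk _ fx)|exact: (IHk _ fz)].
Qed.

(* Packages the two partial derivatives as functions, so that closure
   properties follow by computing them. *)
Lemma CkS k f fx fz : continuous f ->
  (forall X, is_derive X ((1, 0) : R * R) f (fx X)) ->
  (forall X, is_derive X ((0, 1) : R * R) f (fz X)) ->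
  Ck k fx -> Ck k fz -> Ck k.+1 f.
Proof.
move=> cf dxf dzf kfx kfz; split.
- exact: cf.
- by move=> X; have [] := dxf X.
- by move=> X; have [] := dzf X.
- have -> : dx f = fx by apply/funext => X; have [_] := dxf X.
  exact: kfx.
- have -> : dz f = fz by apply/funext => X; have [_] := dzf X.
  exact: kfz.
Qed.

Lemma Ck_dx k f X : Ck k.+1 f -> is_derive X ((1, 0) : R * R) f (dx f X).
Proof. by move=> [_ d _ _ _]; apply: DeriveDef; [exact: d|]. Qed.

Lemma Ck_dz k f X : Ck k.+1 f -> is_derive X ((0, 1) : R * R) f (dz f X).
Proof. by move=> [_ _ d _ _]; apply: DeriveDef; [exact: d|]. Qed.

Lemma Ck_cst k (a : R) : Ck k (fun=> a).
Proof.
elim: k a => [|k IHk] a; first exact: cst_continuous.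
apply: (@CkS k _ (fun=> 0) (fun=> 0)); [|exact: (IHk 0)|exact: (IHk 0)].
exact: cst_continuous.
Qed.

Lemma Ck_fst k : Ck k (@fst R R).
Proof.
have c : continuous (@fst R R) by move=> X; exact: cvg_fst.
case: k => [//|k]; apply: (@CkS k _ (fun=> 1) (fun=> 0)); first exact: c.
- by move=> X; apply/is_derive_dx; exact: is_derive_id.
- by move=> X; apply/is_derive_dz; exact: is_derive_cst.
- exact: Ck_cst.
- exact: Ck_cst.
Qed.

Lemma Ck_snd k : Ck k (@snd R R).
Proof.
have c : continuous (@snd R R) by move=> X; exact: cvg_snd.
case: k => [//|k]; apply: (@CkS k _ (fun=> 0) (fun=> 1)); first exact: c.
- by move=> X; apply/is_derive_dx; exact: is_derive_cst.
- by move=> X; apply/is_derive_dz; exact: is_derive_id.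
- exact: Ck_cst.
- exact: Ck_cst.
Qed.

Lemma CkD k f g : Ck k f -> Ck k g -> Ck k (fun X => f X + g X).
Proof.
elim: k f g => [|k IHk] f g fk gk.
  by move=> X; apply: cvgD; [exact: fk|exact: gk].
apply: (@CkS k _ (fun X => dx f X + dx g X) (fun X => dz f X + dz g X)).
- by move=> X; apply: cvgD; [exact: Ck_continuous fk X|exact: Ck_continuous gk X].
- by move=> X; apply: is_deriveD; [exact: Ck_dx fk|exact: Ck_dx gk].
- by move=> X; apply: is_deriveD; [exact: Ck_dz fk|exact: Ck_dz gk].
- by case: fk gk => _ _ _ df _ [_ _ _ dg _]; exact: (IHk _ _ df dg).
- by case: fk gk => _ _ _ _ df [_ _ _ _ dg]; exact: (IHk _ _ df dg).
Qed.

Lemma CkM k f g : Ck k f -> Ck k g -> Ck k (fun X => f X * g X).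
Proof.
elim: k f g => [|k IHk] f g fk gk.
  by move=> X; apply: cvgM; [exact: fk|exact: gk].
apply: (@CkS k _ (fun X => f X * dx g X + g X * dx f X)
                 (fun X => f X * dz g X + g X * dz f X)).
- by move=> X; apply: cvgM; [exact: Ck_continuous fk X|exact: Ck_continuous gk X].
- by move=> X; apply: is_deriveM; [exact: Ck_dx fk|exact: Ck_dx gk].
- by move=> X; apply: is_deriveM; [exact: Ck_dz fk|exact: Ck_dz gk].
- have fk' := CkW fk; have gk' := CkW gk.
  case: fk gk => _ _ _ df _ [_ _ _ dg _].
  exact: (CkD (IHk _ _ fk' dg) (IHk _ _ gk' df)).
- have fk' := CkW fk; have gk' := CkW gk.
  case: fk gk => _ _ _ _ df [_ _ _ _ dg].
  exact: (CkD (IHk _ _ fk' dg) (IHk _ _ gk' df)).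
Qed.

Lemma is_derive_comp_dir (F : R -> R) f X v (dF df : R) :
  is_derive (f X) 1 F dF -> is_derive X v f df -> is_derive X v (F \o f) (dF * df).
Proof.
move=> hF /is_derive_line hf; apply/is_derive_line.
have := @is_derive1_comp R F (fun h => f (h *: v + X)) 0 dF df.
by apply => //; rewrite scale0r add0r.
Qed.

(* [G] lists the successive derivatives, on [U], of the outer function [G n]. *)
Lemma Ck_comp (G : nat -> R -> R) (U : set R) k n f :
  (forall m s, U s -> is_derive s 1 (G m) (G m.+1 s)) ->
  (forall X, U (f X)) -> Ck k f -> Ck k (G n \o f).
Proof.
move=> dG Uf; have cG m : continuous f -> continuous (G m \o f).
  move=> cf X; apply: continuous_comp; first exact: cf.
  have [dGm _] := dG m _ (Uf X).
  by apply: differentiable_continuous; apply/derivable1_diffP.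
elim: k n => [|k IHk] n fk; first exact: cG.
apply: (@CkS k _ (fun X => G n.+1 (f X) * dx f X) (fun X => G n.+1 (f X) * dz f X)).
- by apply: cG; exact: Ck_continuous fk.
- by move=> X; apply: is_derive_comp_dir; [exact: dG|exact: Ck_dx fk].
- by move=> X; apply: is_derive_comp_dir; [exact: dG|exact: Ck_dz fk].
- by have [_ _ _ df _] := fk; exact: (CkM (IHk n.+1 (CkW fk)) df).
- by have [_ _ _ _ df] := fk; exact: (CkM (IHk n.+1 (CkW fk)) df).
Qed.

End Smooth.

(** * Flat functions *)

Section Flat.
Context (R : realType).
Implicit Types (P : {poly R}) (t s : R).

(* [P(1/t) exp(-1/t)] for [t > 0], extended by [0]: a class of smooth functions,
   flat at [0], closed under differentiation. *)
Definition flat P t : R := if 0 < t then P.[t^-1] * expR (- t^-1) else 0.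

(** With y = 1/t one has d/dt = - y^2 d/dy, which sends P(y) exp(-y) to y^2 (P - P')(y) exp(-y). *)
Definition flat_deriv P : {poly R} := 'X^2 * (P - P^`()).

Lemma flat_le0 P t : t <= 0 -> flat P t = 0.
Proof. by move=> t0; rewrite /flat ltNge t0. Qed.

(** For n > 0 raise y/n <= exp(y/n) to the power n; this gives the bound n^n. *)
Lemma monomial_expRN_bounded n : exists M : R, forall y, 0 <= y -> y ^+ n * expR (- y) <= M.
Proof.
case: n => [|n].
  exists 1 => y y0; rewrite expr0 mul1r -[leRHS]expR0 ler_expR; lra.
exists (n.+1%:R ^+ n.+1) => y y0.
rewrite expRN ler_pdivrMr ?expR_gt0//.
have -> : y ^+ n.+1 = n.+1%:R ^+ n.+1 * (y / n.+1%:R) ^+ n.+1.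
  by rewrite -exprMn mulrC divfK// pnatr_eq0.
rewrite ler_wpM2l ?exprn_ge0//.
have -> : expR y = expR (y / n.+1%:R) ^+ n.+1.
  by rewrite -expRM_natr divfK// pnatr_eq0.
rewrite ler_pXn2r// ?nnegrE ?divr_ge0 ?expR_ge0//.
by rewrite (le_trans _ (expR_ge1Dx _))// lerDr.
Qed.

Lemma flat_bounded P : exists2 M : R, 0 <= M & forall t, `|flat P t| <= M.
Proof.
suff [M HM] : exists M : R, forall y, 0 <= y -> `|P.[y]| * expR (- y) <= M.
  have M0 : 0 <= M.
    by rewrite (le_trans _ (HM 0 (lexx 0)))// mulr_ge0 ?expR_ge0.
  exists M => // t; rewrite /flat; case: ifPn => [t0|_]; last by rewrite normr0.
  by rewrite normrM [`|expR _|]ger0_norm ?expR_ge0// HM// invr_ge0 ltW.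
have [C HC] := choice monomial_expRN_bounded.
exists (\sum_(i < size P) `|P`_i| * C i) => y y0.
rewrite horner_coef; apply: (@le_trans _ _ ((\sum_(i < size P) `|P`_i| * y ^+ i) * expR (- y))).
  rewrite ler_wpM2r ?expR_ge0// (le_trans (ler_norm_sum _ _ _))//.
  by apply: ler_sum => i _; rewrite normrM normrX (ger0_norm y0).
rewrite mulr_suml; apply: ler_sum => i _.
by rewrite -mulrA ler_wpM2l// HC.
Qed.

Lemma is_derive_flat P t : is_derive t 1 (flat P) (flat (flat_deriv P) t).
Proof.
have [t0|t0|->] := ltgtP t 0.
- rewrite flat_le0 ?ltW//.
  apply: (@near_eq_is_derive _ _ _ (cst 0)) => //.
  near=> s; rewrite flat_le0//; apply/ltW; near: s.
  exact: lt_nbhsl.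
- have Vne0 : t != 0 by rewrite gt_eqF.
  have dV : is_derive t 1 (fun s : R => s^-1) (- t ^- 2).
    apply: is_derive_eq; first exact: (is_deriveV Vne0 (is_derive_id t 1)).
    by rewrite /GRing.scale/= mulr1.
  have dVN : is_derive t 1 (fun s : R => - s^-1) (t ^- 2).
    by apply: is_derive_eq; rewrite opprK.
  have d1 := @is_derive1_comp R (horner P) (fun s : R => s^-1) t _ _ (is_derive_poly P t^-1) dV.
  have d2 := @is_derive1_comp R expR (fun s : R => - s^-1) t _ _ (is_derive_expR (- t^-1)) dVN.
  have d3 := is_deriveM d1 d2.
  apply: (@near_eq_is_derive _ _ _ ((horner P \o (fun s : R => s^-1)) *
                                    (expR \o (fun s : R => - s^-1)))).
    near=> s; rewrite /flat ifT//; near: s; exact: lt_nbhsr.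
  apply: is_derive_eq; rewrite /flat t0 /flat_deriv /= /GRing.scale/=.
  rewrite hornerM hornerD hornerN hornerXn -exprVn; ring.
- rewrite flat_le0//; apply/is_derive1_caratheodory.
  have [M M0 HM] := flat_bounded ('X^2 * P).
  (* The slope at 0: for s > 0, P(1/s) exp(-1/s) is s^2 times [flat ('X^2 * P) s]. The last factor
     is bounded, so the slope tends to 0. *)
  exists (fun s => s * flat ('X^2 * P) s); split.
  + move=> z; rewrite (flat_le0 _ (lexx 0)) !subr0 /flat.
    case: ifPn => z0; last by rewrite mulr0 mul0r.
    by rewrite hornerM hornerXn; field; rewrite gt_eqF.
  + apply/cvgrPdist_le => e e0.
    have sm : \forall s \near (0 : R), `|s| <= e / (M + 1).
      by apply: nbhs0_le; rewrite divr_gt0// ltr_wpDl.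
    apply: filterS sm => s sM; rewrite mul0r sub0r normrN normrM.
    apply: (@le_trans _ _ (`|s| * (M + 1))).
      by rewrite ler_wpM2l// (le_trans (HM s))// lerDl.
    by rewrite -ler_pdivlMr ?ltr_wpDl.
  + by rewrite mul0r.
Unshelve. all: by end_near. Qed.

Lemma flat_lipschitz P : exists2 M : R, 0 <= M &
  forall t s, `|flat P t - flat P s| <= M * `|t - s|.
Proof.
have [M M0 HM] := flat_bounded (flat_deriv P); exists M => //.
have cf : continuous (flat P).
  move=> x; apply: differentiable_continuous; apply/derivable1_diffP.
  by have [] := is_derive_flat P x.
suff H t s : s <= t -> `|flat P t - flat P s| <= M * `|t - s|.
  move=> t s; have [st|/ltW ts] := leP s t; first exact: H.
  by rewrite distrC [X in M * X]distrC; exact: H.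
move=> st; have cw : {within `[s, t], continuous (flat P)}.
  exact: continuous_subspaceT.
have [c _ ->] := MVT_segment st (fun x _ => is_derive_flat P x) cw.
by rewrite normrM ler_wpM2r.
Qed.

Lemma flat_continuous P : continuous (flat P).
Proof.
move=> x; apply: differentiable_continuous; apply/derivable1_diffP.
by have [] := is_derive_flat P x.
Qed.

Lemma measurable_flat P : measurable_fun setT (flat P).
Proof. by apply: continuous_measurable_fun; exact: flat_continuous. Qed.

Lemma smooth2_flat P (f : R * R -> R) : smooth2 f -> smooth2 (fun X => flat P (f X)).
Proof.
move=> sf k; apply: (@Ck_comp R (fun n => flat (iter n flat_deriv P)) setT k 0) => //.
by move=> m s _; exact: is_derive_flat.
Qed.

Lemma flat1_ge0 t : 0 <= flat 1 t.
Proof. by rewrite /flat; case: ifPn => // t0; rewrite hornerC mul1r expR_ge0. Qed.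

Lemma flat1_gt0 t : 0 < t -> 0 < flat 1 t.
Proof. by move=> t0; rewrite /flat t0 hornerC mul1r expR_gt0. Qed.

Lemma flat1_le s t : s <= t -> flat 1 s <= flat 1 t.
Proof.
move=> st; have [s0|s0] := leP s 0; first by rewrite (flat_le0 _ s0) flat1_ge0.
have t0 : 0 < t by exact: lt_le_trans st.
by rewrite /flat s0 t0 !hornerC !mul1r ler_expR lerN2 lef_pV2.
Qed.

Lemma flat_deriv1 : flat_deriv 1 = 'X^2.
Proof. by rewrite /flat_deriv derivC subr0 mulr1. Qed.

(** The reason for the polynomial [1 + 'X]: subtracting its derivative leaves ['X], so the
    truncation has the single nonnegative term [flat 'X^3] as its derivative. *)
Lemma flat_deriv1X : flat_deriv (1 + 'X) = 'X^3.
Proof. by rewrite /flat_deriv derivD derivC derivX add0r addrAC subrr add0r -exprSr. Qed.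

Lemma flat1X_ge0 t : 0 <= flat (1 + 'X) t.
Proof.
rewrite /flat; case: ifPn => // t0.
by rewrite mulr_ge0 ?expR_ge0// hornerD hornerC hornerX addr_ge0// invr_ge0 ltW.
Qed.

Lemma flat1X_gt0 t : 0 < t -> 0 < flat (1 + 'X) t.
Proof.
move=> t0; rewrite /flat t0 mulr_gt0 ?expR_gt0// hornerD hornerC hornerX.
by rewrite addr_gt0// invr_gt0.
Qed.

Lemma flatX3_ge0 t : 0 <= flat 'X^3 t.
Proof.
rewrite /flat; case: ifPn => // t0.
by rewrite mulr_ge0 ?expR_ge0// hornerXn exprn_ge0// invr_ge0 ltW.
Qed.

(** Multiplication by t lowers the degree in 1/t by one, and [flat 'X^2] is the derivative of
    [flat 1]. Hence t Phi'(t) is a derivative within the class when Phi is [flat (1 + 'X)]. *)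
Lemma mul_flatX3 t : t * flat 'X^3 t = flat 'X^2 t.
Proof.
rewrite /flat; case: ifPn => t0; last by rewrite mulr0.
by rewrite !hornerXn; field; rewrite gt_eqF.
Qed.

End Flat.

(** * Closure properties of smooth functions of two variables *)

Section Closure.
Context (R : realType).
Implicit Types (f g : R * R -> R).

Lemma smooth2_cst (a : R) : smooth2 (fun=> a).
Proof. by move=> k; exact: Ck_cst. Qed.

Lemma smooth2D f g : smooth2 f -> smooth2 g -> smooth2 (fun X => f X + g X).
Proof. by move=> sf sg k; exact: CkD. Qed.

Lemma smooth2M f g : smooth2 f -> smooth2 g -> smooth2 (fun X => f X * g X).
Proof. by move=> sf sg k; exact: CkM. Qed.

Lemma smooth2N f : smooth2 f -> smooth2 (fun X => - f X).
Proof.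
move=> sf; under eq_fun do rewrite -mulN1r.
by apply: smooth2M => //; exact: smooth2_cst.
Qed.

Lemma smooth2B f g : smooth2 f -> smooth2 g -> smooth2 (fun X => f X - g X).
Proof. by move=> sf sg; apply: smooth2D => //; exact: smooth2N. Qed.

Lemma smooth2_fst : smooth2 (@fst R R).
Proof. by move=> k; exact: Ck_fst. Qed.

Lemma smooth2_snd : smooth2 (@snd R R).
Proof. by move=> k; exact: Ck_snd. Qed.

Lemma smooth2_powR (q : R) f : smooth2 f -> (forall X, 0 < f X) ->
  smooth2 (fun X => f X `^ q).
Proof.
move=> sf f0 k.
(* The successive derivatives of s^q on s > 0, with falling factorials of q as coefficients. *)
pose G n s := (\prod_(i < n) (q - i%:R)) * s `^ (q - n%:R).
have -> : (fun X => f X `^ q) = G 0%N \o f.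
  by apply/funext => X; rewrite /G/= big_ord0 mul1r subr0.
apply: (@Ck_comp R G [set s | 0 < s]) => // m s /= s0.
have d : is_derive s 1 (G m)
    (\prod_(i < m) (q - i%:R) * ((q - m%:R) * s `^ (q - m%:R - 1))).
  have d0 := @is_derive1_powR R (q - m%:R) s s0.
  exact: (is_deriveZ (\prod_(i < m) (q - i%:R)) d0).
apply: (is_derive_eq d).
rewrite /G big_ord_recr /= -mulrA; congr (_ * (_ * _ `^ _)).
by rewrite -addn1 natrD opprD addrA.
Qed.

Lemma smooth2_derivex f X : smooth2 f -> is_derive X ((1, 0) : R * R) f (dx f X).
Proof. by move=> sf; exact: (Ck_dx X (sf 1%N)). Qed.

Lemma smooth2_derivez f X : smooth2 f -> is_derive X ((0, 1) : R * R) f (dz f X).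
Proof. by move=> sf; exact: (Ck_dz X (sf 1%N)). Qed.

Lemma smooth2_continuous f : smooth2 f -> continuous f.
Proof. by move=> sf; exact: sf 0%N. Qed.

Lemma smooth2_dx f : smooth2 f -> smooth2 (dx f).
Proof. by move=> sf k; have [_ _ _ + _] := sf k.+1. Qed.

Lemma smooth2_dz f : smooth2 f -> smooth2 (dz f).
Proof. by move=> sf k; have [_ _ _ _] := sf k.+1. Qed.

End Closure.

(** * Integration on rectangles *)

Section Plane.
Context (R : realType).
Notation leb := (@lebesgue_measure R).
Notation mu2 := (leb2 R).
Notation RR := (measurableTypeR R * measurableTypeR R)%type.
Implicit Types (f g : R * R -> R) (X : R * R).

(** The sigma-algebra of [leb2] is the product of two Borel sigma-algebras, so an open set is
    written as the union of the countably many boxes contained in it that have rational centre and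
    half-side 1/(n+1). *)
Lemma open_measurable2 (A : set (R * R)) : open A -> measurable (A : set RR).
Proof.
move=> oA.
pose e n : R := n.+1%:R^-1.
pose box (i : rat * rat * nat) : set (R * R) :=
  `]ratr i.1.1 - e i.2, ratr i.1.1 + e i.2[ `*` `]ratr i.1.2 - e i.2, ratr i.1.2 + e i.2[.
pose F i : set RR := if pselect (box i `<=` A) then box i else set0.
have -> : A = \bigcup_i F i.
  apply/seteqP; split => [[x z] Axz|X [i _]]; last first.
    by rewrite /F; case: pselect => [bA /bA|].
  have /nbhs_ballP[r /= r0 rA] : nbhs (x, z) A by apply: open_nbhs_nbhs.
  have [n nr] : exists n, e n < r / 2.
    have [n nP] := @ltr_add_invr R 0 (r / 2) (divr_gt0 r0 (ltr0Sn _ _)).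
    by exists n; rewrite add0r in nP.
  have en0 : 0 < e n by rewrite invr_gt0.
  have ex y : exists q : rat, `|y - ratr q| < e n.
    have [|q] := @rat_in_itvoo R (y - e n) (y + e n); first lra.
    by rewrite in_itv/= => /andP[q1 q2]; exists q; rewrite ltr_norml; apply/andP; split; lra.
  have [q1 hq1] := ex x; have [q2 hq2] := ex z.
  move: hq1 hq2; rewrite !ltr_norml => /andP[hx1 hx2] /andP[hz1 hz2].
  exists (q1, q2, n) => //; rewrite /F; case: pselect => [bA|nb] /=.
    by split; rewrite /= in_itv/=; apply/andP; split; lra.
  exfalso; apply: nb => -[y1 y2] []; rewrite /= !in_itv/= => /andP[? ?] /andP[? ?].
  by apply: rA; split; rewrite /ball/= ltr_norml; apply/andP; split; lra.
apply: countable_bigcupT_measurable; first exact: countableP.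
move=> i; rewrite /F; case: pselect => [bA|nb]; last exact: measurable0.
by apply: measurableX; exact: measurable_itv.
Qed.

Lemma continuous_measurable2 f : continuous f -> measurable_fun [set: RR] f.
Proof.
move=> /continuousP cf; apply: (measurability _ (RGenOpens.measurableE R)).
move=> _ [_ [a [b ->] <-]]; rewrite setTI; apply: open_measurable2.
exact/cf/interval_open.
Qed.

Definition rect (a1 b1 a2 b2 : R) : set (R * R) := `]a1, b1[ `*` `]a2, b2[.

Definition crect (a1 b1 a2 b2 : R) : set (R * R) := `[a1, b1] `*` `[a2, b2].

Section Rectangle.
Variables (a1 b1 a2 b2 : R).
Hypotheses (ab1 : a1 < b1) (ab2 : a2 < b2).
Notation D := (rect a1 b1 a2 b2 : set RR).

Lemma measurable_rect : measurable D.
Proof. by apply: measurableX; exact: measurable_itv. Qed.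

Lemma leb2_rect s1 t1 s2 t2 : s1 < t1 -> s2 < t2 ->
  mu2 (rect s1 t1 s2 t2) = ((t1 - s1) * (t2 - s2))%:E.
Proof.
move=> st1 st2; transitivity (leb `]s1, t1[ * leb `]s2, t2[)%E.
  by apply: product_measure1E; exact: measurable_itv.
by rewrite !lebesgue_measure_itv /= !lte_fin st1 st2.
Qed.

Lemma leb2_rect_lty : (mu2 D < +oo)%E.
Proof. by rewrite leb2_rect// ltry. Qed.

Lemma rect_sub_crect : D `<=` crect a1 b1 a2 b2.
Proof. by move=> X [? ?]; split; exact: subset_itv_oo_cc. Qed.

Lemma compact_crect : compact (crect a1 b1 a2 b2).
Proof. by apply: compact_setX; exact: segment_compact. Qed.

Lemma continuous_bounded_crect f : {within crect a1 b1 a2 b2, continuous f} ->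
  exists2 M : R, 0 <= M & forall X, crect a1 b1 a2 b2 X -> `|f X| <= M.
Proof.
move=> cf; have := compact_bounded (continuous_compact cf compact_crect).
move=> [M [Mreal HM]]; exists (`|M| + 1); first by rewrite addr_ge0.
move=> X DX; apply: (HM (`|M| + 1)); first by rewrite (le_lt_trans (ler_norm _))// ltrDl.
by exists X.
Qed.

Lemma Rint_iter_x f (h : R -> R) : mu2.-integrable D (EFin \o f) ->
  (forall z, z \in `]a2, b2[ ->
     (\int[leb]_(x in `]a1, b1[) (f (x, z))%:E = (h z)%:E)%E) ->
  \int[mu2]_(X in D) f X = \int[leb]_(z in `]a2, b2[) h z.
Proof.
move=> fi fh; congr fine; rewrite integral_mkcond [RHS]integral_mkcond.
have fi' := (@integrable_mkcond _ _ _ mu2 D (EFin \o f) measurable_rect).1 fi.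
rewrite -(integral21_prod_meas1 fi'); apply: eq_integral => z _.
rewrite /fubini_G /= patchE; case: ifPn => [zin|znin].
  rewrite -fh; last by rewrite inE in zin.
  rewrite [RHS]integral_mkcond; apply: eq_integral => x _.
  rewrite !patchE; congr (if _ then _ else _).
  apply/idP/idP; rewrite !inE; first by case.
  by move=> xin; split => //=; rewrite inE in zin.
rewrite integral0_eq// => x _; rewrite patchE ifF//; apply/negbTE.
by apply: contra znin; rewrite !inE => -[].
Qed.

Lemma Rint_iter_z f (h : R -> R) : mu2.-integrable D (EFin \o f) ->
  (forall x, x \in `]a1, b1[ ->
     (\int[leb]_(z in `]a2, b2[) (f (x, z))%:E = (h x)%:E)%E) ->
  \int[mu2]_(X in D) f X = \int[leb]_(x in `]a1, b1[) h x.
Proof.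
move=> fi fh; congr fine; rewrite integral_mkcond [RHS]integral_mkcond.
have fi' := (@integrable_mkcond _ _ _ mu2 D (EFin \o f) measurable_rect).1 fi.
rewrite -(integral12_prod_meas1 fi'); apply: eq_integral => x _.
rewrite /fubini_F /= patchE; case: ifPn => [xin|xnin].
  rewrite -fh; last by rewrite inE in xin.
  rewrite [RHS]integral_mkcond; apply: eq_integral => z _.
  rewrite !patchE; congr (if _ then _ else _).
  apply/idP/idP; rewrite !inE; first by case.
  by move=> zin; split => //=; rewrite inE in xin.
rewrite integral0_eq// => z _; rewrite patchE ifF//; apply/negbTE.
by apply: contra xnin; rewrite !inE => -[].
Qed.

End Rectangle.

Lemma FTC_oo (F f : R -> R) (a b : R) : a < b ->
  (forall x, x \in `[a, b] -> is_derive x 1 F (f x)) ->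
  {within `[a, b], continuous f} ->
  (\int[leb]_(x in `]a, b[) (f x)%:E = (F b - F a)%:E)%E.
Proof.
move=> ab dF cf.
have cF x : x \in `[a, b] -> {for x, continuous F}.
  move=> xab; have [dFx _] := dF x xab.
  by apply: differentiable_continuous; apply/derivable1_diffP.
have mf : measurable_fun `]a, b[ f.
  apply: (@measurable_funS _ _ _ _ `[a, b]) => //.
    exact: subset_itv_oo_cc.
  exact: subspace_continuous_measurable_fun.
rewrite -(@integral_itv_bndoo R a b (EFin \o f) true false); last exact/measurable_EFinP.
rewrite EFinB; apply: (continuous_FTC2 ab cf).
  split.
  - by move=> x xab; have [] := dF x (subset_itv_oo_cc xab).
  - by apply: cvg_at_right_filter; apply: cF; rewrite in_itv/= lexx ltW.
  - by apply: cvg_at_left_filter; apply: cF; rewrite in_itv/= lexx ltW.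
move=> x xab; have [_ <-] := dF x (subset_itv_oo_cc xab).
by rewrite derive1E.
Qed.

End Plane.

(** * Integration by parts *)

Section IntegrationByParts.
Context (R : realType).
Notation leb := (@lebesgue_measure R).
Notation mu2 := (leb2 R).
Notation RR := (measurableTypeR R * measurableTypeR R)%type.
Variables (a1 b1 a2 b2 : R).
Hypotheses (ab1 : a1 < b1) (ab2 : a2 < b2).
Notation D := (rect a1 b1 a2 b2 : set RR).
Implicit Types (f g phi B : R * R -> R).

Let mD : measurable D. Proof. exact: measurable_rect. Qed.
Let muD : (mu2 D < +oo)%E. Proof. exact: leb2_rect_lty. Qed.

Lemma is_derive_continuous (F : R -> R) (x dF : R) :
  is_derive x 1 F dF -> {for x, continuous F}.
Proof.
by move=> [dFx _]; apply: differentiable_continuous; apply/derivable1_diffP.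
Qed.

Lemma continuous_slice_x f z : continuous f -> continuous (fun t => f (t, z)).
Proof.
move=> cf x; have c : (fun t : R => (t, z)) @ x --> (x, z).
  by apply: (@cvg_pair R R R (nbhs x) (nbhs x) (nbhs z) _ _ _ id (fun=> z)); [exact: cvg_id|exact: cvg_cst].
by apply: (cvg_comp _ _ c); exact: cf.
Qed.

Lemma continuous_slice_z f x : continuous f -> continuous (fun t => f (x, t)).
Proof.
move=> cf z; have c : (fun t : R => (x, t)) @ z --> (x, z).
  by apply: (@cvg_pair R R R (nbhs z) (nbhs x) (nbhs z) _ _ _ (fun=> x) id); [exact: cvg_cst|exact: cvg_id].
by apply: (cvg_comp _ _ c); exact: cf.
Qed.

Lemma test_fun2_outside phi X : test_fun2 D phi -> ~ D X -> phi X = 0.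
Proof. by move=> [_ [K [_ KD H]]] nD; apply: H => /KD. Qed.

Lemma continuous_bounded_rect f : continuous f ->
  exists2 M : R, 0 <= M & forall X, D X -> `|f X| <= M.
Proof.
move=> cf; have cw : {within crect a1 b1 a2 b2, continuous f}.
  exact: continuous_subspaceT.
have [M M0 HM] := continuous_bounded_crect cw.
by exists M => // X DX; apply: HM; exact: rect_sub_crect.
Qed.

Lemma continuous_measurable_rect f : continuous f -> measurable_fun D f.
Proof. by move=> cf; apply: measurable_funTS; exact: continuous_measurable2. Qed.

Lemma measurable_bounded_integrable2 f (M : R) : measurable_fun D f ->
  (forall X, D X -> `|f X| <= M) -> mu2.-integrable D (EFin \o f).
Proof. by move=> mf fM; exact: (bounded_integrable mD muD mf fM). Qed.

Lemma integrable_mul_test B phi (M : R) : measurable_fun D B ->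
  (forall X, D X -> `|B X| <= M) -> continuous phi ->
  mu2.-integrable D (EFin \o (fun X => B X * phi X)).
Proof.
move=> mB BM cphi; have [N N0 HN] := continuous_bounded_rect cphi.
apply: (@measurable_bounded_integrable2 _ (M * N)).
  by apply: measurable_funM => //; exact: continuous_measurable_rect.
by move=> X DX; rewrite normrM ler_pM// ?BM// HN.
Qed.

Section X.
Variables (B Bx : R * R -> R) (M N : R).
Hypotheses (dB : forall x z, x \in `[a1, b1] -> z \in `]a2, b2[ ->
    is_derive x 1 (fun t => B (t, z)) (Bx (x, z)))
  (cBx : forall x z, x \in `[a1, b1] -> z \in `]a2, b2[ ->
    {for x, continuous (fun t => Bx (t, z))})
  (mB : measurable_fun D B) (mBx : measurable_fun D Bx)
  (BM : forall X, D X -> `|B X| <= M) (BxN : forall X, D X -> `|Bx X| <= N).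

(** On each horizontal slice the integrand is the derivative of [B phi], and [phi] vanishes at both
    ends. Differentiability of [B] is asked slice by slice only, up to the ends of the slice, which
    suits the flux of a function whose gradient is controlled on the closed rectangle. *)
Lemma ibp_x phi : test_fun2 D phi ->
  \int[mu2]_(X in D) (B X * dx phi X) = - \int[mu2]_(X in D) (Bx X * phi X).
Proof.
move=> tphi; have [sphi _] := tphi.
have cphi := smooth2_continuous sphi.
have cdphi := smooth2_continuous (smooth2_dx sphi).
have i1 := integrable_mul_test mB BM cdphi.
have i2 := integrable_mul_test mBx BxN cphi.
apply/eqP; rewrite -subr_eq0 opprK -RintegralD//; apply/eqP.
rewrite (@Rint_iter_x R a1 b1 a2 b2 _ (fun=> 0)); first last.
- move=> z zin.
  have cf : {within `[a1, b1],
      continuous (fun x => B (x, z) * dx phi (x, z) + Bx (x, z) * phi (x, z))}.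
    apply: continuous_in_subspaceT => x /[!inE] xin.
    apply: cvgD; apply: cvgM.
    + exact: (is_derive_continuous (dB xin zin)).
    + exact: (continuous_slice_x cdphi).
    + exact: (cBx xin zin).
    + exact: (continuous_slice_x cphi).
  have dF x : x \in `[a1, b1] -> is_derive x 1 (fun x => B (x, z) * phi (x, z))
      (B (x, z) * dx phi (x, z) + Bx (x, z) * phi (x, z)).
    move=> xin; have d2 : is_derive x 1 (fun t => phi (t, z)) (dx phi (x, z)).
      by have /is_derive_dx := smooth2_derivex (x, z) sphi.
    have d3 := is_deriveM (dB xin zin) d2.
    by apply: (is_derive_eq d3); rewrite /GRing.scale/= [phi _ * _]mulrC.
  rewrite (FTC_oo ab1 dF cf).
  rewrite !(test_fun2_outside tphi) ?mulr0 ?subr0//.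
  + by move=> [/=]; rewrite in_itv/= ltxx.
  + by move=> [/=]; rewrite in_itv/= ltxx andbF.
- exact: (integrableD mD i1 i2).
by rewrite /Rintegral integral0.
Qed.

Lemma ibp_x_cvg p (v : nat -> R * R -> R) phi phix : 1 <= p ->
  (forall n, test_fun2 D (v n)) -> cvg_Lp mu2 D p v phi ->
  cvg_Lp mu2 D p (fun n => dx (v n)) phix ->
  \int[mu2]_(X in D) (B X * phix X) = - \int[mu2]_(X in D) (Bx X * phi X).
Proof.
move=> p1 tv cv cdv.
have c1 := cvg_Lp_pairing mD muD p1 cdv mB BM.
have c2 : - (\int[mu2]_(X in D) (Bx X * v n X)) @[n --> \oo] -->
    - (\int[mu2]_(X in D) (Bx X * phi X)).
  by apply: cvgN; exact: (cvg_Lp_pairing mD muD p1 cv mBx BxN).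
have E : (fun n => \int[mu2]_(X in D) (B X * dx (v n) X)) =
    (fun n => - \int[mu2]_(X in D) (Bx X * v n X)).
  by apply/funext => n; rewrite ibp_x.
rewrite E in c1; rewrite -(cvg_lim (@Rhausdorff R) c1).
exact: (cvg_lim (@Rhausdorff R) c2).
Qed.

End X.

Section Z.
Variables (B Bz : R * R -> R) (M N : R).
Hypotheses (dB : forall x z, x \in `]a1, b1[ -> z \in `[a2, b2] ->
    is_derive z 1 (fun t => B (x, t)) (Bz (x, z)))
  (cBz : forall x z, x \in `]a1, b1[ -> z \in `[a2, b2] ->
    {for z, continuous (fun t => Bz (x, t))})
  (mB : measurable_fun D B) (mBz : measurable_fun D Bz)
  (BM : forall X, D X -> `|B X| <= M) (BzN : forall X, D X -> `|Bz X| <= N).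

Lemma ibp_z phi : test_fun2 D phi ->
  \int[mu2]_(X in D) (B X * dz phi X) = - \int[mu2]_(X in D) (Bz X * phi X).
Proof.
move=> tphi; have [sphi _] := tphi.
have cphi := smooth2_continuous sphi.
have cdphi := smooth2_continuous (smooth2_dz sphi).
have i1 := integrable_mul_test mB BM cdphi.
have i2 := integrable_mul_test mBz BzN cphi.
apply/eqP; rewrite -subr_eq0 opprK -RintegralD//; apply/eqP.
rewrite (@Rint_iter_z R a1 b1 a2 b2 _ (fun=> 0)); first last.
- move=> x xin.
  have cf : {within `[a2, b2],
      continuous (fun z => B (x, z) * dz phi (x, z) + Bz (x, z) * phi (x, z))}.
    apply: continuous_in_subspaceT => z /[!inE] zin.
    apply: cvgD; apply: cvgM.
    + exact: (is_derive_continuous (dB xin zin)).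
    + exact: (continuous_slice_z cdphi).
    + exact: (cBz xin zin).
    + exact: (continuous_slice_z cphi).
  have dF z : z \in `[a2, b2] -> is_derive z 1 (fun z => B (x, z) * phi (x, z))
      (B (x, z) * dz phi (x, z) + Bz (x, z) * phi (x, z)).
    move=> zin; have d2 : is_derive z 1 (fun t => phi (x, t)) (dz phi (x, z)).
      by have /is_derive_dz := smooth2_derivez (x, z) sphi.
    have d3 := is_deriveM (dB xin zin) d2.
    by apply: (is_derive_eq d3); rewrite /GRing.scale/= [phi _ * _]mulrC.
  rewrite (FTC_oo ab2 dF cf).
  rewrite !(test_fun2_outside tphi) ?mulr0 ?subr0//.
  + by move=> [_ /=]; rewrite in_itv/= ltxx.
  + by move=> [_ /=]; rewrite in_itv/= ltxx andbF.
- exact: (integrableD mD i1 i2).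
by rewrite /Rintegral integral0.
Qed.

Lemma ibp_z_cvg p (v : nat -> R * R -> R) phi phiz : 1 <= p ->
  (forall n, test_fun2 D (v n)) -> cvg_Lp mu2 D p v phi ->
  cvg_Lp mu2 D p (fun n => dz (v n)) phiz ->
  \int[mu2]_(X in D) (B X * phiz X) = - \int[mu2]_(X in D) (Bz X * phi X).
Proof.
move=> p1 tv cv cdv.
have c1 := cvg_Lp_pairing mD muD p1 cdv mB BM.
have c2 : - (\int[mu2]_(X in D) (Bz X * v n X)) @[n --> \oo] -->
    - (\int[mu2]_(X in D) (Bz X * phi X)).
  by apply: cvgN; exact: (cvg_Lp_pairing mD muD p1 cv mBz BzN).
have E : (fun n => \int[mu2]_(X in D) (B X * dz (v n) X)) =
    (fun n => - \int[mu2]_(X in D) (Bz X * v n X)).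
  by apply/funext => n; rewrite ibp_z.
rewrite E in c1; rewrite -(cvg_lim (@Rhausdorff R) c1).
exact: (cvg_lim (@Rhausdorff R) c2).
Qed.

End Z.

(** Limits of test functions have a weak gradient automatically: the defining identity is
    integration by parts with the test function [psi] as the fixed coefficient. *)
Lemma W1p0_intro p (v : nat -> R * R -> R) phi phix phiz : 1 <= p ->
  (forall n, test_fun2 D (v n)) -> cvg_W1p p D v phi phix phiz ->
  W1p0 p D phi phix phiz.
Proof.
move=> p1 tv [c1 c2 c3]; split; last by exists v.
have [_ ? _] := c1; have [_ ? _] := c2; have [_ ? _] := c3.
split => // psi [spsi _].
have cpsi := smooth2_continuous spsi.
have cx := smooth2_continuous (smooth2_dx spsi).
have cz := smooth2_continuous (smooth2_dz spsi).
have [M _ HM] := continuous_bounded_rect cpsi.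
have [Mx _ HMx] := continuous_bounded_rect cx.
have [Mz _ HMz] := continuous_bounded_rect cz.
split.
- under eq_Rintegral do rewrite mulrC.
  under [in RHS]eq_Rintegral do rewrite mulrC.
  apply/esym/eqP; rewrite eqr_oppLR; apply/eqP.
  apply: (ibp_x_cvg _ _ _ _ HM HMx p1 tv c1 c2).
  + by move=> x z _ _; have /is_derive_dx := smooth2_derivex (x, z) spsi.
  + by move=> x z _ _; exact: continuous_slice_x.
  + exact: continuous_measurable_rect.
  + exact: continuous_measurable_rect.
- under eq_Rintegral do rewrite mulrC.
  under [in RHS]eq_Rintegral do rewrite mulrC.
  apply/esym/eqP; rewrite eqr_oppLR; apply/eqP.
  apply: (ibp_z_cvg _ _ _ _ HM HMz p1 tv c1 c3).
  + by move=> x z _ _; have /is_derive_dz := smooth2_derivez (x, z) spsi.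
  + by move=> x z _ _; exact: continuous_slice_z.
  + exact: continuous_measurable_rect.
  + exact: continuous_measurable_rect.
Qed.

End IntegrationByParts.

(** * Exchanging the two coordinates *)

Section SwapLift.
Context (R : realType).
Notation leb := (@lebesgue_measure R).
Notation mu2 := (leb2 R).
Notation RR := (measurableTypeR R * measurableTypeR R)%type.

Definition swapRR (X : R * R) : R * R := (X.2, X.1).

Lemma measurable_swapRR : measurable_fun [set: RR] (swapRR : RR -> RR).
Proof. exact: measurable_swap. Qed.

(** Tonelli's theorem, applied in opposite orders to the two sides, yields the same iterated
    integral. *)
Lemma ge0_integral_swap (f : RR -> \bar R) : measurable_fun setT f ->
  (forall X, (0 <= f X)%E) ->
  (\int[mu2]_X f (swapRR X) = \int[mu2]_X f X)%E.
Proof.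
move=> mf f0.
have ms : measurable_fun setT (f \o swapRR) by exact: measurableT_comp measurable_swapRR.
transitivity (\int[leb]_x fubini_F leb (f \o swapRR) x)%E.
  by apply: (@fubini_tonelli1 _ _ _ _ _ leb leb (f \o swapRR) ms) => X; exact: f0.
by apply/esym; exact: (@fubini_tonelli2 _ _ _ _ _ leb leb f mf f0).
Qed.

Lemma rect_swap (a1 b1 a2 b2 : R) X :
  rect a2 b2 a1 b1 X <-> rect a1 b1 a2 b2 (swapRR X).
Proof. by split=> -[]. Qed.

Section Fixed.
Variables (a1 b1 a2 b2 p : R).
Hypotheses (ab1 : a1 < b1) (ab2 : a2 < b2) (p1 : 1 <= p).
Notation D := (rect a1 b1 a2 b2 : set RR).
Notation D' := (rect a2 b2 a1 b1 : set RR).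

Let mD : measurable D. Proof. exact: measurable_rect. Qed.
Let mD' : measurable D'. Proof. exact: measurable_rect. Qed.
Let muD : (mu2 D < +oo)%E. Proof. exact: leb2_rect_lty. Qed.

Lemma in_Lp_lty d (T : measurableType d) (mu : {measure set T -> \bar R})
    (E : set T) (f : T -> R) : measurable E ->
  in_Lp mu E p f <-> measurable_fun E f /\ (Lp_int mu E p f < +oo)%E.
Proof.
move=> mE; rewrite (in_LpP mu mE p1); split=> -[mf fi]; split => //.
  move/integrableP : fi => [_]; rewrite /Lp_int (eq_integral (fun x => (`|f x| `^ p)%:E))//.
  by move=> x _; rewrite /= (ger0_norm (powR_ge0 _ _)).
apply/integrableP; split.
  by apply/measurable_EFinP; exact: measurable_normpow.
rewrite (eq_integral (fun x => (`|f x| `^ p)%:E))//.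
by move=> x _; rewrite /= (ger0_norm (powR_ge0 _ _)).
Qed.

Lemma measurable_rect_swap (f : R * R -> R) : measurable_fun D f ->
  measurable_fun D' (f \o swapRR).
Proof.
move=> mf; apply: (@measurable_comp _ _ _ RR RR R D) => //.
  by move=> _ [X /rect_swap ? <-].
exact: measurable_funTS measurable_swapRR.
Qed.

Lemma Lp_int_swap (f : R * R -> R) : measurable_fun D f ->
  Lp_int mu2 D' p (f \o swapRR) = Lp_int mu2 D p f.
Proof.
move=> mf; rewrite /Lp_int integral_mkcond [RHS]integral_mkcond.
rewrite -[RHS]ge0_integral_swap; last 2 first.
- apply: (measurable_restrictT _ mD).1; apply/measurable_EFinP.
  exact: measurable_normpow.
- by move=> X; rewrite patchE; case: ifPn => // _; rewrite lee_fin powR_ge0.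
apply: eq_integral => X _; rewrite !patchE; congr (if _ then _ else _).
by apply/idP/idP; rewrite !inE => /rect_swap.
Qed.

Lemma cvg_Lp_swap (v : nat -> R * R -> R) (f : R * R -> R) :
  cvg_Lp mu2 D p v f -> cvg_Lp mu2 D' p (fun n => v n \o swapRR) (f \o swapRR).
Proof.
have inswap g : in_Lp mu2 D p g -> in_Lp mu2 D' p (g \o swapRR).
  move=> /(in_Lp_lty _ _ mD)[mg gi]; apply/(in_Lp_lty _ _ mD').
  by split; [exact: measurable_rect_swap|rewrite Lp_int_swap].
move=> /(cvg_LpP mu2 mD p1)[vp fp [mvf vf]]; apply/(cvg_LpP mu2 mD' p1).
split; [by move=> n; exact: inswap|exact: inswap|split].
  by move=> n; exact: (measurable_rect_swap (mvf n)).
have E : (fun n => Lp_int mu2 D' p ((v n \o swapRR) \- (f \o swapRR))) =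
    (fun n => Lp_int mu2 D p (v n \- f)).
  by apply/funext => n; exact: (Lp_int_swap (mvf n)).
by rewrite E.
Qed.

Lemma measurable_rect_snd (g : R -> R) : measurable_fun `]a2, b2[ g ->
  measurable_fun D (g \o snd).
Proof.
move=> mg; apply: (@measurable_comp _ _ _ RR (measurableTypeR R) R `]a2, b2[) => //.
  by move=> _ [X [_ ?] <-].
exact: measurable_funTS measurable_snd.
Qed.

Lemma Lp_int_snd (g : R -> R) : measurable_fun `]a2, b2[ g ->
  Lp_int mu2 D p (g \o snd) = ((b1 - a1)%:E * Lp_int leb `]a2, b2[ p g)%E.
Proof.
move=> mg; have mgp : measurable_fun `]a2, b2[ (fun z => (`|g z| `^ p)%:E).
  by apply/measurable_EFinP; exact: measurable_normpow.
have ba0 : (0 <= (b1 - a1)%:E)%E by rewrite lee_fin subr_ge0 ltW.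
rewrite /Lp_int -ge0_integralZl//.
rewrite integral_mkcond [RHS]integral_mkcond.
rewrite fubini_tonelli2; last 2 first.
- apply: (measurable_restrictT _ mD).1; apply/measurable_EFinP.
  by apply: measurable_normpow; exact: measurable_rect_snd.
- by move=> X; rewrite patchE; case: ifPn => // _; rewrite lee_fin powR_ge0.
apply: eq_integral => z _; rewrite /fubini_G patchE; case: ifPn => [|zn].
  rewrite inE => zin.
  transitivity (\int[leb]_(x in `]a1, b1[) (cst (`|g z| `^ p)%:E x))%E.
    rewrite [RHS]integral_mkcond; apply: eq_integral => x _; rewrite !patchE.
    congr (if _ then _ else _); apply/idP/idP; rewrite !inE; first by case.
    by move=> xin; split.
  rewrite integral_cst; last exact: measurable_itv.
  have L : leb `]a1, b1[ = (b1 - a1)%:E by rewrite lebesgue_measure_itv /= lte_fin ab1.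
  by rewrite [RHS]muleC; congr (_ * _)%E; exact: L.
rewrite integral0_eq// => x _; rewrite patchE ifF//; apply/negbTE.
by apply: contra zn; rewrite !inE => -[].
Qed.

(** Extending functions on a side constantly in x turns convergence of traces into convergence on
    the rectangle, where they can be integrated over strips together with the approximations
    themselves. *)
Lemma cvg_Lp_snd (g_ : nat -> R -> R) (g : R -> R) :
  cvg_Lp leb `]a2, b2[ p g_ g ->
  cvg_Lp mu2 D p (fun n => g_ n \o snd) (g \o snd).
Proof.
have mI : measurable (`]a2, b2[%classic : set (measurableTypeR R)).
  exact: measurable_itv.
have insnd h : in_Lp leb `]a2, b2[ p h -> in_Lp mu2 D p (h \o snd).
  move=> /(in_Lp_lty _ _ mI)[mh hi]; apply/(in_Lp_lty _ _ mD).
  split; first exact: measurable_rect_snd.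
  by rewrite Lp_int_snd// lte_mul_pinfty// lee_fin subr_ge0 ltW.
move=> /(cvg_LpP leb mI p1)[gp1 gp2 [mg cg]]; apply/(cvg_LpP mu2 mD p1).
split; [by move=> n; exact: insnd|exact: insnd|split].
  by move=> n; exact: (measurable_rect_snd (mg n)).
have E : (fun n => Lp_int mu2 D p ((g_ n \o snd) \- (g \o snd))) =
    (fun n => ((b1 - a1)%:E * Lp_int leb `]a2, b2[ p (g_ n \- g)%R))%E.
  by apply/funext => n; exact: (Lp_int_snd (mg n)).
by rewrite E -[X in _ --> X](mule0 (b1 - a1)%:E); apply: cvgeZl.
Qed.

End Fixed.
End SwapLift.

(** * Pointwise boundary values *)

Section Within.
Context (R : realType).

Lemma within_continuous_dist2 (A : set (R * R)) (f : R * R -> R) X (e : R) :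
  {within A, continuous f} -> A X -> 0 < e ->
  exists2 r : R, 0 < r &
    forall Y, A Y -> `|Y.1 - X.1| < r -> `|Y.2 - X.2| < r -> `|f Y - f X| < e.
Proof.
move=> /subspace_continuousP cf AX e0.
have /cvgrPdist_lt /(_ e e0) := cf X AX.
rewrite /within /= => /nbhs_ballP[r /= r0 H]; exists r => // Y AY Y1 Y2.
rewrite distrC; apply: H => //; split; rewrite /ball/= distrC.
  exact: Y1.
exact: Y2.
Qed.

Lemma within_continuous_dist1 (A : set R) (f : R -> R) x (e : R) :
  {within A, continuous f} -> A x -> 0 < e ->
  exists2 r : R, 0 < r & forall y, A y -> `|y - x| < r -> `|f y - f x| < e.
Proof.
move=> /subspace_continuousP cf Ax e0.
have /cvgrPdist_lt /(_ e e0) := cf x Ax.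
rewrite /within /= => /nbhs_ballP[r /= r0 H]; exists r => // y Ay y1.
by rewrite distrC; apply: H => //; rewrite /ball/= distrC.
Qed.

End Within.

(** * The trace on a vertical side *)

Section Trace.
Context (R : realType).
Notation leb := (@lebesgue_measure R).
Notation mu2 := (leb2 R).
Notation RR := (measurableTypeR R * measurableTypeR R)%type.
Variables (a1 b1 a2 b2 p : R).
Hypotheses (ab1 : a1 < b1) (ab2 : a2 < b2) (p1 : 1 <= p).
Notation D := (rect a1 b1 a2 b2 : set RR).

Let mD : measurable D. Proof. exact: measurable_rect. Qed.
Let muD : (mu2 D < +oo)%E. Proof. exact: leb2_rect_lty. Qed.

(** In use [k] is the abscissa of the edge of the strip [S] opposite to the side. The weight
    vanishes there, so integrating it against an x-derivative compares the values on [S] with those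
    on the near edge only. *)
Definition strip_weight (k : R) (S : set (R * R)) (X : R * R) : R :=
  (k - X.1) * \1_S X.

Section Strip.
Variables (s t s2 t2 e k : R).
Hypotheses (st : s < t) (st2 : s2 < t2) (as1 : a1 <= s) (tb1 : t <= b1)
  (as2 : a2 <= s2) (tb2 : t2 <= b2)
  (ek : (e = s /\ k = t) \/ (e = t /\ k = s)).
Notation S := (rect s t s2 t2 : set RR).

Let mS : measurable S. Proof. exact: measurable_rect. Qed.

Let SD : S `<=` D.
Proof.
move=> X []; rewrite /= !in_itv/= => /andP[? ?] /andP[? ?].
split; rewrite /= in_itv/=; apply/andP; split.
- exact: le_lt_trans as1 _.
- exact: lt_le_trans tb1.
- exact: le_lt_trans as2 _.
- exact: lt_le_trans tb2.
Qed.

Let mindic : measurable_fun D (\1_S : R * R -> R).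
Proof. by apply: measurable_funTS; exact: measurable_indic. Qed.

Let indic_le1 X : D X -> `|(\1_S : R * R -> R) X| <= 1.
Proof. by rewrite indicE; case: (_ \in _); rewrite ?normr1 ?normr0. Qed.

Let mweight : measurable_fun D (strip_weight k S).
Proof.
apply: measurable_funM => //; apply: continuous_measurable_rect.
by move=> X; apply: cvgB; [exact: cvg_cst|exact: cvg_fst].
Qed.

Lemma strip_weight_le X : `|strip_weight k S X| <= (t - s) * \1_S X.
Proof.
rewrite /strip_weight normrM indicE; have [|_] := boolP (X \in S); last first.
  by rewrite normr0 !mulr0.
rewrite inE normr1 !mulr1 => -[]; rewrite /= in_itv/= => /andP[sx xt] _.
by rewrite ler_norml; apply/andP; split; case: ek => -[_ ->]; lra.
Qed.

Let weight_bounded X : D X -> `|strip_weight k S X| <= t - s.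
Proof.
by move=> DX; rewrite (le_trans (strip_weight_le X))// ler_piMr ?subr_ge0 ?(ltW st).
Qed.

(* On the slice at height [z] the integrand is the derivative of
   [(k - x) (v (x, z) - v (e, z))], which vanishes at both ends of [(s, t)]. *)
Lemma integral_strip_weight_smooth (v : R * R -> R) : smooth2 v ->
  \int[mu2]_(X in D) (strip_weight k S X * dx v X) =
  \int[mu2]_(X in D) (\1_S X * v X) - \int[mu2]_(X in D) (\1_S X * v (e, X.2)).
Proof.
move=> sv; have cv := smooth2_continuous sv.
have cdv := smooth2_continuous (smooth2_dx sv).
have cve : continuous (fun X : R * R => v (e, X.2)).
  move=> X; apply: (continuous_comp (f := snd) (g := fun z => v (e, z))).
    exact: cvg_snd.
  exact: continuous_slice_z.
have i1 := integrable_mul_test ab1 ab2 mweight weight_bounded cdv.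
have i2 := integrable_mul_test ab1 ab2 mindic indic_le1 cv.
have i3 := integrable_mul_test ab1 ab2 mindic indic_le1 cve.
apply/eqP; rewrite -RintegralB// -subr_eq0 -RintegralB//; last exact: (integrableB mD i2 i3).
rewrite (@Rint_iter_x R a1 b1 a2 b2 _ (fun=> 0)).
- by rewrite /Rintegral integral0.
- exact: (integrableB mD i1 (integrableB mD i2 i3)).
move=> z zin; pose F x := (k - x) * (v (x, z) - v (e, z)).
pose f x := (k - x) * dx v (x, z) - (v (x, z) - v (e, z)).
have [zJ|zJ] := boolP (z \in `]s2, t2[); last first.
  apply: integral0_eq => x _ /=; rewrite /strip_weight indicE memNset; last first.
    by move=> [_ /=]; rewrite (negbTE zJ).
  by rewrite mulr0 !mul0r !subr0.
transitivity (\int[leb]_(x in `]s, t[) (f x)%:E)%E.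
  rewrite integral_mkcond [RHS]integral_mkcond; apply: eq_integral => x _.
  rewrite !patchE; case: ifPn => xab; last first.
    rewrite ifF//; apply/negbTE; apply: contra xab; rewrite !inE /= !in_itv/=.
    by move=> /andP[sx xt]; rewrite (le_lt_trans as1 sx) (lt_le_trans xt tb1).
  rewrite /strip_weight indicE; case: ifPn => xst /=.
    by rewrite mem_set/=; [congr EFin; rewrite /f; ring|split => //; rewrite inE in xst].
  rewrite memNset/=; last first.
    by move=> [xs _]; move/negP: xst; apply; rewrite inE.
  by rewrite mulr0 !mul0r !subr0.
have cf : {within `[s, t], continuous f}.
  apply: continuous_subspaceT => x; apply: cvgB.
    apply: cvgM; last exact: (continuous_slice_x cdv).
    by apply: cvgB; [exact: cvg_cst|exact: cvg_id].
  by apply: cvgB; [exact: (continuous_slice_x cv)|exact: cvg_cst].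
have dF x : x \in `[s, t] -> is_derive x 1 F (f x).
  move=> _; have d2 : is_derive x 1 (fun t => v (t, z)) (dx v (x, z)).
    by have /is_derive_dx := smooth2_derivex (x, z) sv.
  have d3 : is_derive x 1 (fun t => v (t, z) - v (e, z)) (dx v (x, z) - 0).
    exact: is_deriveB.
  have d4 : is_derive x 1 (fun t : R => k - t) (0 - 1) by exact: is_deriveB.
  apply: (is_derive_eq (is_deriveM d4 d3)).
  by rewrite /f /GRing.scale/=; ring.
rewrite (FTC_oo st dF cf) /F.
by case: ek => -[-> ->]; rewrite !subrr ?mulr0 ?mul0r subrr.
Qed.

Section Limit.
Variables (v : nat -> R * R -> R) (u ux : R * R -> R) (h : R -> R).
Hypotheses (sv : forall n, smooth2 (v n))
  (cv : cvg_Lp mu2 D p v u) (cdv : cvg_Lp mu2 D p (fun n => dx (v n)) ux)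
  (ch : cvg_Lp leb `]a2, b2[ p (fun n z => v n (e, z)) h).

Lemma integral_strip_weight :
  \int[mu2]_(X in D) (strip_weight k S X * ux X) =
  \int[mu2]_(X in D) (\1_S X * u X) - \int[mu2]_(X in D) (\1_S X * h X.2).
Proof.
have c1 := cvg_Lp_pairing mD muD p1 cdv mweight weight_bounded.
have c2 := cvg_Lp_pairing mD muD p1 cv mindic indic_le1.
have c3 := cvg_Lp_pairing mD muD p1 (cvg_Lp_snd ab1 p1 ch) mindic indic_le1.
have E : (fun n => \int[mu2]_(X in D) (strip_weight k S X * dx (v n) X)) =
    (fun n => \int[mu2]_(X in D) (\1_S X * v n X) -
              \int[mu2]_(X in D) (\1_S X * v n (e, X.2))).
  by apply/funext => n; exact: integral_strip_weight_smooth.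
rewrite E in c1; rewrite -(cvg_lim (@Rhausdorff R) c1).
by apply: cvg_lim => //; apply: cvgB; [exact: c2|exact: c3].
Qed.

(** The weight is at most the width [t - s], and the area of [S] is that width times [t2 - s2]. The
    width cancels, so a gap between [u] and its trace forces a lower bound on the integral of [|ux|]
    that does not shrink with the strip. *)
Lemma strip_trace_gap (sg kappa : R) : `|sg| = 1 ->
  (forall X, S X -> kappa <= sg * (u X - h X.2)) ->
  kappa * (t2 - s2) <= \int[mu2]_(X in D) (\1_S X * `|ux X|).
Proof.
move=> sg1 H.
have up : in_Lp mu2 D p u by case: cv.
have uxp : in_Lp mu2 D p ux by case: cdv.
have hp : in_Lp mu2 D p (h \o snd) by have [_ ? _] := cvg_Lp_snd ab1 p1 ch.
have iu := in_Lp_integrable mD muD p1 (in_LpM mD p1 up mindic indic_le1).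
have ih := in_Lp_integrable mD muD p1 (in_LpM mD p1 hp mindic indic_le1).
have iw := in_Lp_integrable mD muD p1 (in_LpM mD p1 uxp mweight weight_bounded).
have iux : mu2.-integrable D (EFin \o (fun X => \1_S X * `|ux X|)).
  have := integrable_norm (in_Lp_integrable mD muD p1 (in_LpM mD p1 uxp mindic indic_le1)).
  apply: eq_integrable => // X _ /=; congr EFin; rewrite normrM ger0_norm//.
have tau0 : 0 < t - s by rewrite subr_gt0.
rewrite -(ler_pM2l tau0) -RintegralZl//.
apply: (@le_trans _ _ (\int[mu2]_(X in D) `|strip_weight k S X * ux X|)); last first.
  apply: le_Rintegral => //.
  - exact: integrable_norm.
  - exact: (integrableZl mD (t - s) iux).
  - by move=> X DX; rewrite normrM mulrA ler_wpM2r// strip_weight_le.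
apply: le_trans (le_normr_Rintegral mD iw).
rewrite integral_strip_weight -[leRHS]mul1r -sg1 -normrM.
apply: le_trans (ler_norm _).
rewrite -RintegralB// -RintegralZl//; last exact: (integrableB mD iu ih).
have -> : (t - s) * (kappa * (t2 - s2)) = \int[mu2]_(X in D) (kappa * \1_S X).
  rewrite RintegralZl//; last first.
    by apply: (bounded_integrable mD muD mindic (M := 1)) => X; exact: indic_le1.
  rewrite mulrCA; congr (_ * _).
  rewrite /Rintegral integral_indic// setIidl//.
  by rewrite leb2_rect.
apply: le_Rintegral => //.
- apply: (bounded_integrable mD muD (M := `|kappa|)).
    by apply: measurable_funM.
  by move=> X DX; rewrite normrM ler_piMr// indic_le1.
- exact: (integrableZl mD sg (integrableB mD iu ih)).
- move=> X DX; rewrite -mulrBr mulrCA indicE.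
  have [|_] := boolP (X \in S); last by rewrite mulr0 !mul0r.
  by rewrite inE mulr1 mul1r => /H.
Qed.

End Limit.
End Strip.

(** Dominated convergence with [|w|] as the bound; it contradicts the lower bound of
    [strip_trace_gap] on strips of vanishing width. *)
Lemma integral_shrinking0 (S : nat -> set RR) (w : R * R -> R) : in_Lp mu2 D p w ->
  (forall n, measurable (S n)) ->
  (forall X, D X -> \forall n \near \oo, ~ S n X) ->
  \int[mu2]_(X in D) (\1_(S n) X * `|w X|) @[n --> \oo] --> (0 : R).
Proof.
move=> wp mS S0; have iw := integrable_norm (in_Lp_integrable mD muD p1 wp).
have mw : measurable_fun D w by have [] := (in_LpP mu2 mD p1 w).1 wp.
have mf n : measurable_fun D (fun X => (\1_(S n) X * `|w X|)%:E).
  apply/measurable_EFinP; apply: measurable_funM; last exact: measurableT_comp.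
  by apply: measurable_funTS; exact: measurable_indic.
have := @dominated_convergence _ _ _ mu2 D mD
  (fun n X => (\1_(S n) X * `|w X|)%:E) (fun=> 0%E) (fun X => `|w X|%:E).
rewrite integral0 => -[] //.
- apply: aeW => X DX; apply: cvg_near_cst; have := S0 X DX.
  by apply: filterS => n nS; rewrite indicE memNset// mul0r.
- apply: aeW => X n DX /=; rewrite lee_fin ger0_norm ?mulr_ge0//.
  by rewrite ler_piMl// indicE lern1 leq_b1.
by move=> _ _ /fine_cvgP[_].
Qed.

Section Side.
Variables (e : R) (v : nat -> R * R -> R) (u ux : R * R -> R) (h : R -> R).
Hypotheses (he : e = a1 \/ e = b1) (sv : forall n, smooth2 (v n))
  (cv : cvg_Lp mu2 D p v u) (cdv : cvg_Lp mu2 D p (fun n => dx (v n)) ux)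
  (ch : cvg_Lp leb `]a2, b2[ p (fun n z => v n (e, z)) h)
  (cu : {within crect a1 b1 a2 b2, continuous u})
  (cth : {within `[a2, b2], continuous h}).

Lemma side_strip (tau : R) : 0 < tau -> tau <= b1 - a1 -> exists s t k,
  [/\ s < t, a1 <= s, t <= b1, (e = s /\ k = t) \/ (e = t /\ k = s) &
      forall x, s < x < t -> 0 < `|x - e| < tau].
Proof.
move=> tau0 taub; case: he => ->.
- exists a1, (a1 + tau), (a1 + tau); split; [lra|lra|lra|by left|].
  by move=> x /andP[x1 x2]; rewrite gtr0_norm; [apply/andP; split|]; lra.
- exists (b1 - tau), b1, (b1 - tau); split; [lra|lra|lra|by right|].
  by move=> x /andP[x1 x2]; rewrite ltr0_norm; [apply/andP; split|]; lra.
Qed.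

(** If the values differed, continuity of [u] and [h] would keep [u - h] away from 0, with a fixed
    sign, on strips of fixed height [t2 - s2] and width [tau n] tending to 0. The integrals of
    [|ux|] over them would be bounded below and tend to 0. *)
Lemma trace_side z : z \in `[a2, b2] -> u (e, z) = h z.
Proof.
move=> zab; apply: contrapT => /eqP neq.
pose dl := u (e, z) - h z; have dl0 : dl != 0 by rewrite subr_eq0.
pose sg := Num.sg dl; have sg1 : `|sg| = 1 by rewrite normr_sg dl0.
pose kappa := `|dl| / 2; have k0 : 0 < kappa by rewrite divr_gt0 ?normr_gt0.
have eab : e \in `[a1, b1] by rewrite in_itv/=; case: he => ->; rewrite lexx ltW.
have [||r1 r10 H1] := within_continuous_dist2 (X := (e, z)) (e := kappa / 2) cu _ _.
  by split.
  by rewrite divr_gt0.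
have [|r2 r20 H2] := within_continuous_dist1 (x := z) (e := kappa / 2) cth zab _.
  by rewrite divr_gt0.
pose r := Num.min r1 r2; have r0 : 0 < r by rewrite lt_min r10.
pose s2 := Num.max a2 (z - r); pose t2 := Num.min b2 (z + r).
move: (zab); rewrite in_itv/= => /andP[az zb].
have st2 : s2 < t2.
  rewrite gt_max !lt_min ab2 /=; apply/andP; split; lra.
have as2 : a2 <= s2 by rewrite le_max lexx.
have tb2 : t2 <= b2 by rewrite ge_min lexx.
pose tau0 := Num.min (b1 - a1) r; have tau0_gt0 : 0 < tau0 by rewrite lt_min subr_gt0 ab1.
pose tau n := tau0 / n.+1%:R.
have tau_gt0 n : 0 < tau n by rewrite divr_gt0.
have tau_le n : tau n <= tau0 by rewrite ler_pdivrMr// ler_peMr ?ler1n// ltW.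
have ex n : exists stk : R * R * R,
  [/\ stk.1.1 < stk.1.2, a1 <= stk.1.1, stk.1.2 <= b1,
      (e = stk.1.1 /\ stk.2 = stk.1.2) \/ (e = stk.1.2 /\ stk.2 = stk.1.1) &
      forall x, stk.1.1 < x < stk.1.2 -> 0 < `|x - e| < tau n].
  have [|s [t [k H]]] := side_strip (tau_gt0 n) _; last by exists (s, t, k).
  by rewrite (le_trans (tau_le n))// ge_min lexx.
have [F HF] := choice ex.
pose S n : set RR := rect (F n).1.1 (F n).1.2 s2 t2.
have gap n : kappa * (t2 - s2) <= \int[mu2]_(X in D) (\1_(S n) X * `|ux X|).
  have [st as1 tb1 ek Hx] := HF n.
  apply: (strip_trace_gap st st2 as1 tb1 as2 tb2 ek sv cv cdv ch sg1).
  move=> [x y] [] /=; rewrite !in_itv/= => /[dup] /Hx /andP[xe1 xe2] /andP[x1 x2].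
  rewrite /s2 /t2 gt_max lt_min => /andP[/andP[ay zy] /andP[yb yz]].
  have xr : `|x - e| < r.
    by rewrite (lt_le_trans xe2)// (le_trans (tau_le n))// ge_min lexx orbT.
  have yr : `|y - z| < r by rewrite distrC ltr_distlC zy yz.
  have yab : y \in `[a2, b2] by rewrite in_itv/= !ltW.
  have h1 : `|u (x, y) - u (e, z)| < kappa / 2.
    apply: H1 => /=; first last.
    - by rewrite (lt_le_trans yr)// ge_min lexx.
    - by rewrite (lt_le_trans xr)// ge_min lexx.
    split; rewrite /= in_itv/=.
      by rewrite (le_trans as1 (ltW x1)) (le_trans (ltW x2) tb1).
    by rewrite (ltW ay) (ltW yb).
  have h2 : `|h y - h z| < kappa / 2.
    by apply: H2 => //; rewrite (lt_le_trans yr)// ge_min lexx orbT.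
  have h3 : `|(u (x, y) - h y) - dl| < kappa.
    rewrite (_ : _ - dl = (u (x, y) - u (e, z)) - (h y - h z)); last by rewrite /dl; ring.
    by rewrite (le_lt_trans (ler_normB _ _))// (splitr kappa) ltrD.
  (* The gap at the boundary point is [2 * kappa], and the two oscillations of [kappa / 2] leave
     [kappa] on the strip. *)
  have h4 : sg * dl = 2 * kappa by rewrite /sg -normrEsg /kappa mulrC divfK.
  have h5 : `|sg * ((u (x, y) - h y) - dl)| < kappa by rewrite normrM sg1 mul1r.
  move: h5; rewrite mulrBr h4 ltr_distl => /andP[h5 _]; apply: ltW; apply: le_lt_trans h5.
  by rewrite mulr2n mulrDl mul1r addrK.
have uxp : in_Lp mu2 D p ux by case: cdv.
have := integral_shrinking0 (S := S) uxp (fun n => measurable_rect _ _ _ _) _.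
move=> /(_ _)/cvgrPdist_lt /(_ (kappa * (t2 - s2))).
case.
- move=> [x y] [] /=; rewrite in_itv/= => /andP[ax xb] _.
  have xe : 0 < `|x - e|.
    by rewrite normr_gt0 subr_eq0; case: he => ->; [rewrite gt_eqF|rewrite lt_eqF].
  have [n0 hn0] := @ltr_add_invr R 0 (`|x - e| / tau0) (divr_gt0 xe tau0_gt0).
  rewrite add0r ltr_pdivlMr// in hn0.
  exists n0 => // n /= n0n [] /=; rewrite in_itv/= => xst _.
  have [_ _ _ _ /(_ x xst)/andP[_]] := HF n.
  rewrite ltNge => /negP; apply; rewrite ltW// (le_lt_trans _ hn0)// /tau mulrC.
  by rewrite ler_pM2r// lef_pV2 ?posrE// ler_nat.
- by rewrite mulr_gt0// subr_gt0.
move=> n _ /(_ n (leqnn n)); rewrite sub0r normrN => H.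
have := le_lt_trans (le_trans (gap n) (ler_norm _)) H.
by rewrite ltxx.
Qed.

End Side.
End Trace.

(** * Boundary values on the four sides of the cylinder *)

Section BoundaryValues.
Context (R : realType).
Notation leb := (@lebesgue_measure R).
Notation mu2 := (leb2 R).
Notation RR := (measurableTypeR R * measurableTypeR R)%type.

Lemma cvg_Lp_eq d (T : measurableType d) (mu : {measure set T -> \bar R})
    (E : set T) p (v : nat -> T -> R) (f f' : T -> R) :
  (forall x, E x -> f x = f' x) -> cvg_Lp mu E p v f -> cvg_Lp mu E p v f'.
Proof.
move=> ff'; rewrite /cvg_Lp /in_Lp.
have -> : f \_ E = f' \_ E.
  by apply/funext => x; rewrite !patchE; case: ifPn => // /set_mem /ff'.
have e n : (v n \- f) \_ E = (v n \- f') \_ E.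
  by apply/funext => x; rewrite !patchE; case: ifPn => // /set_mem /ff' /= ->.
by move=> [? ? H]; split => //; under eq_fun do rewrite -e.
Qed.

Lemma Ck_swap k (f : R * R -> R) : Ck k f -> Ck k (f \o @swapRR R).
Proof.
have cs g : continuous g -> continuous (g \o @swapRR R).
  move=> cg X; have cX : @swapRR R @ X --> swapRR X by exact: swap_continuous.
  by apply: (cvg_comp _ _ cX); exact: cg.
elim: k f => [|k IHk] f fk; first exact: cs.
apply: (@CkS R k _ (dz f \o @swapRR R) (dx f \o @swapRR R)).
- by apply: cs; exact: Ck_continuous fk.
- by move=> X; apply/is_derive_dx; have /is_derive_dz := Ck_dz (swapRR X) fk.
- by move=> X; apply/is_derive_dz; have /is_derive_dx := Ck_dx (swapRR X) fk.
- by have [_ _ _ _ fz] := fk; exact: (IHk _ fz).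
- by have [_ _ _ fx _] := fk; exact: (IHk _ fx).
Qed.

Lemma smooth2_swap (f : R * R -> R) : smooth2 f -> smooth2 (f \o @swapRR R).
Proof. by move=> sf k; exact: Ck_swap. Qed.

Lemma dx_swap (f : R * R -> R) : smooth2 f -> dx (f \o @swapRR R) = dz f \o @swapRR R.
Proof.
move=> sf; apply/funext => X.
have d1 : is_derive X ((1, 0) : R * R) (f \o @swapRR R) (dz f (swapRR X)).
  by apply/is_derive_dx; have /is_derive_dz := smooth2_derivez (swapRR X) sf.
by have [_] := d1.
Qed.

Lemma within_continuous_swap a1 b1 a2 b2 (f : R * R -> R) :
  {within crect a1 b1 a2 b2, continuous f} ->
  {within crect a2 b2 a1 b1, continuous (f \o @swapRR R)}.
Proof.
move=> /subspace_continuousP cf; apply/subspace_continuousP => X [X1 X2].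
apply: (cvg_comp _ _ _ (cf (swapRR X) (conj X2 X1))) => P /= nP.
have nsP : nbhs X (fun Y => crect a1 b1 a2 b2 (swapRR Y) -> P (swapRR Y)).
  exact: (@swap_continuous R R X _ nP).
change (nbhs X (fun Y => crect a2 b2 a1 b1 Y -> P (swapRR Y))).
by apply: filterS nsP => Y H [Y1 Y2]; exact: H.
Qed.

Section Cyl.
Variables (c d L p : R) (u ux uz h : R * R -> R).
Hypotheses (cd : c < d) (L0 : 0 < L) (p1 : 1 <= p)
  (ut : has_trace p c d L u ux uz h) (cu : {within ccyl c d L, continuous u}).

Lemma lateral_values x (g : R -> R) : [set c; d] x ->
  {within `[0, L], continuous g} -> (forall z, z \in `]0, L[ -> h (x, z) = g z) ->
  forall z, z \in `[0, L] -> u (x, z) = g z.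
Proof.
move=> xcd cg hg z zL; have [v [sv [cv cdv _] lat _]] := ut.
have clat : cvg_Lp leb `]0, L[ p (fun n z => v n (x, z)) g.
  by apply: cvg_Lp_eq (lat x xcd) => y /= /hg.
exact: (trace_side cd L0 p1 xcd sv cv cdv clat cu cg zL).
Qed.

(** Exchanging the coordinates reduces the bottom and the top to the case of a vertical side: the
    swapped approximations are again smooth, and their x-derivatives are the swapped
    z-derivatives. *)
Lemma horizontal_values z (g : R -> R) : [set 0; L] z ->
  {within `[c, d], continuous g} -> (forall x, x \in `]c, d[ -> h (x, z) = g x) ->
  forall x, x \in `[c, d] -> u (x, z) = g x.
Proof.
move=> z0L cg hg x xcd; have [v [sv [cv _ cdv] _ hor]] := ut.
have chor : cvg_Lp leb `]c, d[ p (fun n x => v n (x, z)) g.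
  by apply: cvg_Lp_eq (hor z z0L) => y /= /hg.
have cv' := cvg_Lp_swap p1 cv.
have cdv' := cvg_Lp_swap p1 cdv.
have E : (fun n => dz (v n) \o @swapRR R) = (fun n => dx (v n \o @swapRR R)).
  by apply/funext => n; rewrite dx_swap.
rewrite E in cdv'.
have cu' := within_continuous_swap cu.
exact: (trace_side L0 cd p1 z0L (fun n => smooth2_swap (sv n)) cv' cdv' chor cu' cg xcd).
Qed.

End Cyl.
End BoundaryValues.

(** * Truncations in L^p *)

Section Truncation.
Context d (T : measurableType d) (R : realType).
Variables (mu : {measure set T -> \bar R}) (D : set T) (p : R).
Hypotheses (mD : measurable D) (muD : (mu D < +oo)%E) (p1 : 1 <= p).
Variables (P : {poly R}) (v : nat -> T -> R) (u b chi : T -> R) (M : R).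
Hypotheses (cv : cvg_Lp mu D p v u) (mb : measurable_fun D b)
  (mchi : measurable_fun D chi) (chiM : forall x, D x -> `|chi x| <= M).

Let up : in_Lp mu D p u. Proof. by case: cv. Qed.
Let vp n : in_Lp mu D p (v n). Proof. by case: cv. Qed.
Let mu_ : measurable_fun D u. Proof. by have [] := (in_LpP mu mD p1 u).1 up. Qed.
Let mv n : measurable_fun D (v n).
Proof. by have [] := (in_LpP mu mD p1 (v n)).1 (vp n). Qed.

Let mflat (Q : {poly R}) (f : T -> R) : measurable_fun D f -> measurable_fun D (fun x => flat Q (f x - b x)).
Proof.
move=> mf; apply: (measurableT_comp (measurable_flat Q)).
exact: measurable_funB.
Qed.

Let nullvu : Lp_null mu D p (fun n x => v n x - u x).
Proof. by have [_ _] := (cvg_LpP mu mD p1 v u).1 cv. Qed.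

Lemma cvg_Lp_flat : cvg_Lp mu D p (fun n x => chi x * flat P (v n x - b x))
  (fun x => chi x * flat P (u x - b x)).
Proof.
have [N N0 HN] := flat_bounded P; have [K K0 HK] := flat_lipschitz P.
have mem (f : T -> R) : measurable_fun D f -> in_Lp mu D p (fun x => chi x * flat P (f x - b x)).
  move=> mf; apply: (in_LpM mD p1 _ mchi chiM).
  by apply: (in_Lp_bounded mD muD p1 (M := N)) => //; exact: mflat.
apply/(cvg_LpP mu mD p1); split; [by move=> n; exact: mem|exact: mem|].
apply: (Lp_null_le mD p1 (Lp_nullZ mD (M * K) nullvu)).
  by move=> n; apply: measurable_funB; apply: measurable_funM => //; exact: mflat.
move=> n x Dx /=; rewrite -mulrBr !normrM -mulrA.
have M0 : 0 <= M by rewrite (le_trans _ (chiM Dx)).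
rewrite (ger0_norm M0) (ger0_norm K0) ler_pM// ?chiM//.
by rewrite (le_trans (HK _ _))// opprB addrA subrK.
Qed.

Variables (w : nat -> T -> R) (g b' chi' : T -> R) (M' N' : R).
Hypotheses (cw : cvg_Lp mu D p w g) (mb' : measurable_fun D b')
  (b'N : forall x, D x -> `|b' x| <= N')
  (mchi' : measurable_fun D chi') (chi'M : forall x, D x -> `|chi' x| <= M').

Let gp : in_Lp mu D p g. Proof. by case: cw. Qed.
Let wp n : in_Lp mu D p (w n). Proof. by case: cw. Qed.
Let mg : measurable_fun D g. Proof. by have [] := (in_LpP mu mD p1 g).1 gp. Qed.
Let mw n : measurable_fun D (w n).
Proof. by have [] := (in_LpP mu mD p1 (w n)).1 (wp n). Qed.

Let nullwg : Lp_null mu D p (fun n x => w n x - g x).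
Proof. by have [_ _] := (cvg_LpP mu mD p1 w g).1 cw. Qed.

(** Product and chain rule for chi Phi(f - b), with [h], [b'] and [chi'] in the places of the
    derivatives of [f], [b] and [chi]. *)
Definition flat_grad (f h : T -> R) (x : T) : R :=
  chi' x * flat P (f x - b x) + chi x * (flat (flat_deriv P) (f x - b x) * (h x - b' x)).

(** The difference splits in three. In [d1] the Lipschitz bound applies, and in [d2] a bounded
    factor multiplies [w n - g]. In [d3] the coefficient converges but multiplies the possibly
    unbounded function [g - b'], so only a domination argument works. *)
Lemma cvg_Lp_flat_grad :
  cvg_Lp mu D p (fun n => flat_grad (v n) (w n)) (flat_grad u g).
Proof.
have [N N0 HN] := flat_bounded P; have [K K0 HK] := flat_lipschitz P.
pose P' := flat_deriv P.
have [N1 N10 HN1] := flat_bounded P'; have [K1 K10 HK1] := flat_lipschitz P'.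
have hb (h : T -> R) : in_Lp mu D p h -> in_Lp mu D p (fun x => h x - b' x).
  by move=> hp; apply: (in_LpB mD p1 hp); exact: (in_Lp_bounded mD muD p1 mb' b'N).
have mem (f h : T -> R) : measurable_fun D f -> in_Lp mu D p h -> in_Lp mu D p (flat_grad f h).
  move=> mf hp; apply: (in_LpD mD p1).
    apply: (in_LpM mD p1 _ mchi' chi'M).
    by apply: (in_Lp_bounded mD muD p1 (M := N)) => //; exact: mflat.
  apply: (in_LpM mD p1 _ mchi chiM).
  apply: (in_LpM mD p1 (hb h hp) (M := N1)); first exact: mflat.
  by move=> x _; exact: HN1.
have mem' (f h : T -> R) : measurable_fun D f -> in_Lp mu D p h -> measurable_fun D (flat_grad f h).
  by move=> mf hp; have [] := (in_LpP mu mD p1 _).1 (mem f h mf hp).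
apply/(cvg_LpP mu mD p1); split; [by move=> n; exact: mem|exact: mem|].
pose d1 n x := chi' x * (flat P (v n x - b x) - flat P (u x - b x)).
pose d2 n x := chi x * (flat P' (v n x - b x) * (w n x - g x)).
pose d3 n x := chi x * ((flat P' (v n x - b x) - flat P' (u x - b x)) * (g x - b' x)).
have n1 : Lp_null mu D p d1.
  apply: (Lp_null_le mD p1 (Lp_nullZ mD (M' * K) nullvu)).
    move=> n; apply: measurable_funM => //; apply: measurable_funB; exact: mflat.
  move=> n x Dx; rewrite !normrM -mulrA.
  have M0 : 0 <= M' by rewrite (le_trans _ (chi'M Dx)).
  rewrite (ger0_norm M0) (ger0_norm K0) ler_pM// ?chi'M//.
  by rewrite (le_trans (HK _ _))// opprB addrA subrK.
have n2 : Lp_null mu D p d2.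
  apply: (Lp_null_le mD p1 (Lp_nullZ mD (M * N1) nullwg)).
    move=> n; apply: measurable_funM => //; apply: measurable_funM.
      exact: mflat.
    exact: measurable_funB.
  move=> n x Dx; rewrite !normrM -mulrA.
  have M0 : 0 <= M by rewrite (le_trans _ (chiM Dx)).
  by rewrite (ger0_norm M0) (ger0_norm N10) ler_pM ?mulr_ge0 ?chiM// ler_wpM2r.
have n3 : Lp_null mu D p d3.
  (* One constant for both bounds of the domination lemma: [2 * N1] for the size of the difference
     of the flat factors, [K1] for its Lipschitz bound. *)
  pose E := M * (2 * N1 + K1).
  apply: (Lp_null_dominated mD p1 nullvu (in_LpZ mD p1 E (hb g gp))).
  - move=> n; apply: measurable_funM => //; apply: measurable_funM.
      by apply: measurable_funB; exact: mflat.
    exact: measurable_funB.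
  - move=> n x Dx; rewrite !normrM /E.
    have M0 : 0 <= M by rewrite (le_trans _ (chiM Dx)).
    rewrite (ger0_norm M0) -mulrA ler_pM ?mulr_ge0 ?chiM// ler_wpM2r//.
    rewrite (le_trans (ler_normB _ _))// [leRHS]ger0_norm; last first.
      by rewrite addr_ge0 ?mulr_ge0.
    by have := HN1 (v n x - b x); have := HN1 (u x - b x); lra.
  - move=> n x Dx; rewrite !normrM /E.
    have M0 : 0 <= M by rewrite (le_trans _ (chiM Dx)).
    rewrite (ger0_norm M0).
    apply: (@le_trans _ _ (M * (K1 * `|v n x - u x| * `|g x - b' x|))).
      rewrite ler_pM ?mulr_ge0 ?chiM// ler_wpM2r// (le_trans (HK1 _ _))//.
      by rewrite opprB addrA subrK.
    rewrite [leRHS](_ : _ = M * (`|2 * N1 + K1| * `|v n x - u x| * `|g x - b' x|)).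
      rewrite ler_wpM2l// ler_wpM2r// ler_wpM2r//.
      by rewrite [leRHS]ger0_norm ?addr_ge0 ?mulr_ge0// lerDr mulr_ge0.
    ring.
have := Lp_nullD mD p1 (Lp_nullD mD p1 n1 n2) n3.
have -> // : (fun n x => d1 n x + d2 n x + d3 n x) =
    (fun n => flat_grad (v n) (w n) \- flat_grad u g).
by apply/funext => n; apply/funext => x; rewrite /d1 /d2 /d3 /flat_grad /=; ring.
Qed.

End Truncation.

(** * The flux of a smooth function *)

Section WeightedGradient.
Context (R : realType).
Notation mu2 := (leb2 R).
Notation RR := (measurableTypeR R * measurableTypeR R)%type.
Variables (a1 b1 a2 b2 : R).
Hypotheses (ab1 : a1 < b1) (ab2 : a2 < b2).
Notation D := (rect a1 b1 a2 b2 : set RR).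
Notation CD := (crect a1 b1 a2 b2).
Variables (W : R * R -> R) (m : R).
Hypothesis sW : smooth2 W.

Definition grad2 (X : R * R) : R := dx W X ^+ 2 + dz W X ^+ 2.

Hypothesis grad2_gt0 : forall X, CD X -> 0 < grad2 X.

(** Since [grad2] is the squared length of the gradient, m = (p - 2)/2 gives |grad W|^(p-2) f, a
    component of the p-Laplacian flux when [f] is a partial derivative of [W]. *)
Definition wflux (f : R * R -> R) (X : R * R) : R := grad2 X `^ m * f X.

(** One formula for both directions: [gx], [gz] and [f'] are the derivatives of W_x, W_z and [f] in
    the direction considered. *)
Definition wflux_deriv (gx gz f f' : R * R -> R) (X : R * R) : R :=
  m * grad2 X `^ (m - 1) * (2 * dx W X * gx X + 2 * dz W X * gz X) * f X +
  grad2 X `^ m * f' X.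

Let sx := smooth2_dx sW.
Let sz := smooth2_dz sW.

Lemma smooth2_grad2 : smooth2 grad2.
Proof.
have -> : grad2 = fun X => dx W X * dx W X + dz W X * dz W X.
  by apply/funext => X; rewrite /grad2 !expr2.
by apply: smooth2D; apply: smooth2M.
Qed.

Lemma is_derive_wflux X v (f : R * R -> R) (gx gz f' : R * R -> R) : CD X ->
  is_derive X v (dx W) (gx X) -> is_derive X v (dz W) (gz X) ->
  is_derive X v f (f' X) -> is_derive X v (wflux f) (wflux_deriv gx gz f f' X).
Proof.
move=> CX dxx dzx df.
have dn : is_derive X v grad2 (2 * dx W X * gx X + 2 * dz W X * gz X).
  have -> : grad2 = (dx W * dx W + dz W * dz W)%R.
    by apply/funext => Y; rewrite /grad2 !expr2.
  apply: (is_derive_eq (is_deriveD (is_deriveM dxx dxx) (is_deriveM dzx dzx))).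
  by rewrite /GRing.scale/=; ring.
have dp : is_derive X v (fun Y => grad2 Y `^ m)
    (m * grad2 X `^ (m - 1) * (2 * dx W X * gx X + 2 * dz W X * gz X)).
  exact: (is_derive_comp_dir (is_derive1_powR m (grad2_gt0 CX)) dn).
apply: (is_derive_eq (is_deriveM dp df)).
by rewrite /wflux_deriv /GRing.scale/=; ring.
Qed.

Let continuous_pow r X : CD X -> {for X, continuous (fun Y => grad2 Y `^ r)}.
Proof.
move=> CX; have c : {for grad2 X, continuous (fun s : R => s `^ r)}.
  exact: (is_derive_continuous (is_derive1_powR r (grad2_gt0 CX))).
apply: (@continuous_comp _ _ _ grad2 (fun s : R => s `^ r) X); last exact: c.
exact: (smooth2_continuous smooth2_grad2).
Qed.

Let measurable_pow r : measurable_fun D (fun Y => grad2 Y `^ r).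
Proof.
apply: (measurableT_comp (measurable_powR r)).
by apply: continuous_measurable_rect; exact: (smooth2_continuous smooth2_grad2).
Qed.

Section Coefficients.
Variables (f gx gz f' : R * R -> R).
Hypotheses (sf : smooth2 f) (sgx : smooth2 gx) (sgz : smooth2 gz) (sf' : smooth2 f').

Lemma continuous_wflux X : CD X -> {for X, continuous (wflux f)}.
Proof. by move=> CX; apply: cvgM; [exact: continuous_pow|exact: smooth2_continuous]. Qed.

Lemma continuous_wflux_deriv X : CD X -> {for X, continuous (wflux_deriv gx gz f f')}.
Proof.
move=> CX; apply: cvgD; apply: cvgM.
- apply: cvgM.
    by apply: cvgM; [exact: cvg_cst|exact: continuous_pow].
  apply: cvgD; apply: cvgM.
  + by apply: cvgM; [exact: cvg_cst|exact: (smooth2_continuous sx)].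
  + exact: (smooth2_continuous sgx).
  + by apply: cvgM; [exact: cvg_cst|exact: (smooth2_continuous sz)].
  + exact: (smooth2_continuous sgz).
- exact: smooth2_continuous.
- exact: continuous_pow.
- exact: smooth2_continuous.
Qed.

Lemma measurable_wflux : measurable_fun D (wflux f).
Proof.
apply: measurable_funM; first exact: measurable_pow.
by apply: continuous_measurable_rect; exact: smooth2_continuous.
Qed.

Lemma measurable_wflux_deriv : measurable_fun D (wflux_deriv gx gz f f').
Proof.
have ms (h : R * R -> R) : smooth2 h -> measurable_fun D h.
  by move=> sh; apply: continuous_measurable_rect; exact: smooth2_continuous.
apply: measurable_funD; apply: measurable_funM.
- apply: measurable_funM.
    by apply: measurable_funM; [exact: measurable_cst|exact: measurable_pow].
  apply: ms; apply: smooth2D; apply: smooth2M => //;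
    by apply: smooth2M => //; exact: smooth2_cst.
- exact: ms.
- exact: measurable_pow.
- exact: ms.
Qed.

End Coefficients.

Lemma pointwise_continuous_bounded (h : R * R -> R) :
  (forall X, CD X -> {for X, continuous h}) ->
  exists M : R, forall X, D X -> `|h X| <= M.
Proof.
move=> ch; have cw : {within CD, continuous h}.
  by apply: continuous_in_subspaceT => X /set_mem; exact: ch.
have [M _ HM] := continuous_bounded_crect cw.
by exists M => X DX; apply: HM; exact: rect_sub_crect.
Qed.

Let slice_x (h : R * R -> R) x z : {for (x, z), continuous h} ->
  {for x, continuous (fun t => h (t, z))}.
Proof.
move=> ch; have c : (fun t : R => (t, z)) @ x --> (x, z).
  by apply: (@cvg_pair R R R (nbhs x) (nbhs x) (nbhs z) _ _ _ id (fun=> z)); [exact: cvg_id|exact: cvg_cst].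
by apply: (cvg_comp _ _ c); exact: ch.
Qed.

Let slice_z (h : R * R -> R) x z : {for (x, z), continuous h} ->
  {for z, continuous (fun t => h (x, t))}.
Proof.
move=> ch; have c : (fun t : R => (x, t)) @ z --> (x, z).
  by apply: (@cvg_pair R R R (nbhs z) (nbhs x) (nbhs z) _ _ _ (fun=> x) id); [exact: cvg_cst|exact: cvg_id].
by apply: (cvg_comp _ _ c); exact: ch.
Qed.

Section Limit.
Variables (p : R) (v : nat -> R * R -> R) (phi phix phiz : R * R -> R).
Hypotheses (p1 : 1 <= p) (tv : forall n, test_fun2 D (v n))
  (cv : cvg_W1p p D v phi phix phiz).

Let Bx := wflux (dx W).
Let Bz := wflux (dz W).
Let Bxx := wflux_deriv (dx (dx W)) (dx (dz W)) (dx W) (dx (dx W)).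
Let Bzz := wflux_deriv (dz (dx W)) (dz (dz W)) (dz W) (dz (dz W)).

Let sxx : smooth2 (dx (dx W)). Proof. exact: smooth2_dx. Qed.
Let sxz : smooth2 (dx (dz W)). Proof. exact: smooth2_dx. Qed.
Let szx : smooth2 (dz (dx W)). Proof. exact: smooth2_dz. Qed.
Let szz : smooth2 (dz (dz W)). Proof. exact: smooth2_dz. Qed.

Lemma wflux_ibp_x :
  \int[mu2]_(X in D) (Bx X * phix X) = - \int[mu2]_(X in D) (Bxx X * phi X).
Proof.
have [cv0 cvx _] := cv.
have [M HM] := pointwise_continuous_bounded (fun X CX => continuous_wflux sx CX).
have [N HN] := pointwise_continuous_bounded
  (fun X CX => continuous_wflux_deriv sx sxx sxz sxx CX).
have mB := measurable_wflux sx.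
have mBx := measurable_wflux_deriv sx sxx sxz sxx.
apply: (ibp_x_cvg ab1 ab2 _ _ mB mBx HM HN p1 tv cv0 cvx).
- move=> x z xin zin; have CX : CD (x, z) by split => //; exact: subset_itv_oo_cc.
  have /is_derive_dx // := is_derive_wflux CX (smooth2_derivex (x, z) sx)
    (smooth2_derivex (x, z) sz) (smooth2_derivex (x, z) sx).
- move=> x z xin zin; apply: slice_x; apply: continuous_wflux_deriv => //.
  by split => //; exact: subset_itv_oo_cc.
Qed.

Lemma wflux_ibp_z :
  \int[mu2]_(X in D) (Bz X * phiz X) = - \int[mu2]_(X in D) (Bzz X * phi X).
Proof.
have [cv0 _ cvz] := cv.
have [M HM] := pointwise_continuous_bounded (fun X CX => continuous_wflux sz CX).
have [N HN] := pointwise_continuous_bounded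
  (fun X CX => continuous_wflux_deriv sz szx szz szz CX).
have mB := measurable_wflux sz.
have mBz := measurable_wflux_deriv sz szx szz szz.
apply: (ibp_z_cvg ab1 ab2 _ _ mB mBz HM HN p1 tv cv0 cvz).
- move=> x z xin zin; have CX : CD (x, z) by split => //; exact: subset_itv_oo_cc.
  have /is_derive_dz // := is_derive_wflux CX (smooth2_derivez (x, z) sx)
    (smooth2_derivez (x, z) sz) (smooth2_derivez (x, z) sz).
- move=> x z xin zin; apply: slice_z; apply: continuous_wflux_deriv => //.
  by split => //; exact: subset_itv_oo_cc.
Qed.

End Limit.
End WeightedGradient.

(** * Monotonicity and cutoffs *)

Section Monotone.
Context (R : realType).

(** With A = |a|^(2m) and B = |b|^(2m), the right side equals (A + B)/2 |a - b|^2 + (A - B)(|a|^2 -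
    |b|^2)/2. The second term is nonnegative because s^m is nondecreasing, and A + B >= 1 because
    |b| >= 1. *)
Lemma powR_vector_monotone (m a1 a2 b1 b2 : R) : 0 <= m -> 1 <= b1 ^+ 2 + b2 ^+ 2 ->
  2^-1 * ((a1 - b1) ^+ 2 + (a2 - b2) ^+ 2) <=
  ((a1 ^+ 2 + a2 ^+ 2) `^ m * a1 - (b1 ^+ 2 + b2 ^+ 2) `^ m * b1) * (a1 - b1) +
  ((a1 ^+ 2 + a2 ^+ 2) `^ m * a2 - (b1 ^+ 2 + b2 ^+ 2) `^ m * b2) * (a2 - b2).
Proof.
move=> m0 nb1.
set na := a1 ^+ 2 + a2 ^+ 2; set nb := b1 ^+ 2 + b2 ^+ 2.
have na0 : 0 <= na by rewrite addr_ge0 ?sqr_ge0.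
have nb0 : 0 <= nb by rewrite addr_ge0 ?sqr_ge0.
have A0 : 0 <= na `^ m by exact: powR_ge0.
have B1 : 1 <= nb `^ m.
  apply: (@le_trans _ _ (1 `^ m)); first by rewrite powR1.
  by apply: ge0_ler_powR; rewrite ?nnegrE.
have mono : 0 <= (na `^ m - nb `^ m) * (na - nb).
  have [ab|/ltW ba] := leP na nb.
    by rewrite mulr_le0 ?subr_le0//; apply: ge0_ler_powR; rewrite ?nnegrE.
  by rewrite mulr_ge0 ?subr_ge0//; apply: ge0_ler_powR; rewrite ?nnegrE.
move: mono; rewrite /na /nb -/na -/nb.
move: (na `^ m) (nb `^ m) A0 B1 => A B A0 B1; rewrite /na /nb => mono.
have E : ((A * a1 - B * b1) * (a1 - b1) + (A * a2 - B * b2) * (a2 - b2)) =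
   2^-1 * (A + B) * ((a1 - b1) ^+ 2 + (a2 - b2) ^+ 2) +
   2^-1 * ((A - B) * ((a1 ^+ 2 + a2 ^+ 2) - (b1 ^+ 2 + b2 ^+ 2))) by field.
have S0 : 0 <= (a1 - b1) ^+ 2 + (a2 - b2) ^+ 2 by rewrite addr_ge0 ?sqr_ge0.
rewrite E -[leLHS]addr0; apply: lerD; last by rewrite mulr_ge0 ?invr_ge0.
by rewrite ler_wpM2r// ler_peMr ?invr_ge0//; lra.
Qed.

Lemma sqrt_powR (s q : R) : 0 <= s -> Num.sqrt s `^ q = s `^ (q / 2).
Proof. by move=> s0; rewrite -powR12_sqrt// -powRrM mulrC. Qed.

Lemma sqrD_eq0l (x y : R) : x ^+ 2 + y ^+ 2 = 0 -> x = 0.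
Proof.
move=> /eqP; rewrite (paddr_eq0 (sqr_ge0 x) (sqr_ge0 y)) => /andP[+ _].
by rewrite sqrf_eq0 => /eqP.
Qed.

Lemma normrB_le_sum (x y b M N : R) : `|b| <= M -> `|x - b| <= `|x| + `|y| + (`|M| + `|N|).
Proof.
move=> bM; rewrite (le_trans (ler_normB _ _))// lerD// ?lerDl//.
by rewrite (le_trans bM)// (le_trans (ler_norm _))// lerDl.
Qed.

(** Gives integrability of the flux paired with the gradient of the test function: when [s] is a
    function in L^p, the right side is integrable. *)
Lemma flux_norm_le (p k s x1 x2 y1 y2 : R) : 2 < p -> `|x1| + `|x2| <= s ->
  `|y1| <= k * s -> `|y2| <= k * s ->
  `|Num.sqrt (x1 ^+ 2 + x2 ^+ 2) `^ (p - 2) * (x1 * y1 + x2 * y2)| <= 2 * k * s `^ p.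
Proof.
move=> p2 xs ys1 ys2.
have s0 : 0 <= s by apply: le_trans xs; exact: addr_ge0.
have xs1 : `|x1| <= s by rewrite (le_trans _ xs)// lerDl.
have xs2 : `|x2| <= s by rewrite (le_trans _ xs)// lerDr.
have sq : Num.sqrt (x1 ^+ 2 + x2 ^+ 2) <= s.
  rewrite -(ger0_norm s0) -sqrtr_sqr ler_wsqrtr//.
  apply: (@le_trans _ _ ((`|x1| + `|x2|) ^+ 2)).
    by rewrite sqrrD !real_normK ?num_real// addrAC lerDl mulrn_wge0// mulr_ge0.
  by rewrite ler_sqr ?nnegrE// addr_ge0.
have pq : 0 <= p - 2 by rewrite subr_ge0 ltW.
rewrite normrM (ger0_norm (powR_ge0 _ _)).
have -> : s `^ p = s `^ (p - 2) * (s * s).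
  have q1 : 0 < p - 1 by rewrite subr_gt0 (lt_trans _ p2)// ltr1n.
  have q0 : 0 < p by rewrite (lt_trans _ p2).
  rewrite -(mulr_powRB1 s0 q0) -(mulr_powRB1 s0 q1) (_ : p - 1 - 1 = p - 2); last by ring.
  by ring.
rewrite mulrCA ler_pM ?powR_ge0//.
  by apply: ge0_ler_powR; rewrite ?nnegrE ?sqrtr_ge0.
rewrite (le_trans (ler_normD _ _))// !normrM.
have -> : 2 * k * (s * s) = s * (k * s) + s * (k * s) by ring.
by apply: lerD; apply: ler_pM.
Qed.

End Monotone.

(** * Smooth cutoffs of the cylinder *)

Section Cutoff.
Context (R : realType).
Variables (c d L k : R).
Hypotheses (k0 : 0 < k).

(* [wall] vanishes on [inner] and exceeds [flat 1 (k / 2)] within [k / 2] of the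
   lateral and horizontal sides. *)
Definition wall (X : R * R) : R :=
  flat 1 (c + k - X.1) + flat 1 (X.1 - d + k) + flat 1 (k - X.2) + flat 1 (X.2 - L + k).

(** The argument is at most 0 wherever some summand of [wall] reaches [flat 1 (k / 2)], and it is a
    positive constant where [wall] vanishes. *)
Definition cutoff (X : R * R) : R := flat 1 (flat 1 (k / 2) - wall X).

Definition inner (X : R * R) : Prop :=
  [/\ c + k <= X.1, X.1 <= d - k, k <= X.2 & X.2 <= L - k].

Lemma smooth2_affine1 (a b : R) : smooth2 (fun X : R * R => a * X.1 + b).
Proof.
apply: smooth2D; last exact: smooth2_cst.
by apply: smooth2M; [exact: smooth2_cst|exact: smooth2_fst].
Qed.

Lemma smooth2_affine2 (a b : R) : smooth2 (fun X : R * R => a * X.2 + b).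
Proof.
apply: smooth2D; last exact: smooth2_cst.
by apply: smooth2M; [exact: smooth2_cst|exact: smooth2_snd].
Qed.

Let l1 (X : R * R) := c + k - X.1.
Let l2 (X : R * R) := X.1 - d + k.
Let l3 (X : R * R) := k - X.2.
Let l4 (X : R * R) := X.2 - L + k.

Let s1 : smooth2 l1.
Proof.
have -> : l1 = fun X => -1 * X.1 + (c + k) by apply/funext => X; rewrite /l1; ring.
exact: smooth2_affine1.
Qed.

Let s2 : smooth2 l2.
Proof.
have -> : l2 = fun X => 1 * X.1 + (k - d) by apply/funext => X; rewrite /l2; ring.
exact: smooth2_affine1.
Qed.

Let s3 : smooth2 l3.
Proof.
have -> : l3 = fun X => -1 * X.2 + k by apply/funext => X; rewrite /l3; ring.
exact: smooth2_affine2.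
Qed.

Let s4 : smooth2 l4.
Proof.
have -> : l4 = fun X => 1 * X.2 + (k - L) by apply/funext => X; rewrite /l4; ring.
exact: smooth2_affine2.
Qed.

Lemma smooth2_wall : smooth2 wall.
Proof. by apply: smooth2D; [apply: smooth2D; [apply: smooth2D|]|]; exact: smooth2_flat. Qed.

Lemma smooth2_cutoff : smooth2 cutoff.
Proof.
apply: smooth2_flat; apply: smooth2B; last exact: smooth2_wall.
exact: smooth2_cst.
Qed.

Lemma wall_inner X : inner X -> wall X = 0.
Proof.
by move=> [i1 i2 i3 i4]; rewrite /wall !flat_le0 ?addr0//; lra.
Qed.

(** Left unnormalised: the estimates use that this value is a positive constant. *)
Definition plateau : R := flat 1 (flat 1 (k / 2)).

Lemma plateau_gt0 : 0 < plateau.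
Proof. by do 2 apply: flat1_gt0; rewrite divr_gt0. Qed.

Lemma cutoff_inner X : inner X -> cutoff X = plateau.
Proof. by move=> iX; rewrite /cutoff wall_inner// subr0. Qed.

Lemma cutoff_outside X : ~ crect (c + k / 2) (d - k / 2) (k / 2) (L - k / 2) X ->
  cutoff X = 0.
Proof.
move=> nX; rewrite /cutoff flat_le0// subr_le0 /wall.
have e0 := @flat1_ge0 R; have le := @flat1_le R (k / 2).
have [|x1] := leP (k / 2) (c + k - X.1).
  by move/le; have := e0 (X.1 - d + k); have := e0 (k - X.2); have := e0 (X.2 - L + k); lra.
have [|x2] := leP (k / 2) (X.1 - d + k).
  by move/le; have := e0 (c + k - X.1); have := e0 (k - X.2); have := e0 (X.2 - L + k); lra.
have [|x3] := leP (k / 2) (k - X.2).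
  by move/le; have := e0 (c + k - X.1); have := e0 (X.1 - d + k); have := e0 (X.2 - L + k); lra.
have [|x4] := leP (k / 2) (X.2 - L + k).
  by move/le; have := e0 (c + k - X.1); have := e0 (X.1 - d + k); have := e0 (k - X.2); lra.
exfalso; apply: nX; split; rewrite /= in_itv/=; apply/andP; split; lra.
Qed.

Let flat_derive0 (l : R * R -> R) X v (dl : R) : is_derive X v l dl -> l X <= 0 ->
  is_derive X v (fun Y => flat 1 (l Y)) 0.
Proof.
move=> dlX lX; apply: (is_derive_eq (is_derive_comp_dir (is_derive_flat 1 (l X)) dlX)).
by rewrite flat_le0// mul0r.
Qed.

(** The set [inner] is closed and the cutoff need not be locally constant at its edge. Its
    derivative vanishes there all the same, because each summand of [wall] is a flat function
    evaluated at a nonpositive number. *)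
Lemma cutoff_derive0 X v : inner X ->
  (forall l, smooth2 l -> exists dl, is_derive X v l dl) -> is_derive X v cutoff 0.
Proof.
move=> [i1 i2 i3 i4] ex.
have fl l : smooth2 l -> l X <= 0 -> is_derive X v (fun Y => flat 1 (l Y)) 0.
  by move=> /ex [dl dlX]; exact: flat_derive0 dlX.
have d1 : is_derive X v (fun Y => flat 1 (l1 Y)) 0 by apply: fl => //; rewrite /l1; lra.
have d2 : is_derive X v (fun Y => flat 1 (l2 Y)) 0 by apply: fl => //; rewrite /l2; lra.
have d3 : is_derive X v (fun Y => flat 1 (l3 Y)) 0 by apply: fl => //; rewrite /l3; lra.
have d4 : is_derive X v (fun Y => flat 1 (l4 Y)) 0 by apply: fl => //; rewrite /l4; lra.
have dw : is_derive X v wall (0 + 0 + 0 + 0).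
  exact: (is_deriveD (is_deriveD (is_deriveD d1 d2) d3) d4).
have dB : is_derive X v (fun Y => flat 1 (k / 2) - wall Y) (0 - (0 + 0 + 0 + 0)).
  exact: (is_deriveB (is_derive_cst _ X v) dw).
apply: (is_derive_eq (is_derive_comp_dir (is_derive_flat 1 _) dB)).
by rewrite !addr0 subr0 mulr0.
Qed.

Lemma dx_cutoff_inner X : inner X -> dx cutoff X = 0.
Proof.
move=> iX; have [|_ //] := @cutoff_derive0 X ((1, 0) : R * R) iX.
by move=> l sl; exists (dx l X); exact: smooth2_derivex.
Qed.

Lemma dz_cutoff_inner X : inner X -> dz cutoff X = 0.
Proof.
move=> iX; have [|_ //] := @cutoff_derive0 X ((0, 1) : R * R) iX.
by move=> l sl; exists (dz l X); exact: smooth2_derivez.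
Qed.

Lemma cutoff_test_fun (f : R * R -> R) : smooth2 f ->
  test_fun2 (cyl c d L) (fun X => cutoff X * f X).
Proof.
move=> sf; split; first by apply: smooth2M => //; exact: smooth2_cutoff.
exists (crect (c + k / 2) (d - k / 2) (k / 2) (L - k / 2)); split.
- exact: compact_crect.
- suff sub (X : R * R) : crect (c + k / 2) (d - k / 2) (k / 2) (L - k / 2) X ->
    cyl c d L X by exact: sub.
  have k2 : 0 < k / 2 by rewrite divr_gt0.
  move: (k / 2) k2 => k2 k20.
  move=> []; rewrite /= !in_itv/= => /andP[x1 x2] /andP[z1 z2].
  by split; rewrite /= in_itv/=; apply/andP; split; lra.
- by move=> X nX; rewrite cutoff_outside// mul0r.
Qed.

End Cutoff.

(** * Truncated differences as test functions *)

Section Truncate.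
Context (R : realType).
Notation mu2 := (leb2 R).
Notation RR := (measurableTypeR R * measurableTypeR R)%type.
Variables (c d L k p : R) (P : {poly R}).
Hypotheses (cd : c < d) (L0 : 0 < L) (k0 : 0 < k) (p1 : 1 <= p).
Notation D := (cyl c d L : set RR).
Variables (v : nat -> R * R -> R) (u ux uz b : R * R -> R).
Hypotheses (sv : forall n, smooth2 (v n)) (sb : smooth2 b) (cv : cvg_W1p p D v u ux uz).
Notation chi := (cutoff c d L k).

Definition trunc (f : R * R -> R) (X : R * R) : R := chi X * flat P (f X - b X).

Definition truncx (f fx : R * R -> R) : R * R -> R :=
  flat_grad P b chi (dx b) (dx chi) f fx.

Definition truncz (f fz : R * R -> R) : R * R -> R :=
  flat_grad P b chi (dz b) (dz chi) f fz.

Lemma trunc_test_fun n : test_fun2 (cyl c d L) (trunc (v n)).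
Proof. by apply: cutoff_test_fun => //; apply: smooth2_flat; exact: smooth2B. Qed.

Lemma dx_trunc f : smooth2 f -> dx (trunc f) = truncx f (dx f).
Proof.
move=> sf; apply/funext => X.
have d1 := smooth2_derivex X (smooth2_cutoff c d L k).
have d2 := is_derive_comp_dir (is_derive_flat P (f X - b X))
  (is_deriveB (smooth2_derivex X sf) (smooth2_derivex X sb)).
have [_] := is_deriveM d1 d2; rewrite /dx => ->.
by rewrite /truncx /flat_grad /GRing.scale/= addrC [X in X + _ = _]mulrC.
Qed.

Lemma dz_trunc f : smooth2 f -> dz (trunc f) = truncz f (dz f).
Proof.
move=> sf; apply/funext => X.
have d1 := smooth2_derivez X (smooth2_cutoff c d L k).
have d2 := is_derive_comp_dir (is_derive_flat P (f X - b X))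
  (is_deriveB (smooth2_derivez X sf) (smooth2_derivez X sb)).
have [_] := is_deriveM d1 d2; rewrite /dz => ->.
by rewrite /truncz /flat_grad /GRing.scale/= addrC [X in X + _ = _]mulrC.
Qed.

Lemma trunc_cvg :
  cvg_W1p p D (fun n => trunc (v n)) (trunc u) (truncx u ux) (truncz u uz).
Proof.
have ms (h : R * R -> R) : smooth2 h -> measurable_fun D h.
  by move=> sh; apply: continuous_measurable_rect; exact: smooth2_continuous.
have bs (h : R * R -> R) : smooth2 h ->
    exists2 M : R, 0 <= M & forall X, D X -> `|h X| <= M.
  by move=> sh; apply: continuous_bounded_rect; exact: smooth2_continuous.
have schi := smooth2_cutoff c d L k.
have mD : measurable D by exact: measurable_rect.
have muD : (mu2 D < +oo)%E by exact: leb2_rect_lty.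
have [M _ HM] := bs _ schi.
have [Mx _ HMx] := bs _ (smooth2_dx schi); have [Mz _ HMz] := bs _ (smooth2_dz schi).
have [Nx _ HNx] := bs _ (smooth2_dx sb); have [Nz _ HNz] := bs _ (smooth2_dz sb).
have [c0 cx cz] := cv; split.
- exact: (cvg_Lp_flat mD muD p1 P c0 (ms _ sb) (ms _ schi) HM).
- have -> : (fun n => dx (trunc (v n))) = (fun n => truncx (v n) (dx (v n))).
    by apply/funext => n; rewrite dx_trunc.
  exact: (cvg_Lp_flat_grad mD muD p1 P c0 (ms _ sb) (ms _ schi) HM cx
    (ms _ (smooth2_dx sb)) HNx (ms _ (smooth2_dx schi)) HMx).
- have -> : (fun n => dz (trunc (v n))) = (fun n => truncz (v n) (dz (v n))).
    by apply/funext => n; rewrite dz_trunc.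
  exact: (cvg_Lp_flat_grad mD muD p1 P c0 (ms _ sb) (ms _ schi) HM cz
    (ms _ (smooth2_dz sb)) HNz (ms _ (smooth2_dz schi)) HMz).
Qed.

Hypothesis inn : forall X, D X -> 0 < u X - b X -> inner c d L k X.

(** Where u > b the cutoff is constant, and elsewhere the flat factor and its derivative vanish. In
    both cases the cutoff acts as the constant [plateau k], and its gradient drops out of the
    formulas. *)
Lemma trunc_inner X : D X -> trunc u X = plateau k * flat P (u X - b X).
Proof.
move=> DX; rewrite /trunc; have [F0|F0] := leP (u X - b X) 0.
  by rewrite flat_le0// !mulr0.
by rewrite cutoff_inner//; exact: inn.
Qed.

Lemma truncx_inner X : D X ->
  truncx u ux X = plateau k * flat (flat_deriv P) (u X - b X) * (ux X - dx b X).
Proof.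
move=> DX; rewrite /truncx /flat_grad; have [F0|F0] := leP (u X - b X) 0.
  by rewrite !flat_le0// !(mulr0, mul0r) addr0.
by rewrite dx_cutoff_inner ?cutoff_inner ?mul0r ?add0r ?mulrA//; exact: inn.
Qed.

Lemma truncz_inner X : D X ->
  truncz u uz X = plateau k * flat (flat_deriv P) (u X - b X) * (uz X - dz b X).
Proof.
move=> DX; rewrite /truncz /flat_grad; have [F0|F0] := leP (u X - b X) 0.
  by rewrite !flat_le0// !(mulr0, mul0r) addr0.
by rewrite dz_cutoff_inner ?cutoff_inner ?mul0r ?add0r ?mulrA//; exact: inn.
Qed.

End Truncate.

(** * Comparison with smooth supersolutions *)

Section Comparison.
Context (R : realType).
Notation mu2 := (leb2 R).
Notation RR := (measurableTypeR R * measurableTypeR R)%type.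
Variables (c d L p a l : R) (u ux uz eta W : R * R -> R) (v : nat -> R * R -> R).
Hypotheses (cd : c < d) (L0 : 0 < L) (p2 : 2 < p).
Notation D := (cyl c d L : set RR).
Notation m := ((p - 2) / 2).
Hypotheses (sv : forall n, smooth2 (v n)) (cv : cvg_W1p p D v u ux uz)
  (meta : measurable_fun D eta)
  (graph : {ae mu2, forall X, D X -> beta_graph a l (u X) (eta X)})
  (weak : forall phi phix phiz, W1p0 p D phi phix phiz ->
     - (\int[mu2]_(X in D) (eta X * phiz X)) +
     (\int[mu2]_(X in D) (Num.sqrt (ux X ^+ 2 + uz X ^+ 2) `^ (p - 2) *
               (ux X * phix X + uz X * phiz X))) = 0)
  (cu : {within ccyl c d L, continuous u})
  (sW : smooth2 W) (W0 : forall X, D X -> 0 <= W X)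
  (uW : forall X, ccyl c d L X -> ~ D X -> u X <= W X)
  (gradW : forall X, ccyl c d L X -> 1 <= grad2 W X)
  (superW : forall X, D X ->
     wflux_deriv W m (dx (dx W)) (dx (dz W)) (dx W) (dx (dx W)) X +
     wflux_deriv W m (dz (dx W)) (dz (dz W)) (dz W) (dz (dz W)) X <= a * dz W X).

Let p1 : 1 <= p. Proof. by rewrite (le_trans _ (ltW p2))// ler1n. Qed.
Let mD : measurable D. Proof. exact: measurable_rect. Qed.
Let muD : (mu2 D < +oo)%E. Proof. exact: leb2_rect_lty. Qed.

(** The function [f] is [pr] plus twice the positive part of b - u. It is continuous and positive on
    the compact closure: [pr > 0] inside and b > u on the boundary. Where u > b it reduces to [pr],
    so there the product of the distances to the four sides is at least the minimum of [f]. *)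
Lemma gap_near_boundary (b : R * R -> R) : continuous b ->
  (forall X, ccyl c d L X -> ~ D X -> u X < b X) ->
  exists2 k : R, 0 < k & forall X, D X -> 0 < u X - b X -> inner c d L k X.
Proof.
move=> cb ub.
pose pr (X : R * R) := (X.1 - c) * (d - X.1) * (X.2 * (L - X.2)).
pose f (X : R * R) := pr X + ((b X - u X) + `|b X - u X|).
have cpr : continuous pr.
  have c1 : continuous (@fst R R) by move=> X; exact: cvg_fst.
  have c2 : continuous (@snd R R) by move=> X; exact: cvg_snd.
  move=> X; apply: cvgM; apply: cvgM.
  - by apply: cvgB; [exact: c1|exact: cvg_cst].
  - by apply: cvgB; [exact: cvg_cst|exact: c1].
  - exact: c2.
  - by apply: cvgB; [exact: cvg_cst|exact: c2].
have cf : {within ccyl c d L, continuous f}.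
  move=> X; apply: cvgD; first exact: (continuous_subspaceT cpr).
  have cbu : {within ccyl c d L, continuous (fun X => b X - u X)}.
    by move=> Y; apply: cvgB; [exact: (continuous_subspaceT cb)|exact: cu].
  apply: cvgD; first exact: cbu.
  by apply: cvg_norm; exact: cbu.
have ne : ccyl c d L !=set0.
  by exists (c, 0); split; rewrite /= in_itv/= lexx ltW.
have cpt : compact (ccyl c d L) by exact: compact_crect.
have [X0 X0in X0min] := compact_EVT_min ne cpt cf.
have bu0 X : 0 <= (b X - u X) + `|b X - u X|.
  by have := ler_norm (- (b X - u X)); rewrite normrN; lra.
have f0 X : ccyl c d L X -> 0 < f X.
  move=> CX; have [DX|nDX] := pselect (D X).
    rewrite ltr_wpDr// /pr; case: DX; rewrite /= !in_itv/= => /andP[x1 x2] /andP[z1 z2].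
    by rewrite !mulr_gt0 ?subr_gt0.
  have ltub := ub X CX nDX.
  rewrite ltr_wpDl//; last by rewrite gtr0_norm ?subr_gt0// -mulr2n mulrn_wgt0// subr_gt0.
  rewrite /pr; case: CX; rewrite /= !in_itv/= => /andP[x1 x2] /andP[z1 z2].
  by rewrite !mulr_ge0 ?subr_ge0.
have fX0 := f0 X0 (set_mem X0in).
have dc0 : 0 < d - c by rewrite subr_gt0.
(* The minimum divided by a bound for three of the four factors bounds the fourth from below: [ka]
   for the distances to the lateral sides, [kb] for those to bottom and top. *)
pose ka := f X0 / ((d - c) * (L * L)); pose kb := f X0 / ((d - c) * (d - c) * L).
have ka0 : 0 < ka by rewrite divr_gt0// !mulr_gt0.
have kb0 : 0 < kb by rewrite divr_gt0// !mulr_gt0.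
exists (Num.min ka kb); first by rewrite lt_min ka0.
move=> X DX uX; have CX : ccyl c d L X by exact: rect_sub_crect.
have : f X0 <= pr X.
  have := X0min X (mem_set CX); rewrite {2}/f => /le_trans; apply.
  by rewrite ltr0_norm; [rewrite subrr addr0|lra].
case: DX; rewrite /pr /= !in_itv/= => /andP[x1 x2] /andP[z1 z2] fp.
have le_a y : 0 <= y -> f X0 <= y * ((d - c) * (L * L)) -> Num.min ka kb <= y.
  move=> y0 H; rewrite ge_min; apply/orP; left.
  by rewrite ler_pdivrMr// !mulr_gt0.
have le_b y : 0 <= y -> f X0 <= y * ((d - c) * (d - c) * L) -> Num.min ka kb <= y.
  move=> y0 H; rewrite ge_min; apply/orP; right.
  by rewrite ler_pdivrMr// !mulr_gt0.
have y1 : 0 <= X.1 - c by lra. have y2 : 0 <= d - X.1 by lra.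
have y3 : 0 <= X.2 by lra. have y4 : 0 <= L - X.2 by lra.
have y5 : X.1 - c <= d - c by rewrite lerD2r ltW.
have y6 : d - X.1 <= d - c by rewrite lerD2l lerN2 ltW.
have y7 : X.2 <= L by exact: ltW.
have y8 : L - X.2 <= L by rewrite gerBl.
have dc := ltW dc0; have L0' := ltW L0.
split.
- rewrite addrC -lerBrDr; apply: le_a => //; apply: (le_trans fp).
  by rewrite -mulrA ler_wpM2l// ler_pM ?mulr_ge0// ler_pM.
- rewrite lerBrDl -lerBrDr; apply: le_a => //; apply: (le_trans fp).
  by rewrite [X in X * _]mulrC -mulrA ler_wpM2l// ler_pM ?mulr_ge0// ler_pM.
- apply: le_b => //; apply: (le_trans fp).
  by rewrite mulrCA ler_wpM2l// ler_pM ?mulr_ge0// ler_pM.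
- rewrite lerBrDl -lerBrDr; apply: le_b => //; apply: (le_trans fp).
  by rewrite [X in _ * X]mulrC mulrCA ler_wpM2l// ler_pM ?mulr_ge0// ler_pM.
Qed.

Section Epsilon.
Variable eps : R.
Hypothesis eps0 : 0 < eps.

Let b (X : R * R) : R := W X + eps.

Let sb : smooth2 b.
Proof. by apply: smooth2D => //; exact: smooth2_cst. Qed.

Let dxb : dx b = dx W.
Proof.
apply/funext => X.
have [_] := is_deriveD (smooth2_derivex X sW) (is_derive_cst eps X ((1, 0) : R * R)).
by rewrite addr0.
Qed.

Let dzb : dz b = dz W.
Proof.
apply/funext => X.
have [_] := is_deriveD (smooth2_derivez X sW) (is_derive_cst eps X ((0, 1) : R * R)).
by rewrite addr0.
Qed.

Variable k : R.
Hypotheses (k0 : 0 < k) (inn : forall X, D X -> 0 < u X - b X -> inner c d L k X).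

Let Q : {poly R} := 1 + 'X.
Let phi := trunc c d L k Q b u.
Let phix := truncx c d L k Q b u ux.
Let phiz := truncz c d L k Q b u uz.
Let psiz := truncz c d L k 1 b u uz.
Let kap := plateau k.
Let Psi (X : R * R) : R := flat 'X^3 (u X - b X).

Let tv (P : {poly R}) n : test_fun2 D (trunc c d L k P b (v n)).
Proof. exact: trunc_test_fun. Qed.

Let tc (P : {poly R}) : cvg_W1p p D (fun n => trunc c d L k P b (v n))
  (trunc c d L k P b u) (truncx c d L k P b u ux) (truncz c d L k P b u uz).
Proof. exact: trunc_cvg. Qed.

Let up : in_Lp mu2 D p u. Proof. by have [[]] := cv. Qed.
Let uxp : in_Lp mu2 D p ux. Proof. by have [_ []] := cv. Qed.
Let uzp : in_Lp mu2 D p uz. Proof. by have [_ _ []] := cv. Qed.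
Let phip : in_Lp mu2 D p phi. Proof. by have [[]] := tc Q. Qed.
Let phixp : in_Lp mu2 D p phix. Proof. by have [_ []] := tc Q. Qed.
Let phizp : in_Lp mu2 D p phiz. Proof. by have [_ _ []] := tc Q. Qed.
Let psizp : in_Lp mu2 D p psiz. Proof. by have [_ _ []] := tc 1. Qed.

Let mLp (f : R * R -> R) : in_Lp mu2 D p f -> measurable_fun D f.
Proof. by move=> /(in_LpP mu2 mD p1)[]. Qed.

Let iLp (f : R * R -> R) : in_Lp mu2 D p f -> mu2.-integrable D (EFin \o f).
Proof. exact: in_Lp_integrable. Qed.

Let ms (h : R * R -> R) : smooth2 h -> measurable_fun D h.
Proof. by move=> sh; apply: continuous_measurable_rect; exact: smooth2_continuous. Qed.

Let bs (h : R * R -> R) : smooth2 h -> exists M : R, forall X, D X -> `|h X| <= M.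
Proof.
move=> sh; have [M _ HM] := continuous_bounded_rect c d 0 L (smooth2_continuous sh).
by exists M.
Qed.

Let iM (h f : R * R -> R) : smooth2 h -> in_Lp mu2 D p f ->
  mu2.-integrable D (EFin \o (fun X => h X * f X)).
Proof.
move=> sh fp; have [M HM] := bs sh; apply: iLp.
exact: (in_LpM mD p1 fp (ms sh) HM).
Qed.

Let phiE X : D X -> phi X = kap * flat Q (u X - b X).
Proof. exact: trunc_inner. Qed.

Let phixE X : D X -> phix X = kap * Psi X * (ux X - dx W X).
Proof. by move=> DX; rewrite /phix truncx_inner// flat_deriv1X dxb. Qed.

Let phizE X : D X -> phiz X = kap * Psi X * (uz X - dz W X).
Proof. by move=> DX; rewrite /phiz truncz_inner// flat_deriv1X dzb. Qed.

Let psizE X : D X -> psiz X = (u X - b X) * phiz X.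
Proof.
move=> DX; rewrite phizE// /psiz truncz_inner// flat_deriv1 dzb -mul_flatX3 -/kap /Psi.
by ring.
Qed.

Let int_dz (B : R * R -> R) (P : {poly R}) : smooth2 B ->
  \int[mu2]_(X in D) (B X * truncz c d L k P b u uz X) =
  - \int[mu2]_(X in D) (dz B X * trunc c d L k P b u X).
Proof.
move=> sB; have [M HM] := bs sB; have [N HN] := bs (smooth2_dz sB).
have [c0 _ cz] := tc P.
apply: (ibp_z_cvg cd L0 _ _ (ms sB) (ms (smooth2_dz sB)) HM HN p1 (tv P) c0 cz).
- by move=> x z _ _; have /is_derive_dz := smooth2_derivez (x, z) sB.
- move=> x z _ _; apply: continuous_slice_z.
  exact: (smooth2_continuous (smooth2_dz sB)).
Qed.

Let int_dx (B : R * R -> R) (P : {poly R}) : smooth2 B ->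
  \int[mu2]_(X in D) (B X * truncx c d L k P b u ux X) =
  - \int[mu2]_(X in D) (dx B X * trunc c d L k P b u X).
Proof.
move=> sB; have [M HM] := bs sB; have [N HN] := bs (smooth2_dx sB).
have [c0 cx _] := tc P.
apply: (ibp_x_cvg cd L0 _ _ (ms sB) (ms (smooth2_dx sB)) HM HN p1 (tv P) c0 cx).
- by move=> x z _ _; have /is_derive_dx := smooth2_derivex (x, z) sB.
- move=> x z _ _; apply: continuous_slice_x.
  exact: (smooth2_continuous (smooth2_dx sB)).
Qed.

Let int_dz0 (P : {poly R}) : \int[mu2]_(X in D) (truncz c d L k P b u uz X) = 0.
Proof.
have := int_dz P (smooth2_cst (1 : R)).
rewrite (@eq_Rintegral _ _ _ mu2 D (fun X => truncz c d L k P b u uz X)); last first.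
  by move=> X _; rewrite mul1r.
move=> ->; rewrite (@eq_Rintegral _ _ _ mu2 D (fun=> 0)); last first.
  by move=> X _; rewrite /dz derive_cst mul0r.
by rewrite /Rintegral integral0 oppr0.
Qed.

(* Where [phiz] is nonzero [u > 0], so [eta = a u + l]; moreover
   [(u - b) phiz = psiz] is itself a [z]-derivative of a truncation. *)
Lemma integral_eta : \int[mu2]_(X in D) (eta X * phiz X) =
  - a * \int[mu2]_(X in D) (dz W X * phi X).
Proof.
have mau : measurable_fun D (fun X => (a * u X + l) * phiz X).
  apply: measurable_funM; last exact: mLp.
  by apply: measurable_funD => //; apply: measurable_funM => //; exact: mLp.
have -> : \int[mu2]_(X in D) (eta X * phiz X) =
    \int[mu2]_(X in D) ((a * u X + l) * phiz X).
  congr fine; apply: ae_eq_integral => //.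
  - by apply/measurable_EFinP; apply: measurable_funM => //; exact: mLp.
  - exact/measurable_EFinP.
  move: graph; apply: filterS => X gX DX; congr EFin.
  rewrite phizE//; have [F0|F0] := leP (u X - b X) 0.
    by rewrite /Psi flat_le0// !(mulr0, mul0r).
  have uX : 0 < u X.
    by rewrite -(subrK (b X) (u X)) ltr_wpDr// addr_ge0 ?W0// ltW.
  have := gX DX; rewrite /beta_graph ltNge (ltW uX)/= gt_eqF//= => ->.
  by [].
rewrite (@eq_Rintegral _ _ _ mu2 D
  (fun X => a * psiz X + (a * (W X * phiz X) + (a * eps + l) * phiz X))); last first.
  by move=> X /set_mem DX; rewrite psizE// /b; ring.
have i1 := iLp psizp; have i2 := iM sW phizp; have i3 := iLp phizp.
rewrite RintegralD//; last 2 first.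
- exact: (integrableZl mD a i1).
- exact: (integrableD mD (integrableZl mD a i2) (integrableZl mD (a * eps + l) i3)).
rewrite RintegralD//; last 2 first.
- exact: (integrableZl mD a i2).
- exact: (integrableZl mD (a * eps + l) i3).
rewrite !RintegralZl// (int_dz0 1) (int_dz0 Q) (int_dz Q sW).
by rewrite !mulr0 add0r addr0 mulrN mulNr.
Qed.

Let gradW_gt0 X : ccyl c d L X -> 0 < grad2 W X.
Proof. by move=> CX; exact: lt_le_trans ltr01 (gradW CX). Qed.

Let fW (X : R * R) : R :=
  grad2 W X `^ m * dx W X * phix X + grad2 W X `^ m * dz W X * phiz X.

Let sxW := smooth2_dx sW.
Let szW := smooth2_dz sW.

Let wflux_integrable (f g : R * R -> R) : smooth2 f -> in_Lp mu2 D p g ->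
  mu2.-integrable D (EFin \o (fun X => wflux W m f X * g X)).
Proof.
move=> sf gp; have [M HM] := @pointwise_continuous_bounded R c d 0 L (wflux W m f)
  (@continuous_wflux R c d 0 L W m sW gradW_gt0 f sf).
exact: (iLp (in_LpM mD p1 gp (measurable_wflux m sW sf) HM)).
Qed.

Let fW_integrable : mu2.-integrable D (EFin \o fW).
Proof.
have i1 := wflux_integrable sxW phixp; have i2 := wflux_integrable szW phizp.
exact: (integrableD mD i1 i2).
Qed.

(** The weak form of the supersolution inequality: the flux of [W] is integrated by parts, and
    [superW] is multiplied by the nonnegative [phi]. *)
Lemma integral_fW : - a * \int[mu2]_(X in D) (dz W X * phi X) <= \int[mu2]_(X in D) fW X.
Proof.
have sxx := smooth2_dx sxW; have sxz := smooth2_dx szW.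
have szx := smooth2_dz sxW; have szz := smooth2_dz szW.
have i1 := wflux_integrable sxW phixp; have i2 := wflux_integrable szW phizp.
pose Bxx := wflux_deriv W m (dx (dx W)) (dx (dz W)) (dx W) (dx (dx W)).
pose Bzz := wflux_deriv W m (dz (dx W)) (dz (dz W)) (dz W) (dz (dz W)).
have E1 := wflux_ibp_x cd L0 m sW gradW_gt0 p1 (tv Q) (tc Q).
have E2 := wflux_ibp_z cd L0 m sW gradW_gt0 p1 (tv Q) (tc Q).
have -> : \int[mu2]_(X in D) fW X =
    - (\int[mu2]_(X in D) (Bxx X * phi X)) + - (\int[mu2]_(X in D) (Bzz X * phi X)).
  exact: (etrans (RintegralD mD i1 i2) (f_equal2 +%R E1 E2)).
rewrite -opprD mulNr lerN2.
have j1 : mu2.-integrable D (EFin \o (fun X => Bxx X * phi X)).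
  have [M HM] := @pointwise_continuous_bounded R c d 0 L Bxx
    (@continuous_wflux_deriv R c d 0 L W m sW gradW_gt0 _ _ _ _ sxW sxx sxz sxx).
  exact: (iLp (in_LpM mD p1 phip (measurable_wflux_deriv m sW sxW sxx sxz sxx) HM)).
have j2 : mu2.-integrable D (EFin \o (fun X => Bzz X * phi X)).
  have [M HM] := @pointwise_continuous_bounded R c d 0 L Bzz
    (@continuous_wflux_deriv R c d 0 L W m sW gradW_gt0 _ _ _ _ szW szx szz szz).
  exact: (iLp (in_LpM mD p1 phip (measurable_wflux_deriv m sW szW szx szz szz) HM)).
rewrite -(RintegralD mD j1 j2) -(RintegralZl a mD (iM szW phip)).
apply: (le_Rintegral mD (integrableD mD j1 j2) (integrableZl mD a (iM szW phip))).
move=> X DX; rewrite -mulrDl [leRHS]mulrA; apply: ler_wpM2r; last exact: superW.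
by rewrite phiE// mulr_ge0 ?flat1X_ge0// ltW// plateau_gt0.
Qed.

Let fu (X : R * R) : R :=
  Num.sqrt (ux X ^+ 2 + uz X ^+ 2) `^ (p - 2) * (ux X * phix X + uz X * phiz X).

Let mfu : measurable_fun D fu.
Proof.
have mux := mLp uxp; have muz := mLp uzp; have mx := mLp phixp; have mz := mLp phizp.
apply: measurable_funM.
  have -> : (fun X => Num.sqrt (ux X ^+ 2 + uz X ^+ 2) `^ (p - 2)) =
      (fun X => (ux X ^+ 2 + uz X ^+ 2) `^ ((p - 2) / 2)).
    by apply/funext => X; rewrite sqrt_powR// addr_ge0 ?sqr_ge0.
  apply: (measurableT_comp (measurable_powR _)).
  exact: (measurable_funD (measurable_funX 2 mux) (measurable_funX 2 muz)).
exact: (measurable_funD (measurable_funM mux mx) (measurable_funM muz mz)).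
Qed.

Let fu_integrable : mu2.-integrable D (EFin \o fu).
Proof.
have [Nx HNx] := bs sxW; have [Nz HNz] := bs szW.
have [K K0 HK] := flat_bounded ('X^3 : {poly R}).
have kap0 : 0 < kap by exact: plateau_gt0.
have kap_ge0 : 0 <= kap by exact: ltW.
(* Dominates both the gradient of [u] and its differences with the gradient of [W], so it serves for
   the two factors of the flux term at once. *)
pose s (X : R * R) := `|ux X| + `|uz X| + (`|Nx| + `|Nz|).
have absp (f : R * R -> R) : in_Lp mu2 D p f -> in_Lp mu2 D p (fun X => `|f X|).
  move=> fp; apply: (in_Lp_le mD p1 fp); first by apply: measurableT_comp => //; exact: mLp.
  by move=> X _; rewrite normr_id.
have sp : in_Lp mu2 D p s.
  apply: (in_LpD mD p1 (in_LpD mD p1 (absp _ uxp) (absp _ uzp))).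
  apply: (@in_Lp_bounded _ _ _ mu2 D p mD muD p1 _ (`|Nx| + `|Nz|)).
    exact: measurable_cst.
  by move=> X _; rewrite ger0_norm// addr_ge0.
have [_ spi] := (in_LpP mu2 mD p1 s).1 sp.
apply: (le_integrable mD _ _ (integrableZl mD (2 * (kap * K)) spi)).
  exact/measurable_EFinP.
move=> X DX /=; rewrite lee_fin.
have s0 : 0 <= s X by rewrite !addr_ge0.
have C0 : 0 <= kap * K by rewrite mulr_ge0// ltW.
rewrite [leRHS]ger0_norm ?mulr_ge0 ?powR_ge0// (ger0_norm s0).
have Nxb := HNx X DX; have Nzb := HNz X DX.
have lx : `|phix X| <= kap * K * s X.
  rewrite phixE// normrM ler_pM//.
    by rewrite normrM (gtr0_norm kap0) ler_wpM2l ?HK// ltW.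
  exact: normrB_le_sum.
have lz : `|phiz X| <= kap * K * s X.
  rewrite phizE// normrM ler_pM//.
    by rewrite normrM (gtr0_norm kap0) ler_wpM2l ?HK// ltW.
  rewrite /s [`|ux X| + _]addrC [`|Nx| + _]addrC; exact: normrB_le_sum.
by apply: flux_norm_le => //; rewrite /s lerDl addr_ge0.
Qed.

Let G (X : R * R) : R :=
  kap * Psi X * (2^-1 * ((ux X - dx W X) ^+ 2 + (uz X - dz W X) ^+ 2)).

Let G_ge0 X : 0 <= G X.
Proof.
rewrite /G !mulr_ge0 ?invr_ge0 ?addr_ge0 ?sqr_ge0 ?flatX3_ge0//.
exact: (ltW (plateau_gt0 k0)).
Qed.

Let G_le X : D X -> G X <= fu X - fW X.
Proof.
move=> DX; have CX : ccyl c d L X by exact: rect_sub_crect.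
have m0 : 0 <= m by rewrite divr_ge0// subr_ge0 ltW.
have := powR_vector_monotone (ux X) (uz X) m0 (gradW CX).
have kP : 0 <= kap * Psi X.
  by rewrite mulr_ge0 ?flatX3_ge0// (ltW (plateau_gt0 k0)).
move=> /(ler_wpM2l kP) H; apply: (le_trans H).
rewrite /fu /fW sqrt_powR ?addr_ge0 ?sqr_ge0// phixE// phizE// -/(grad2 W X).
by rewrite le_eqVlt; apply/orP; left; apply/eqP; ring.
Qed.

Let mG : measurable_fun D G.
Proof.
have mux := mLp uxp; have muz := mLp uzp.
apply: measurable_funM.
  apply: measurable_funM; first exact: measurable_cst.
  apply: (measurableT_comp (measurable_flat _)).
  exact: (measurable_funB (mLp up) (ms sb)).
apply: measurable_funM; first exact: measurable_cst.
apply: measurable_funD; apply: measurable_funX.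
  exact: (measurable_funB mux (ms sxW)).
exact: (measurable_funB muz (ms szW)).
Qed.

Let iG : mu2.-integrable D (EFin \o G).
Proof.
apply: (le_integrable mD _ _ (integrableB mD fu_integrable fW_integrable)).
  exact/measurable_EFinP.
move=> X DX /=; rewrite lee_fin (ger0_norm (G_ge0 X)).
by rewrite (le_trans (G_le DX))// ler_norm.
Qed.

(** The weak equation with [integral_eta] evaluates the integral of [fu] as that of - a W_z phi, and
    by [integral_fW] the integral of [fW] is at least as large. Hence [fu - fW] has integral at most
    0, while monotonicity bounds it below by [G >= 0]. *)
Lemma integral_G0 : \int[mu2]_(X in D) G X = 0.
Proof.
apply/eqP; rewrite eq_le; apply/andP; split; last first.
  by apply: Rintegral_ge0 => X _; exact: G_ge0.
apply: (@le_trans _ _ (\int[mu2]_(X in D) (fu X - fW X))).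
  apply: (le_Rintegral mD iG (integrableB mD fu_integrable fW_integrable)).
  exact: G_le.
rewrite (RintegralB mD fu_integrable fW_integrable).
have W0p : W1p0 p D phi phix phiz.
  exact: (W1p0_intro cd L0 p1 (tv Q) (tc Q)).
have /eqP := weak W0p; rewrite -/(fu) addrC subr_eq0 => /eqP fuE.
have -> : \int[mu2]_(X in D) fu X = \int[mu2]_(X in D) (eta X * phiz X) by exact: fuE.
rewrite integral_eta subr_le0; exact: integral_fW.
Qed.

Lemma Rintegral0_ae (f : R * R -> R) : mu2.-integrable D (EFin \o f) ->
  (forall X, D X -> 0 <= f X) -> \int[mu2]_(X in D) f X = 0 ->
  {ae mu2, forall X, D X -> f X = 0}.
Proof.
move=> fi f0 If; have mf : measurable_fun D (EFin \o f) by have /integrableP[] := fi.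
have : (\int[mu2]_(X in D) `|(f X)%:E| = 0)%E.
  transitivity (\int[mu2]_(X in D) (EFin \o f) X)%E.
    by apply: eq_integral => X /set_mem DX /=; rewrite ger0_norm ?f0.
  have fn := integrable_fin_num mD fi.
  by rewrite -(fineK fn); congr EFin; exact: If.
move=> /(ae_eq_integral_abs mu2 mD mf); apply: filterS => X H DX.
by have := H DX => -[].
Qed.

(** Since [G = 0] almost everywhere, [phix] vanishes almost everywhere: either [Psi = 0] or ux =
    W_x. Integrating [phix] by parts against the coordinate x, whose derivative is 1, gives the
    integral of [phi]. *)
Lemma integral_phi0 : \int[mu2]_(X in D) phi X = 0.
Proof.
have dfst X : dx (@fst R R) X = 1.
  have d1 : is_derive X ((1, 0) : R * R) (@fst R R) 1.
    by apply/is_derive_dx; exact: is_derive_id.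
  by have [_] := d1.
have := int_dx Q (smooth2_fst R).
have -> : \int[mu2]_(X in D) (dx (@fst R R) X * trunc c d L k Q b u X) =
    \int[mu2]_(X in D) phi X.
  by apply: eq_Rintegral => X _; rewrite dfst mul1r.
have -> : \int[mu2]_(X in D) (X.1 * truncx c d L k Q b u ux X) = 0.
  transitivity (\int[mu2]_(X in D) (0 : R)); last by rewrite /Rintegral integral0.
  congr fine; apply: ae_eq_integral => //.
    apply/measurable_EFinP; apply: measurable_funM; last exact: (mLp phixp).
    exact: (ms (smooth2_fst R)).
  have := Rintegral0_ae iG (fun X _ => G_ge0 X) integral_G0.
  apply: filterS => X GX DX; congr EFin.
  have := GX DX; rewrite -/(phix X) phixE// /G => /eqP.
  rewrite !mulf_eq0 invr_eq0 pnatr_eq0 /= => /orP[/orP[|]/eqP ->|].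
  - by rewrite !(mul0r, mulr0).
  - by rewrite !(mul0r, mulr0).
  move=> /eqP/sqrD_eq0l ->.
  by rewrite !mulr0.
by move=> /eqP; rewrite eq_sym oppr_eq0 => /eqP.
Qed.

(** A point with u > b would have a whole rectangle around it where [phi > 0]. The nonnegative [phi]
    has integral 0, so that rectangle would have measure 0. *)
Lemma trunc_comparison X : D X -> u X <= b X.
Proof.
move=> DX; rewrite leNgt; apply/negP => buX.
have CX : ccyl c d L X by exact: rect_sub_crect.
have cF : {within ccyl c d L, continuous (fun Y => u Y - b Y)}.
  move=> Y; apply: cvgB; first exact: cu.
  exact: (continuous_subspaceT (smooth2_continuous sb)).
have F0 : 0 < u X - b X by rewrite subr_gt0.
have [r r0 Hr] := within_continuous_dist2 cF CX F0.
case: X DX CX buX F0 Hr => x z DX CX buX F0 Hr.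
case: (DX) => /=; rewrite !in_itv/= => /andP[cx xd] /andP[z0 zL].
pose s1 := Num.max c (x - r); pose t1 := Num.min d (x + r).
pose s2 := Num.max 0 (z - r); pose t2 := Num.min L (z + r).
have st1 : s1 < t1 by rewrite gt_max !lt_min; apply/andP; split; apply/andP; split; lra.
have st2 : s2 < t2 by rewrite gt_max !lt_min; apply/andP; split; apply/andP; split; lra.
have SP Y : rect s1 t1 s2 t2 Y -> D Y /\ phi Y != 0.
  case: Y => y1 y2 [] /=; rewrite !in_itv/= !gt_max !lt_min.
  move=> /andP[/andP[h1 h2] /andP[h3 h4]] /andP[/andP[h5 h6] /andP[h7 h8]].
  have DY : D (y1, y2) by split; rewrite /= in_itv/=; apply/andP; split.
  split => //; rewrite phiE// mulf_neq0 ?gt_eqF ?(plateau_gt0 k0)//.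
  apply: flat1X_gt0.
  have : `|(u (y1, y2) - b (y1, y2)) - (u (x, z) - b (x, z))| < u (x, z) - b (x, z).
    apply: Hr => /=; first exact: rect_sub_crect.
      by rewrite ltr_norml; apply/andP; split; lra.
    by rewrite ltr_norml; apply/andP; split; lra.
  by rewrite ltr_norml => /andP[H _]; lra.
have phi_ge0 Y : D Y -> 0 <= phi Y.
  by move=> DY; rewrite phiE// mulr_ge0 ?flat1X_ge0// (ltW (plateau_gt0 k0)).
have : mu2.-negligible (rect s1 t1 s2 t2 : set RR).
  have := Rintegral0_ae (iLp phip) phi_ge0 integral_phi0.
  apply: negligibleS => Y SY /= H; have [DY nY] := SP Y SY.
  by move: nY; rewrite H// eqxx.
move=> /(negligibleP mu2 (measurable_rect _ _ _ _)) S0.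
have := leb2_rect st1 st2; rewrite [LHS]S0 => -[] /esym /eqP.
by rewrite mulf_eq0 !subr_eq0 !gt_eqF.
Qed.

End Epsilon.

(** Raising [W] by [eps] makes the boundary inequality strict, so the set where u exceeds it stays
    at a positive distance from the boundary and the cutoff exists. *)
Lemma comparison X : D X -> u X <= W X.
Proof.
move=> DX; apply/ler_addgt0Pr => eps eps0.
have cb : continuous (fun Y => W Y + eps).
  apply: smooth2_continuous; apply: smooth2D => //; exact: smooth2_cst.
have [k k0 Hk] : exists2 k : R, 0 < k &
    forall Y, D Y -> 0 < u Y - (W Y + eps) -> inner c d L k Y.
  apply: gap_near_boundary => // Y CY nDY.
  by rewrite (le_lt_trans (uW CY nDY))// ltrDl.
exact: (trunc_comparison eps0 k0 Hk DX).
Qed.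

End Comparison.

(** * The barrier *)

Section Barrier.
Context (R : realType).
Variables (q A K C sg e z0 dl : R).
Hypotheses (dl0 : 0 < dl) (sg1 : sg ^+ 2 = 1).
Implicit Types (X v : R * R).

(* In the signed distance [t] to the side and the height [s] above the contact
   point, [C rho^q] dominates the boundary datum, and the concave term
   [- K tau^q] absorbs its Hessian, both being of size [tau^(q-1)]. *)
Definition bt X : R := sg * (X.1 - e).
Definition bs X : R := X.2 - z0.
Definition btau X : R := bt X * bt X + dl.
Definition brho X : R := bt X * bt X + bs X * bs X + dl.

(** Subtracting [dl^q] makes the concave term vanish on the side t = 0, where the barrier has to lie
    above the datum. *)
Definition barrier X : R :=
  A * bt X - K * (btau X `^ q - dl `^ q) + C * brho X `^ q.

Lemma btau_gt0 X : 0 < btau X.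
Proof. by rewrite ltr_wpDl// -expr2 sqr_ge0. Qed.

Lemma brho_gt0 X : 0 < brho X.
Proof. by rewrite ltr_wpDl// addr_ge0// -expr2 sqr_ge0. Qed.

Let dbt X v : is_derive X v bt (sg * v.1).
Proof.
apply/is_derive_line; have -> : (fun h : R => bt (h *: v + X)) =
    (fun h => sg * v.1 * h + bt X).
  by apply/funext => h; rewrite /bt /= /GRing.scale/=; ring.
have d1 : is_derive (0 : R) 1 (fun h : R => sg * v.1 * h + bt X) (sg * v.1 *: 1 + 0).
  exact: (is_deriveD (is_deriveZ (sg * v.1) (is_derive_id (0 : R) 1)) (is_derive_cst _ _ _)).
by apply: (is_derive_eq d1); rewrite addr0 /GRing.scale/= mulr1.
Qed.

Let dbs X v : is_derive X v bs v.2.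
Proof.
apply/is_derive_line; have -> : (fun h : R => bs (h *: v + X)) =
    (fun h => v.2 * h + bs X).
  by apply/funext => h; rewrite /bs /= /GRing.scale/=; ring.
have d1 : is_derive (0 : R) 1 (fun h : R => v.2 * h + bs X) (v.2 *: 1 + 0).
  exact: (is_deriveD (is_deriveZ v.2 (is_derive_id (0 : R) 1)) (is_derive_cst _ _ _)).
by apply: (is_derive_eq d1); rewrite addr0 /GRing.scale/= mulr1.
Qed.

Let dbtau X v : is_derive X v btau (2 * bt X * (sg * v.1)).
Proof.
apply: (is_derive_eq (is_deriveD (is_deriveM (dbt X v) (dbt X v)) (is_derive_cst dl X v))).
by rewrite /GRing.scale/=; ring.
Qed.

Let dbrho X v : is_derive X v brho (2 * bt X * (sg * v.1) + 2 * bs X * v.2).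
Proof.
apply: (is_derive_eq (is_deriveD (is_deriveD (is_deriveM (dbt X v) (dbt X v))
  (is_deriveM (dbs X v) (dbs X v))) (is_derive_cst dl X v))).
by rewrite /GRing.scale/=; ring.
Qed.

Let dtau r X v : is_derive X v (fun Y => btau Y `^ r)
  (r * btau X `^ (r - 1) * (2 * bt X * (sg * v.1))).
Proof. exact: (is_derive_comp_dir (is_derive1_powR r (btau_gt0 X)) (dbtau X v)). Qed.

Let drho r X v : is_derive X v (fun Y => brho Y `^ r)
  (r * brho X `^ (r - 1) * (2 * bt X * (sg * v.1) + 2 * bs X * v.2)).
Proof. exact: (is_derive_comp_dir (is_derive1_powR r (brho_gt0 X)) (dbrho X v)). Qed.

Definition barrier_x X : R :=
  sg * (A - K * (2 * q * (bt X * btau X `^ (q - 1))) +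
        C * (2 * q * (bt X * brho X `^ (q - 1)))).

Definition barrier_z X : R := C * (2 * q * (bs X * brho X `^ (q - 1))).

Lemma is_derive_barrier X v :
  is_derive X v barrier (barrier_x X * v.1 + barrier_z X * v.2).
Proof.
have d1 := is_deriveZ A (dbt X v).
have d2 := is_deriveZ K (is_deriveB (dtau q X v) (is_derive_cst (dl `^ q) X v)).
have d3 := is_deriveZ C (drho q X v).
apply: (is_derive_eq (is_deriveD (is_deriveB d1 d2) d3)).
by rewrite /barrier_x /barrier_z /GRing.scale/=; ring.
Qed.

Lemma is_derive_barrier_x X v : is_derive X v barrier_x
  ((- K * (2 * q * (btau X `^ (q - 1) + 2 * (q - 1) * (bt X ^+ 2 * btau X `^ (q - 2)))) +
    C * (2 * q * (brho X `^ (q - 1) + 2 * (q - 1) * (bt X ^+ 2 * brho X `^ (q - 2))))) * v.1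
   + sg * (C * (4 * q * (q - 1) * (bt X * bs X * brho X `^ (q - 2)))) * v.2).
Proof.
have d1 := is_deriveZ K (is_deriveZ (2 * q) (is_deriveM (dbt X v) (dtau (q - 1) X v))).
have d2 := is_deriveZ C (is_deriveZ (2 * q) (is_deriveM (dbt X v) (drho (q - 1) X v))).
have d3 := is_deriveZ sg (is_deriveD (is_deriveB (is_derive_cst A X v) d1) d2).
apply: (is_derive_eq d3); rewrite /GRing.scale/=.
have -> : q - 1 - 1 = q - 2 by ring.
(* Two differentiations across the side bring in [sg] squared, so the orientation disappears. *)
by ring: sg1.
Qed.

Lemma is_derive_barrier_z X v : is_derive X v barrier_z
  (sg * (C * (4 * q * (q - 1) * (bt X * bs X * brho X `^ (q - 2)))) * v.1 +
   C * (2 * q * (brho X `^ (q - 1) + 2 * (q - 1) * (bs X ^+ 2 * brho X `^ (q - 2)))) * v.2).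
Proof.
have d2 := is_deriveZ C (is_deriveZ (2 * q) (is_deriveM (dbs X v) (drho (q - 1) X v))).
apply: (is_derive_eq d2); rewrite /GRing.scale/=.
have -> : q - 1 - 1 = q - 2 by ring.
by ring.
Qed.

Lemma smooth2_barrier : smooth2 barrier.
Proof.
have st : smooth2 bt.
  apply: smooth2M; first exact: smooth2_cst.
  by apply: smooth2B; [exact: smooth2_fst|exact: smooth2_cst].
have ss : smooth2 bs by apply: smooth2B; [exact: smooth2_snd|exact: smooth2_cst].
have stau : smooth2 btau.
  by apply: smooth2D; [exact: smooth2M|exact: smooth2_cst].
have srho : smooth2 brho.
  apply: smooth2D; last exact: smooth2_cst.
  by apply: smooth2D; exact: smooth2M.
apply: smooth2D; last first.
  apply: smooth2M; first exact: smooth2_cst.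
  by apply: smooth2_powR => // X; exact: brho_gt0.
apply: smooth2B; first by apply: smooth2M => //; exact: smooth2_cst.
apply: smooth2M; first exact: smooth2_cst.
apply: smooth2B; last exact: smooth2_cst.
by apply: smooth2_powR => // X; exact: btau_gt0.
Qed.

Lemma dx_barrier : dx barrier = barrier_x.
Proof.
apply/funext => X; have [_] := is_derive_barrier X ((1, 0) : R * R).
by rewrite /= mulr1 mulr0 addr0.
Qed.

Lemma dz_barrier : dz barrier = barrier_z.
Proof.
apply/funext => X; have [_] := is_derive_barrier X ((0, 1) : R * R).
by rewrite /= mulr1 mulr0 add0r.
Qed.

Definition barrier_xx X : R :=
  - K * (2 * q * (btau X `^ (q - 1) + 2 * (q - 1) * (bt X ^+ 2 * btau X `^ (q - 2)))) +
  C * (2 * q * (brho X `^ (q - 1) + 2 * (q - 1) * (bt X ^+ 2 * brho X `^ (q - 2)))).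

Definition barrier_xz X : R :=
  sg * (C * (4 * q * (q - 1) * (bt X * bs X * brho X `^ (q - 2)))).

Definition barrier_zz X : R :=
  C * (2 * q * (brho X `^ (q - 1) + 2 * (q - 1) * (bs X ^+ 2 * brho X `^ (q - 2)))).

Lemma dxdx_barrier : dx (dx barrier) = barrier_xx.
Proof.
rewrite dx_barrier; apply/funext => X.
have [_] := is_derive_barrier_x X ((1, 0) : R * R).
by rewrite /= mulr1 mulr0 addr0.
Qed.

Lemma dzdx_barrier : dz (dx barrier) = barrier_xz.
Proof.
rewrite dx_barrier; apply/funext => X.
have [_] := is_derive_barrier_x X ((0, 1) : R * R).
by rewrite /= mulr1 mulr0 add0r.
Qed.

Lemma dxdz_barrier : dx (dz barrier) = barrier_xz.
Proof.
rewrite dz_barrier; apply/funext => X.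
have [_] := is_derive_barrier_z X ((1, 0) : R * R).
by rewrite /= mulr1 mulr0 addr0.
Qed.

Lemma dzdz_barrier : dz (dz barrier) = barrier_zz.
Proof.
rewrite dz_barrier; apply/funext => X.
have [_] := is_derive_barrier_z X ((0, 1) : R * R).
by rewrite /= mulr1 mulr0 add0r.
Qed.

End Barrier.

(** * Estimates for the barrier, uniform in [dl] *)

Section BarrierEstimates.
Context (R : realType).

(** Since |x| <= y^(1/2), the product is at most y^(q - 1/2), whose exponent is nonnegative. This
    bounds the first derivatives of the power terms independently of [dl]. *)
Lemma mul_powR_le (q x y Q : R) : 2^-1 <= q -> 0 < y -> x ^+ 2 <= y -> y <= Q ->
  `|x| * y `^ (q - 1) <= Q `^ (q - 2^-1).
Proof.
move=> q2 y0 xy yQ.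
have xs : `|x| <= y `^ 2^-1 by rewrite powR12_sqrt ?(ltW y0)// -sqrtr_sqr ler_wsqrtr.
apply: (@le_trans _ _ (y `^ 2^-1 * y `^ (q - 1))); first by rewrite ler_wpM2r ?powR_ge0.
rewrite -powRD; last by apply/implyP => _; rewrite gt_eqF.
have -> : 2^-1 + (q - 1) = q - 2^-1 by field.
by apply: ge0_ler_powR; rewrite ?nnegrE ?subr_ge0// ?(ltW y0)// (le_trans (ltW y0)).
Qed.

Lemma powR_pred (y r : R) : 0 < y -> y `^ r = y * y `^ (r - 1).
Proof.
move=> y0; rewrite -{2}(powRr1 (ltW y0)) -powRD; last by apply/implyP => _; rewrite gt_eqF.
by congr (_ `^ _); ring.
Qed.

(** The p-Laplacian in nondivergence form, up to the factor |grad|^(p-4), for gradient (x, z) and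
    Hessian entries xx, xz, zz. As |z| <= |x|, the quadratic form is at most -(kap - 3 B) x^2.
    Multiplied by p - 2 it is used for its sign only, and the trace term supplies the bound, which
    is therefore independent of p. *)
Lemma elliptic_sum_le (p x z xx xz zz B kap : R) : 2 < p ->
  z ^+ 2 <= x ^+ 2 -> 0 <= B -> xx <= - kap -> `|xz| <= B -> 0 <= zz -> zz <= B ->
  3 * B <= kap ->
  (p - 2) * (x ^+ 2 * xx + 2 * x * z * xz + z ^+ 2 * zz) +
    (x ^+ 2 + z ^+ 2) * (xx + zz) <= - (kap - 3 * B) * x ^+ 2.
Proof.
move=> p2 zx B0 hxx hxz zz0 hzz hk.
have x20 := sqr_ge0 x; have z20 := sqr_ge0 z.
have h1 : x ^+ 2 * xx <= x ^+ 2 * - kap by rewrite ler_wpM2l.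
have h2 : z ^+ 2 * zz <= x ^+ 2 * B by rewrite ler_pM.
have h3 : 2 * x * z * xz <= 2 * (x ^+ 2 * B).
  have : `|2 * x * z| <= 2 * x ^+ 2.
    rewrite ler_norml; apply/andP; split.
      by have := sqr_ge0 (x + z); rewrite sqrrD mulr2n; lra.
    by have := sqr_ge0 (x - z); rewrite sqrrB mulr2n; lra.
  move=> h; rewrite (le_trans (ler_norm _))// normrM mulrA ler_pM//.
have h4 : z ^+ 2 * xx <= 0 by rewrite mulr_ge0_le0//; lra.
have h5 : z ^+ 2 * zz <= x ^+ 2 * B by [].
have h6 : x ^+ 2 * zz <= x ^+ 2 * B by rewrite ler_wpM2l.
have S1 : x ^+ 2 * xx + 2 * x * z * xz + z ^+ 2 * zz <= - (kap - 3 * B) * x ^+ 2 by lra.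
have neg : - (kap - 3 * B) * x ^+ 2 <= 0 by rewrite mulNr oppr_le0 mulr_ge0// subr_ge0.
have S2 : (p - 2) * (x ^+ 2 * xx + 2 * x * z * xz + z ^+ 2 * zz) <= 0.
  by rewrite mulr_ge0_le0 ?subr_ge0 ?(ltW p2)// (le_trans S1).
rewrite mulrDl 2!mulrDr; have := mulr_ge0 x20 B0; lra.
Qed.

Variables (p a L q A C sg e z0 dl Q : R).
Hypotheses (p2 : 2 < p) (a0 : 0 <= a) (L0 : 0 < L) (q_gt : 2^-1 < q) (q_lt : q < 1)
  (C0 : 0 < C) (dl0 : 0 < dl) (sg1 : sg ^+ 2 = 1).
Notation M0 := (Q `^ (q - 2^-1)).
(** Solves (2q - 1) K - C = 3 C + 2 a C L. The part 3 C absorbs the second derivatives of the rho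
    term in [elliptic_sum_le]; the part 2 a C L beats the drift, with the factor 2 coming from x^2 +
    z^2 <= 2 x^2. *)
Definition barrier_K : R := C * (4 + 2 * a * L) / (2 * q - 1).
Notation K := barrier_K.
Hypothesis A_ge : 2 * K * M0 + 4 * C * M0 + 1 <= A.
Notation W := (barrier q A K C sg e z0 dl).
Notation t := (bt sg e).
Notation s := (bs z0).
Notation tau := (btau sg e dl).
Notation rho := (brho sg e z0 dl).

Let al0 : 0 < 2 * q - 1. Proof. by have := q_gt; lra. Qed.
Let q1 : 0 <= 2 * (1 - q). Proof. by have := q_lt; lra. Qed.
Let q0 : 0 < q. Proof. by have := q_gt; lra. Qed.
Let M00 : 0 <= M0. Proof. exact: powR_ge0. Qed.

Let K0 : 0 < K.
Proof.
by rewrite divr_gt0// mulr_gt0// ltr_pwDl// mulr_ge0 ?(ltW L0)// mulr_ge0.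
Qed.

Section Point.
Variable X : R * R.
Hypotheses (sL : `|s X| <= L) (rQ : rho X <= Q).

Let T1 := tau X `^ (q - 1).
Let T2 := tau X `^ (q - 2).
Let R1 := rho X `^ (q - 1).
Let R2 := rho X `^ (q - 2).

Let tau0 : 0 < tau X. Proof. exact: btau_gt0. Qed.
Let rho0 : 0 < rho X. Proof. exact: brho_gt0. Qed.

Let T1E : T1 = tau X * T2.
Proof.
by rewrite /T1 /T2 (powR_pred _ tau0) -addrA -opprD.
Qed.

Let R1E : R1 = rho X * R2.
Proof.
by rewrite /R1 /R2 (powR_pred _ rho0) -addrA -opprD.
Qed.

Let T20 : 0 < T2. Proof. exact: powR_gt0. Qed.
Let R20 : 0 < R2. Proof. exact: powR_gt0. Qed.
Let T10 : 0 < T1. Proof. exact: powR_gt0. Qed.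
Let R10 : 0 < R1. Proof. exact: powR_gt0. Qed.

Let tau_rho : tau X <= rho X.
Proof. by rewrite /btau /brho lerD2r lerDl -expr2 sqr_ge0. Qed.

Let R1T1 : R1 <= T1.
Proof.
rewrite /R1 /T1 -[q - 1]opprB !powRN lef_pV2 ?posrE ?powR_gt0//.
by apply: ge0_ler_powR; rewrite ?nnegrE ?subr_ge0// ?ltW.
Qed.

Let tT1 : `|t X| * T1 <= M0.
Proof.
apply: mul_powR_le => //; first exact: ltW.
  by rewrite /btau expr2 lerDl ltW.
exact: le_trans rQ.
Qed.

Let tR1 : `|t X| * R1 <= M0.
Proof.
apply: mul_powR_le => //; first exact: ltW.
by rewrite /brho expr2 -addrA lerDl addr_ge0 ?(ltW dl0)// -expr2 sqr_ge0.
Qed.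

Let sR1 : `|s X| * R1 <= M0.
Proof.
apply: mul_powR_le => //; first exact: ltW.
by rewrite /brho expr2 addrAC lerDr addr_ge0 ?(ltW dl0)// -expr2 sqr_ge0.
Qed.

(** The common scale of the second derivatives. It has no bound uniform in [dl] near the side, so
    all terms have to be compared in multiples of it. *)
Let H := 2 * q * T1.
Let H0 : 0 < H. Proof. by rewrite !mulr_gt0. Qed.

(** As t^2 <= tau and q < 1, the second normal derivative of tau^q is at least 2 q (2 q - 1)
    tau^(q-1). That of rho^q is at most 2 q rho^(q-1), and rho^(q-1) <= tau^(q-1). *)
Let xx_le : barrier_xx q K C sg e z0 dl X <= - (((2 * q - 1) * K - C) * H).
Proof.
rewrite /barrier_xx -/T1 -/T2 -/R1 -/R2.
have h1 : (2 * q - 1) * T1 <= T1 + 2 * (q - 1) * (t X ^+ 2 * T2).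
  have : t X ^+ 2 * T2 <= T1.
    by rewrite T1E ler_wpM2r ?(ltW T20)// /btau expr2 lerDl ltW.
  by move=> /(ler_wpM2l q1); lra.
have h2 : R1 + 2 * (q - 1) * (t X ^+ 2 * R2) <= T1.
  have : 0 <= 2 * (1 - q) * (t X ^+ 2 * R2).
    by rewrite mulr_ge0// mulr_ge0 ?sqr_ge0 ?(ltW R20).
  by have := R1T1; lra.
have h3 : K * (2 * q * ((2 * q - 1) * T1)) <=
    K * (2 * q * (T1 + 2 * (q - 1) * (t X ^+ 2 * T2))).
  by rewrite ler_wpM2l ?(ltW K0)// ler_wpM2l// mulr_ge0// ltW.
have h4 : C * (2 * q * (R1 + 2 * (q - 1) * (t X ^+ 2 * R2))) <= C * (2 * q * T1).
  by rewrite ler_wpM2l ?(ltW C0)// ler_wpM2l// mulr_ge0// ltW.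
by rewrite /H; move: h3 h4; lra.
Qed.

Let zz_ge0 : 0 <= barrier_zz q C sg e z0 dl X.
Proof.
rewrite /barrier_zz -/R1 -/R2 mulr_ge0 ?(ltW C0)// mulr_ge0//.
  by rewrite mulr_ge0// ltW.
have : s X ^+ 2 * R2 <= R1.
  rewrite R1E ler_wpM2r ?(ltW R20)// /brho expr2 addrAC lerDr.
  by rewrite addr_ge0 ?(ltW dl0)// -expr2 sqr_ge0.
move=> /(ler_wpM2l q1); have : 0 <= (2 * q - 1) * R1 by rewrite mulr_ge0 ?ltW.
by lra.
Qed.

Let zz_le : barrier_zz q C sg e z0 dl X <= C * H.
Proof.
rewrite /barrier_zz -/R1 -/R2 ler_wpM2l ?(ltW C0)// /H ler_wpM2l//.
  by rewrite mulr_ge0// ltW.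
have : 0 <= 2 * (1 - q) * (s X ^+ 2 * R2).
  by rewrite mulr_ge0// mulr_ge0 ?sqr_ge0 ?(ltW R20).
by have := R1T1; lra.
Qed.

Let sg_norm : `|sg| = 1.
Proof.
by have /eqP := sg1; rewrite sqrf_eq1 => /orP[]/eqP ->; rewrite ?normrN normr1.
Qed.

Let xz_le : `|barrier_xz q C sg e z0 dl X| <= C * H.
Proof.
have nE : `|t X * s X| = `|t X| * `|s X| by rewrite normrM.
rewrite /barrier_xz -/R2 normrM sg_norm mul1r normrM (gtr0_norm C0) ler_wpM2l ?(ltW C0)//.
have q10 : q - 1 < 0 by have := q_lt; lra.
rewrite normrM [`|t X * s X * R2|]normrM nE (gtr0_norm R20) normrM (ltr0_norm q10).
rewrite (gtr0_norm (_ : 0 < 4 * q)); last by rewrite mulr_gt0.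
have ts : 2 * (`|t X| * `|s X|) <= rho X.
  have := sqr_ge0 (`|t X| - `|s X|); rewrite sqrrB !real_normK ?num_real// /brho -!expr2.
  by rewrite mulr2n; have := dl0; lra.
have h1 : 2 * (`|t X| * `|s X|) * R2 <= T1.
  by apply: le_trans R1T1; rewrite R1E ler_wpM2r// ltW.
rewrite /H.
have nn : 0 <= 2 * (`|t X| * `|s X|) * R2 by rewrite !mulr_ge0// ltW.
have -> : 4 * q * - (q - 1) * (`|t X| * `|s X| * R2) =
   2 * q * ((1 - q) * (2 * (`|t X| * `|s X|) * R2)) by ring.
rewrite ler_wpM2l ?mulr_ge0 ?(ltW q0)//; apply: le_trans h1.
by rewrite ler_piMl//; have := q0; lra.
Qed.

Let z_le1 : `|barrier_z q C sg e z0 dl X| <= 2 * C * M0.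
Proof.
rewrite /barrier_z -/R1 !normrM (gtr0_norm C0) (gtr0_norm q0) (gtr0_norm R10).
rewrite (ger0_norm (_ : 0 <= 2))// [2 * C]mulrC -[leRHS]mulrA ler_wpM2l ?(ltW C0)//.
rewrite -mulrA ler_wpM2l//; apply: le_trans sR1.
by rewrite ler_piMl ?mulr_ge0 ?(ltW R10)// ltW.
Qed.

(** Whereas [z_le1] compares W_z with W_x, this bound is in the scale [H], in which the drift a W_z
    meets the second derivatives. *)
Let z_le2 : `|barrier_z q C sg e z0 dl X| <= C * H * L.
Proof.
rewrite /barrier_z -/R1 !normrM (gtr0_norm C0) (gtr0_norm q0) (gtr0_norm R10).
rewrite (ger0_norm (_ : 0 <= 2))// -[leRHS]mulrA ler_wpM2l ?(ltW C0)//.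
rewrite /H -[leRHS]mulrA ler_wpM2l ?mulr_ge0 ?(ltW q0)// mulrC.
by rewrite ler_pM ?(ltW R10).
Qed.

(** From [A] the concave term takes at most 2 K M0 and the rho term at most 2 C M0. What [A_ge]
    leaves makes |W_x| at least 1 and at least the bound 2 C M0 of |W_z|. *)
Let x_ge : 1 + 2 * C * M0 <= sg * barrier_x q A K C sg e z0 dl X.
Proof.
rewrite /barrier_x mulrA -expr2 sg1 mul1r -/T1 -/R1.
have twoq : 2 * q <= 2 by rewrite ler_piMr// ltW.
have twoq0 : 0 <= 2 * q by rewrite mulr_ge0// ltW.
have h1 : K * (2 * q * (t X * T1)) <= K * (2 * M0).
  rewrite ler_wpM2l ?(ltW K0)// (le_trans (ler_norm _))// normrM (ger0_norm twoq0).
  by rewrite ler_pM// normrM (gtr0_norm T10).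
have h2 : - (C * (2 * M0)) <= C * (2 * q * (t X * R1)).
  rewrite -mulrN ler_wpM2l ?(ltW C0)// lerNl (le_trans (ler_norm _))// normrN normrM.
  by rewrite (ger0_norm twoq0) ler_pM// normrM (gtr0_norm R10).
by have := A_ge; lra.
Qed.

Let x_sq_ge1 : 1 <= barrier_x q A K C sg e z0 dl X ^+ 2.
Proof.
have -> : barrier_x q A K C sg e z0 dl X ^+ 2 = (sg * barrier_x q A K C sg e z0 dl X) ^+ 2.
  by rewrite [RHS]exprMn sg1 mul1r.
have CM : 0 <= 2 * C * M0 by rewrite mulr_ge0// mulr_ge0// ltW.
by rewrite expr_ge1//; have := x_ge; lra.
Qed.

Let z_sq_le : barrier_z q C sg e z0 dl X ^+ 2 <= barrier_x q A K C sg e z0 dl X ^+ 2.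
Proof.
have -> : barrier_x q A K C sg e z0 dl X ^+ 2 = (sg * barrier_x q A K C sg e z0 dl X) ^+ 2.
  by rewrite [RHS]exprMn sg1 mul1r.
rewrite -real_normK ?num_real// ler_sqr ?nnegrE//.
  by rewrite (le_trans z_le1)//; have := x_ge; lra.
have CM : 0 <= 2 * C * M0 by rewrite mulr_ge0// mulr_ge0// ltW.
by have := x_ge; lra.
Qed.

Lemma grad2_barrier_ge1 : 1 <= grad2 W X.
Proof.
by rewrite /grad2 dx_barrier// dz_barrier// (le_trans x_sq_ge1)// lerDl sqr_ge0.
Qed.

(** The divergence of the flux is n^(m-1) times the expression in [elliptic_sum_le], which is at
    most - a C L H n. Since n^m >= 1 the product is at most - a C L H, and by [z_le2] this is at
    most a W_z. *)
Let supersolution_flux (m : R) (fx fz fxx fxz fzx fzz : R * R -> R) : m = (p - 2) / 2 ->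
  fx = barrier_x q A K C sg e z0 dl -> fz = barrier_z q C sg e z0 dl ->
  fxx = barrier_xx q K C sg e z0 dl -> fxz = barrier_xz q C sg e z0 dl ->
  fzx = barrier_xz q C sg e z0 dl -> fzz = barrier_zz q C sg e z0 dl ->
  forall n, n = fx X ^+ 2 + fz X ^+ 2 ->
  m * n `^ (m - 1) * (2 * fx X * fxx X + 2 * fz X * fzx X) * fx X + n `^ m * fxx X +
  (m * n `^ (m - 1) * (2 * fx X * fxz X + 2 * fz X * fzz X) * fz X + n `^ m * fzz X)
    <= a * fz X.
Proof.
move=> mE -> -> -> -> -> -> n nE.
have n1 : 1 <= n by rewrite nE (le_trans x_sq_ge1)// lerDl sqr_ge0.
have n0 : 0 < n by exact: lt_le_trans ltr01 n1.
have nm : n `^ m = n * n `^ (m - 1) by exact: powR_pred.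
have nm1 : 1 <= n `^ m.
  apply: (@le_trans _ _ (1 `^ m)); first by rewrite powR1.
  by apply: ge0_ler_powR; rewrite ?nnegrE ?(ltW n0)// mE divr_ge0// subr_ge0 ltW.
have nm10 : 0 <= n `^ (m - 1) by exact: powR_ge0.
rewrite {}nm in nm1 *; move: n0 n1 nm1 nm10; move: (n `^ (m - 1)) => N; rewrite {}nE.
have := @elliptic_sum_le p (barrier_x q A K C sg e z0 dl X) (barrier_z q C sg e z0 dl X)
  (barrier_xx q K C sg e z0 dl X) (barrier_xz q C sg e z0 dl X)
  (barrier_zz q C sg e z0 dl X) (C * H) (((2 * q - 1) * K - C) * H) p2 z_sq_le
  (ltW (mulr_gt0 C0 H0)) xx_le xz_le zz_ge0 zz_le.
have zL := z_le2; have zx := z_sq_le.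
have KE : (2 * q - 1) * K - C = 3 * C + 2 * a * C * L.
  by rewrite /barrier_K; field; rewrite gt_eqF.
have aCL : 0 <= a * C * L * H by rewrite !mulr_ge0// ltW.
rewrite KE => /(_ _); move: zL zx.
move: (barrier_x q A K C sg e z0 dl X) (barrier_z q C sg e z0 dl X)
  (barrier_xx q K C sg e z0 dl X) (barrier_xz q C sg e z0 dl X)
  (barrier_zz q C sg e z0 dl X) => x z xx xz zz zL zx S n0 n1 nN N0.
have {}S : (p - 2) * (x ^+ 2 * xx + 2 * x * z * xz + z ^+ 2 * zz) +
    (x ^+ 2 + z ^+ 2) * (xx + zz) <= - (a * C * L * H) * (x ^+ 2 + z ^+ 2).
  apply: (le_trans (S _)); first by lra.
  have -> : - ((3 * C + 2 * a * C * L) * H - 3 * (C * H)) * x ^+ 2 =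
    - (a * C * L * H) * (2 * x ^+ 2) by ring.
  by rewrite !mulNr lerN2 ler_wpM2l//; lra.
have -> : m * N * (2 * x * xx + 2 * z * xz) * x + (x ^+ 2 + z ^+ 2) * N * xx +
   (m * N * (2 * x * xz + 2 * z * zz) * z + (x ^+ 2 + z ^+ 2) * N * zz) =
   N * ((p - 2) * (x ^+ 2 * xx + 2 * x * z * xz + z ^+ 2 * zz) +
    (x ^+ 2 + z ^+ 2) * (xx + zz)) by rewrite mE; field.
apply: (le_trans (ler_wpM2l N0 S)).
have -> : N * (- (a * C * L * H) * (x ^+ 2 + z ^+ 2)) =
  - (a * C * L * H * ((x ^+ 2 + z ^+ 2) * N)) by ring.
apply: (@le_trans _ _ (- (a * C * L * H))); first by rewrite lerN2 ler_peMr.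
have -> : a * C * L * H = a * (C * H * L) by ring.
rewrite -mulrN ler_wpM2l//.
by move: zL; rewrite ler_norml => /andP[].
Qed.

Lemma barrier_supersolution :
  wflux_deriv W ((p - 2) / 2) (dx (dx W)) (dx (dz W)) (dx W) (dx (dx W)) X +
  wflux_deriv W ((p - 2) / 2) (dz (dx W)) (dz (dz W)) (dz W) (dz (dz W)) X <= a * dz W X.
Proof.
exact: (@supersolution_flux _ _ _ _ _ _ _ erefl (dx_barrier q A K C sg e z0 dl0)
  (dz_barrier q A K C sg e z0 dl0) (dxdx_barrier q A K C e z0 dl0 sg1)
  (dzdx_barrier q A K C e z0 dl0 sg1) (dxdz_barrier q A K C sg e z0 dl0)
  (dzdz_barrier q A K C sg e z0 dl0) _ erefl).
Qed.

Hypothesis t0 : 0 <= t X.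

(** Write tau^q = (t^2 + dl) tau^(q-1) and use tau^(q-1) <= dl^(q-1): then tau^q - dl^q <= t^2
    tau^(q-1) <= M0 t, so the concave term costs only a multiple of t. *)
Lemma barrier_ge : (A - K * M0) * t X + C * rho X `^ q <= W X.
Proof.
rewrite /barrier lerD2r mulrBl lerD2l lerN2 -[leRHS]mulrA ler_wpM2l ?(ltW K0)//.
have dlq : tau X `^ q <= t X * (t X * T1) + dl `^ q.
  rewrite -(mulr_powRB1 (ltW tau0) q0) -/T1 {1}/btau mulrDl -mulrA lerD2l.
  rewrite -(mulr_powRB1 (ltW dl0) q0) ler_wpM2l ?(ltW dl0)//.
  rewrite /T1 -[q - 1]opprB !powRN lef_pV2 ?posrE ?powR_gt0//.
  apply: ge0_ler_powR; rewrite ?nnegrE ?subr_ge0// ?(ltW q_lt) ?(ltW dl0) ?(ltW tau0)//.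
  by rewrite /btau lerDr -expr2 sqr_ge0.
have := tT1; rewrite (ger0_norm t0) => /(ler_wpM2l t0); rewrite [M0 * _]mulrC.
by lra.
Qed.

Lemma barrier_le : W X <= A * t X + C * rho X `^ q.
Proof.
rewrite /barrier lerD2r gerBl mulr_ge0 ?(ltW K0)// subr_ge0.
apply: ge0_ler_powR; rewrite ?nnegrE ?(ltW q0) ?(ltW dl0) ?(ltW tau0)//.
by rewrite /btau lerDr -expr2 sqr_ge0.
Qed.

End Point.
End BarrierEstimates.

(** * The boundary datum near an interior zero *)

Section OneDimension.
Context (R : realType).
Implicit Types (h : R -> R).

Lemma C1alpha_bounded alpha s t h : s < t -> C1alpha alpha s t h ->
  exists2 G : R, 0 < G & forall r, r \in `[s, t] -> h r <= G.
Proof.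
move=> st [ch _]; have [m _ hm] := EVT_max (ltW st) ch.
exists (`|h m| + 1) => [|r /hm hr]; first by rewrite ltr_wpDl.
by rewrite (le_trans hr)// (le_trans (ler_norm _))// lerDl.
Qed.

(** The derivative vanishes at an interior minimum, so the Hölder condition bounds it by C |r -
    r0|^alpha between r0 and r, and the mean value theorem adds one power. The constant comes from
    the Hölder condition alone, hence is the same for all minimum points. *)
Lemma C1alpha_interior_min alpha s t h : s < t -> 0 < alpha -> C1alpha alpha s t h ->
  exists2 C : R, 0 < C & forall r0, r0 \in `]s, t[ ->
    (forall r, r \in `]s, t[ -> h r0 <= h r) ->
    forall r, r \in `[s, t] -> h r <= h r0 + C * `|r - r0| `^ (1 + alpha).
Proof.
move=> st al0 [ch [h' [dh [C0 hC]]]].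
exists (`|C0| + 1) => [|r0 r0st hmin r rst]; first by rewrite ltr_wpDl.
have C1 : 0 <= `|C0| + 1 by rewrite addr_ge0.
have sub : {subset `]s, t[ <= `[s, t]} by exact: subset_itv_oo_cc.
have h'0 : h' r0 = 0.
  have d0 := derive1_at_min (ltW st) (fun x xst => @ex_derive _ _ _ _ _ _ _ (dh x xst)) r0st hmin.
  by have [_ <-] := dh r0 r0st; have [_] := d0.
have dist w : w \in `[s, t] -> `|w - r0| <= `|r - r0| -> h' w <= (`|C0| + 1) * `|r - r0| `^ alpha
     /\ - h' w <= (`|C0| + 1) * `|r - r0| `^ alpha.
  move=> wst wr; have := hC w r0 wst (sub _ r0st); rewrite h'0 subr0 => hw.
  have {}hw : `|h' w| <= (`|C0| + 1) * `|r - r0| `^ alpha.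
    rewrite (le_trans hw)//; apply: (@le_trans _ _ ((`|C0| + 1) * `|w - r0| `^ alpha)).
      by rewrite ler_wpM2r ?powR_ge0// (le_trans (ler_norm _))// lerDl.
    by rewrite ler_wpM2l//; apply: ge0_ler_powR; rewrite ?nnegrE// ltW.
  by split; apply: le_trans hw; [exact: ler_norm|rewrite -normrN; exact: ler_norm].
have [r0E|rn0] := eqVneq r r0.
  by rewrite r0E lerDl mulr_ge0// powR_ge0.
have rr0 : 0 < `|r - r0| by rewrite normr_gt0 subr_eq0.
rewrite (powR_pred _ rr0) (_ : 1 + alpha - 1 = alpha); last by ring.
rewrite -lerBlDl mulrCA; move: r0st rst; rewrite !in_itv/= => /andP[s0 t0] /andP[sr rt].
have mvt a b : a < b -> s <= a -> b <= t -> exists2 w, w \in `]a, b[ & h b - h a = h' w * (b - a).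
  move=> ab sa bt.
  have dab x : x \in `]a, b[ -> is_derive x 1 h (h' x).
    rewrite in_itv/= => /andP[ax xb]; apply: (dh x).
    by rewrite in_itv/= (le_lt_trans sa ax) (lt_le_trans xb bt).
  have cab : {within `[a, b], continuous h}.
    apply: (continuous_subspaceW _ ch) => x /=; rewrite !in_itv/= => /andP[ax xb].
    by rewrite (le_trans sa ax) (le_trans xb bt).
  exact: (MVT ab dab cab).
move: rn0; rewrite neq_lt => /orP[rlt|rgt].
- have [w] := mvt r r0 rlt sr (ltW t0); rewrite in_itv/= => /andP[rw wr] E.
  have wd : `|w - r0| <= `|r - r0| by rewrite !ltr0_norm ?subr_lt0// !opprB lerD2l lerN2 ltW.
  have wst : w \in `[s, t] by rewrite in_itv/= (le_trans sr (ltW rw)) (le_trans (ltW wr) (ltW t0)).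
  have [_ hw] := dist w wst wd.
  have nE : `|r - r0| = r0 - r by rewrite ltr0_norm ?subr_lt0// opprB.
  rewrite -[leLHS]opprB E -mulNr mulrC; move: hw; rewrite nE => hw.
  by rewrite ler_wpM2l// subr_ge0 ltW.
- have [w] := mvt r0 r rgt (ltW s0) rt; rewrite in_itv/= => /andP[rw wr] E.
  have wd : `|w - r0| <= `|r - r0| by rewrite !gtr0_norm ?subr_gt0// lerD2r ltW.
  have wst : w \in `[s, t] by rewrite in_itv/= (le_trans (ltW s0) (ltW rw)) (le_trans (ltW wr) rt).
  have [hw _] := dist w wst wd.
  have nE : `|r - r0| = r - r0 by rewrite gtr0_norm ?subr_gt0.
  rewrite E mulrC; move: hw; rewrite nE => hw.
  by rewrite ler_wpM2l// subr_ge0 ltW.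
Qed.

End OneDimension.

(** * Linear growth at contact points *)

Section Contact.
Context (R : realType).
Variables (c d L : R) (u : R * R -> R).
Hypotheses (cd : c < d) (L0 : 0 < L) (cu : {within ccyl c d L, continuous u}).

Lemma lateral_ge0 X : (forall Y, cyl c d L Y -> 0 <= u Y) -> lateral c d L X -> 0 <= u X.
Proof.
case: X => x z u0 [/= hx hz]; rewrite leNgt; apply/negP => ux.
move: hz; rewrite in_itv/= => /andP[z0 zL].
have cX : ccyl c d L (x, z).
  by split; rewrite /= in_itv/= ?(ltW z0) ?(ltW zL)//; case: hx => ->; rewrite lexx ltW.
have [r r0 hr] := within_continuous_dist2 cu cX (etrans (oppr_gt0 _) ux).
have m0 : 0 < Num.min (r / 2) ((d - c) / 2) by rewrite lt_min !divr_gt0// subr_gt0.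
have mr : Num.min (r / 2) ((d - c) / 2) < r.
  by rewrite (le_lt_trans (_ : _ <= r / 2)) ?ge_min ?lexx// ltr_pdivrMr// ltr_pMr// ltr1n.
have mdc : Num.min (r / 2) ((d - c) / 2) < d - c.
  rewrite (le_lt_trans (_ : _ <= (d - c) / 2)) ?ge_min ?lexx ?orbT//.
  by rewrite ltr_pdivrMr// ltr_pMr ?subr_gt0// ltr1n.
move: m0 mr mdc; move: (Num.min _ _) => m m0 mr mdc.
have [y yc yx] : exists2 y, c < y < d & `|y - x| < r.
  case: hx => ->; [exists (c + m)|exists (d - m)].
  - by rewrite ltrDl m0/=; lra.
  - by rewrite addrAC subrr add0r gtr0_norm.
  - by rewrite gtrBl m0 andbT; lra.
  - by rewrite addrAC subrr add0r normrN gtr0_norm.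
have cY : cyl c d L (y, z) by split; rewrite /= in_itv/= ?z0.
have ccY : ccyl c d L (y, z).
  by move: yc => /andP[cy yd]; split; rewrite /= in_itv/= ?(ltW z0) ?(ltW zL) ?(ltW cy) ?(ltW yd).
have := hr (y, z) ccY yx; rewrite /= subrr normr0 => /(_ r0).
rewrite gtr0_norm ?subr_gt0; last by apply: lt_le_trans ux _; exact: u0.
by have := u0 _ cY; lra.
Qed.

Lemma rel_boundary_le0 X :
  rel_boundary (ccyl c d L) [set Y | 0 < u Y] X -> u X <= 0.
Proof.
move=> [[cX _] clX]; rewrite leNgt; apply/negP => uX.
have [r r0 hr] := within_continuous_dist2 cu cX uX.
have [Y [[cY nY] [/= Y1 Y2]]] := clX _ (nbhsx_ballx X r r0).
have := hr Y cY; rewrite [`|Y.1 - _|]distrC [`|Y.2 - _|]distrC => /(_ Y1 Y2).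
by apply/negP; rewrite -leNgt distrC (le_trans _ (ler_norm _))// lerBrDr gerDl leNgt; apply/negP.
Qed.

End Contact.

(** * The linear bound from the barrier *)

Section LinearGrowth.
Context (R : realType).
Variables (p a l c d L : R) (u ux uz eta : R * R -> R) (v : nat -> R * R -> R).
Hypotheses (p2 : 2 < p) (a0 : 0 < a) (cd : c < d) (L0 : 0 < L).
Hypotheses (sv : forall n, smooth2 (v n)) (cv : cvg_W1p p (cyl c d L) v u ux uz)
  (meta : measurable_fun (cyl c d L) eta)
  (graph : {ae leb2 R, forall X, cyl c d L X -> beta_graph a l (u X) (eta X)})
  (weak : forall phi phix phiz, W1p0 p (cyl c d L) phi phix phiz ->
    - (\int[leb2 R]_(X in cyl c d L) (eta X * phiz X)) +
    (\int[leb2 R]_(X in cyl c d L)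
      (Num.sqrt (ux X ^+ 2 + uz X ^+ 2) `^ (p - 2) *
         (ux X * phix X + uz X * phiz X))) = 0)
  (cu : {within ccyl c d L, continuous u}).
Variables (q C G : R).
Hypotheses (q_gt : 2^-1 < q) (q_lt : q < 1) (C0 : 0 < C) (G0 : 0 < G).

(** Bounds rho on the closed cylinder; the factor 2 accounts for [dl], itself a squared distance
    within the cylinder. *)
Let Q : R := 2 * ((d - c) ^+ 2 + L ^+ 2).
Let M0 : R := Q `^ (q - 2^-1).
Let K : R := barrier_K a L q C.
(** The last summand lifts the barrier above [G] on the opposite side, where t = d - c. *)
Let A : R := 2 * K * M0 + 4 * C * M0 + 1 + G / (d - c).
(** At [X], at distance r from the contact point, t <= r gives [A]. As rho = 2 r^2 there, C rho^q =
    2 C r^2 rho^(q-1) <= 2 C M0 r gives the rest. *)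
Let mu : R := A + 2 * C * M0.

(** Both sides are treated at once: [sg] orients t = sg (x - e) so that it is the distance to the
    side through the contact point. The first boundary alternative will hold on that side, the
    bottom and the top, the second on the opposite side. *)
Lemma linear_growth : exists2 mu : R, 0 < mu &
  forall sg e z0, sg ^+ 2 = 1 -> [set c; d] e -> z0 \in `[0, L] ->
    (forall x, x \in `[c, d] -> 0 <= sg * (x - e) <= d - c) ->
    (forall X, ccyl c d L X -> ~ cyl c d L X ->
       u X <= C * ((X.2 - z0) ^+ 2) `^ q \/ (u X <= G /\ sg * (X.1 - e) = d - c)) ->
    forall X, cyl c d L X -> u X <= mu * euclid_dist X (e, z0).
Proof.
have dc0 : 0 < d - c by rewrite subr_gt0.
have al0 : 0 < 2 * q - 1 by have := q_gt; lra.
have M00 : 0 <= M0 by exact: powR_ge0.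
have K0 : 0 < K.
  by rewrite divr_gt0// mulr_gt0// ltr_pwDl// mulr_ge0 ?(ltW L0)// mulr_ge0// ltW.
have CM : 0 <= C * M0 by rewrite mulr_ge0// ltW.
have KM : 0 <= K * M0 by rewrite mulr_ge0// ltW.
have Gd : 0 < G / (d - c) by rewrite divr_gt0.
have A_ge : 2 * K * M0 + 4 * C * M0 + 1 <= A by rewrite /A lerDl ltW.
have AK : G / (d - c) <= A - K * M0 by rewrite /A; lra.
exists mu; first by rewrite /mu /A; lra.
move=> sg e z0 sg1 ecd z0L side bdry X cX.
have sub : cyl c d L `<=` ccyl c d L.
  by move=> Y [/= Y1 Y2]; split; exact: subset_itv_oo_cc.
have tE Y : bt sg e Y ^+ 2 = (Y.1 - e) ^+ 2 by rewrite /bt exprMn sg1 mul1r.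
have tb Y : ccyl c d L Y -> 0 <= bt sg e Y <= d - c by move=> [/= Y1 _]; exact: side.
have sb Y : ccyl c d L Y -> `|bs z0 Y| <= L.
  move: z0L; rewrite in_itv/= => /andP[z00 z0L] [/= _]; rewrite in_itv/= => /andP[Y0 YL].
  by rewrite /bs ler_norml; apply/andP; split; lra.
(* The barrier depends on [X]: with [dl = r^2] one has [rho X = 2 r^2]. *)
set r := euclid_dist X (e, z0); pose dl := r ^+ 2.
have rE : dl = bt sg e X ^+ 2 + bs z0 X ^+ 2.
  by rewrite /dl /r /euclid_dist sqr_sqrtr ?addr_ge0 ?sqr_ge0// tE.
have t2 Y : ccyl c d L Y -> bt sg e Y ^+ 2 <= (d - c) ^+ 2.
  by move=> /tb/andP[t0 t1]; rewrite ler_sqr ?nnegrE// ltW.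
have s2 Y : ccyl c d L Y -> bs z0 Y ^+ 2 <= L ^+ 2.
  by move=> /sb sL; rewrite -real_normK ?num_real// ler_sqr ?nnegrE// ltW.
have tX0 : 0 < bt sg e X.
  have /tb/andP[t0 _] := sub _ cX; rewrite lt_def t0 andbT -sqrf_eq0 tE sqrf_eq0 subr_eq0.
  case: cX => /= + _; rewrite in_itv/= => /andP[cX1 X1d].
  by case: ecd => ->; [rewrite gt_eqF|rewrite lt_eqF].
have r0 : 0 <= r by exact: sqrtr_ge0.
have dl0 : 0 < dl.
  by rewrite rE ltr_pwDl ?sqr_ge0// exprn_gt0.
have dlQ : dl <= (d - c) ^+ 2 + L ^+ 2 by rewrite rE lerD// ?t2 ?s2//; exact: sub.
have rhoQ Y : ccyl c d L Y -> brho sg e z0 dl Y <= Q.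
  move=> cY; have := t2 Y cY; have := s2 Y cY; rewrite /brho /Q -!expr2.
  by move: dlQ; lra.
pose W := barrier q A K C sg e z0 dl.
have W_ge Y : ccyl c d L Y ->
    (A - K * M0) * bt sg e Y + C * brho sg e z0 dl Y `^ q <= W Y.
  move=> cY; have /andP[t0 _] := tb Y cY.
  exact: (barrier_ge A (ltW a0) L0 q_gt q_lt C0 dl0 (rhoQ Y cY) t0).
have Crho Y : 0 <= C * brho sg e z0 dl Y `^ q by rewrite mulr_ge0 ?(ltW C0) ?powR_ge0.
have AKt Y : ccyl c d L Y -> 0 <= (A - K * M0) * bt sg e Y.
  move=> /tb/andP[t0 _]; rewrite mulr_ge0//; exact: (le_trans (ltW Gd)).
have uW : u X <= W X.
  apply: (comparison cd L0 p2 sv cv meta graph weak cu _ _ _ _ _ cX).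
  - exact: smooth2_barrier.
  - move=> Y /sub cY; apply: (le_trans _ (W_ge Y cY)); apply: addr_ge0; first exact: AKt.
    exact: Crho.
  - move=> Y cY nY; apply: le_trans (W_ge Y cY).
    have [h|[h h']] := bdry Y cY nY.
      apply: (le_trans h); apply: (@le_trans _ _ (C * brho sg e z0 dl Y `^ q)); last first.
        by rewrite lerDr; exact: AKt.
      rewrite ler_wpM2l ?(ltW C0)//; apply: ge0_ler_powR; rewrite ?nnegrE ?sqr_ge0 ?(ltW (brho_gt0 _ _ _ dl0 _))//.
        by have := q_gt; lra.
      by rewrite /brho -!expr2 /bs; have := sqr_ge0 (bt sg e Y); move: dl0; lra.
    apply: (le_trans h); apply: (@le_trans _ _ ((A - K * M0) * bt sg e Y)); last first.
      by rewrite lerDl; exact: Crho.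
    by rewrite /bt h' -ler_pdivrMr.
  - by move=> Y cY; exact: (grad2_barrier_ge1 (ltW a0) L0 q_gt q_lt C0 dl0 sg1 A_ge (rhoQ Y cY)).
  - move=> Y /sub cY.
    exact: (barrier_supersolution p2 (ltW a0) L0 q_gt q_lt C0 dl0 sg1 A_ge (sb Y cY) (rhoQ Y cY)).
apply: (le_trans uW); apply: (le_trans (barrier_le A sg e z0 (ltW a0) L0 q_gt C0 dl0 X)).
have rhoE : brho sg e z0 dl X = 2 * r ^+ 2 by rewrite /brho -!expr2 -rE /dl; ring.
have tr : bt sg e X <= r.
  by rewrite -ler_sqr ?nnegrE ?(ltW tX0)// -[r ^+ 2]/dl rE lerDl sqr_ge0.
have hM : r * brho sg e z0 dl X `^ (q - 1) <= M0.
  rewrite -[X in X * _](ger0_norm r0); apply: mul_powR_le; first exact: ltW.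
  - exact: brho_gt0.
  - by rewrite rhoE; have := sqr_ge0 r; lra.
  - exact: rhoQ (sub _ cX).
have A0 : 0 <= A by move: A_ge; lra.
have -> : mu * r = A * r + 2 * C * M0 * r by rewrite /mu; ring.
apply: lerD; first by rewrite ler_wpM2l.
rewrite (powR_pred _ (brho_gt0 _ _ _ dl0 _)) {1}rhoE.
have -> : C * (2 * r ^+ 2 * brho sg e z0 dl X `^ (q - 1)) =
  2 * C * r * (r * brho sg e z0 dl X `^ (q - 1)) by ring.
have -> : 2 * C * M0 * r = 2 * C * r * M0 by ring.
by rewrite ler_wpM2l// !mulr_ge0// ltW.
Qed.

End LinearGrowth.

Theorem lemma14 (R : realType) (p a l c d L mplus alpha eta0 : R)
  (g u : R * R -> R)
  (hp : 2 < p) (ha : 0 < a) (hl : 0 < l) (hcd : c < d) (hL : 0 < L)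
  (hm : 0 < mplus) (halpha : 0 < alpha < 1) (heta0 : 0 < eta0)
  (* the boundary datum *)
  (hgC1 : forall x, [set c; d] x -> C1alpha alpha 0 L (fun z => g (x, z)))
  (hgbot : forall x, [set c; d] x -> g (x, 0) = 0)
  (hgtop : forall x, [set c; d] x -> g (x, L) = mplus)
  (hgW2 : forall x, [set c; d] x ->
     W2q (2 + eta0) `]0, L[ (fun z => g (x, z)))
  (* the continuous representative of the solution *)
  (hu : weak_solution p a l c d L (boundary_datum L 0 mplus g) u)
  (hucont : {within ccyl c d L, continuous u})
  (hu0 : forall X, cyl c d L X -> 0 <= u X)
  (humono : forall x z1 z2, cyl c d L (x, z1) -> cyl c d L (x, z2) ->
     z1 <= z2 -> u (x, z1) <= u (x, z2)) :
  exists mu : R, 0 < mu /\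
    forall X0, lateral c d L X0 ->
      rel_boundary (ccyl c d L) [set X | 0 < u X] X0 ->
      forall X, cyl c d L X -> u X <= mu * euclid_dist X X0.
Proof.
have /andP[al0 al1] := halpha.
have p1 : 1 <= p by rewrite ltW// (lt_trans _ hp)// ltr1n.
have [ux [uz [eta [_ ut meta graph weak]]]] := hu.
have [v [sv cv _ _]] := ut.
have uside x z : [set c; d] x -> z \in `[0, L] -> u (x, z) = g (x, z).
  move=> hx; have [cg _] := hgC1 x hx.
  apply: (lateral_values hcd hL p1 ut hucont hx cg) => z'.
  rewrite in_itv/= => /andP[z'0 z'L].
  by rewrite /boundary_datum/= gt_eqF// lt_eqF.
have ubot x : x \in `[c, d] -> u (x, 0) = 0.
  apply: (horizontal_values hcd hL p1 ut hucont (g := fun=> 0)); first by left.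
    by apply: continuous_subspaceT => y; exact: cst_continuous.
  by move=> y _; rewrite /boundary_datum/= eqxx.
have utop x : x \in `[c, d] -> u (x, L) = mplus.
  apply: (horizontal_values hcd hL p1 ut hucont (g := fun=> mplus)); first by right.
    by apply: continuous_subspaceT => y; exact: cst_continuous.
  by move=> y _; rewrite /boundary_datum/= gt_eqF// eqxx.
have cS : [set c; d] c by left.
have dS : [set c; d] d by right.
have [Cc Cc0 hCc] := C1alpha_interior_min hL al0 (hgC1 c cS).
have [Cd Cd0 hCd] := C1alpha_interior_min hL al0 (hgC1 d dS).
have [Gc Gc0 hGc] := C1alpha_bounded hL (hgC1 c cS).
have [Gd Gd0 hGd] := C1alpha_bounded hL (hgC1 d dS).
pose C := Num.max Cc Cd; pose G := Num.max Gc Gd.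
have C0 : 0 < C by rewrite lt_max Cc0.
have G0 : 0 < G by rewrite lt_max Gc0.
pose q := (1 + alpha) / 2.
have q_gt : 2^-1 < q by rewrite /q; lra.
have q_lt : q < 1 by rewrite /q; lra.
have [mu mu0 hmu] := linear_growth hp ha hcd hL sv cv meta graph weak hucont q_gt q_lt C0 G0.
exists mu; split => // -[e z0] lX0 bX0 X cX.
have eS : [set c; d] e by case: lX0.
have z0L : z0 \in `]0, L[ by case: lX0.
have z0cL : z0 \in `[0, L] by exact: subset_itv_oo_cc.
have g_ge0 z : z \in `]0, L[ -> 0 <= g (e, z).
  move=> zL; rewrite -uside//; last exact: subset_itv_oo_cc.
  by apply: (@lateral_ge0 _ _ _ _ _ hcd hucont (e, z) hu0); split.
(* A contact point is a limit of points where u is not positive, so u <= 0 there by continuity;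
   nonnegativity passes to the side in the same way. *)
have gz0 : g (e, z0) = 0.
  apply/le_anti; rewrite g_ge0// andbT -uside//.
  exact: (rel_boundary_le0 hucont bX0).
have gC z : z \in `[0, L] -> g (e, z) <= C * ((z - z0) ^+ 2) `^ q.
  move=> zL; have gmin z' : z' \in `]0, L[ -> g (e, z0) <= g (e, z') by rewrite gz0; exact: g_ge0.
  have -> : ((z - z0) ^+ 2) `^ q = `|z - z0| `^ (1 + alpha).
    rewrite -real_normK ?num_real// -powR_mulrn// -powRrM; congr (_ `^ _).
    by rewrite /q; field.
  have : g (e, z) <= (if e == c then Cc else Cd) * `|z - z0| `^ (1 + alpha).
    rewrite -[leRHS]add0r -[X in X + _]gz0; case: ifPn => [/eqP ec|ec].
      by rewrite ec in gmin *; exact: hCc.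
    have ed : e = d by case: eS ec => [->|->//]; rewrite eqxx.
    by rewrite ed in gmin *; exact: hCd.
  move=> /le_trans; apply; rewrite ler_wpM2r ?powR_ge0//.
  by case: ifP => _; rewrite le_max lexx ?orbT.
have gG x z : [set c; d] x -> z \in `[0, L] -> g (x, z) <= G.
  by move=> hx zL; case: hx => ->; rewrite le_max ?hGc ?hGd ?orbT.
apply: (hmu (if e == c then 1 else -1)) => //.
- by case: ifP => _; rewrite ?sqrrN expr1n.
- move=> x; rewrite in_itv/= => /andP[cx xd]; case: ifPn => [/eqP ->|ec].
    by rewrite mul1r subr_ge0 cx lerD2r.
  have -> : e = d by case: eS ec => [->|->//]; rewrite eqxx.
  by rewrite mulN1r opprB subr_ge0 xd lerD2l lerN2.
move=> [x z] [/= xcd zL] nX.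
have gz : 0 <= C * ((z - z0) ^+ 2) `^ q by rewrite mulr_ge0 ?powR_ge0// ltW.
have [z00|zn0] := eqVneq z 0; first by left; rewrite {1}z00 ubot.
(* The constant value on the top equals the value of the datum at the upper end of the side through
   the contact point, so the growth bound for [g] at z = L covers the whole top. *)
have [zLE|znL] := eqVneq z L.
  left; rewrite {1}zLE utop// -(hgtop e eS) -zLE; exact: gC.
have xS : [set c; d] x.
  move: xcd zL; rewrite !in_itv/= => /andP[cx xd] /andP[z_0 z_L].
  apply: contrapT => nS; apply: nX; split; rewrite /= in_itv/= !lt_neqAle ?cx ?xd ?z_0 ?z_L !andbT.
    by apply/andP; split; apply/eqP => E; apply: nS; [left|right].
  by rewrite eq_sym zn0.
rewrite uside//; have [->|xe] := eqVneq x e; first by left; exact: gC.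
right; split; first exact: gG.
case: ifPn => [/eqP ec|ec].
  have -> : x = d by case: xS xe => [->|->//]; rewrite ec eqxx.
  by rewrite mul1r ec.
have ed : e = d by case: eS ec => [->|->//]; rewrite eqxx.
have -> : x = c by case: xS xe => [->//|->]; rewrite ed eqxx.
by rewrite ed mulN1r opprB.
Qed.
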